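(* Let $D\subset\mathbb{C}^n$ be a bounded homogeneous domain with $0\in D$ and let $\psi\in H(D)$ induce a bounded multiplication operator $M_\psi$ on $\mathcal{B}(D)$ (respectively on $\mathcal{B}_{0^*}(D)$). Then the spectrum of $M_\psi$ acting on that space is $\sigma(M_\psi)=\overline{\psi(D)}$.
   Context: A domain $D\subset\mathbb{C}^n$ is homogeneous if its group of biholomorphic self-maps acts transitively on $D$. $H(D)$ denotes the holomorphic functions $D\to\mathbb{C}$. For $f\in H(D)$ and $z\in D$, $Q_f(z)=\sup_{u\in\mathbb{C}^n\setminus\{0\}}\frac{|\nabla f(z)u|}{H_z(u,\bar u)^{1/2}}$, where $\nabla f(z)u=\sum_{j=1}^n\frac{\partial f}{\partial z_j}(z)u_j$ and $H_z$ is the Bergman metric of $D$; $\beta_f=\sup_{z\in D}Q_f(z)$. The Bloch space $\mathcal{B}(D)$ is the set of $f\in H(D)$ with $\beta_f<\infty$, with norm $\|f\|_{\mathcal{B}}=|f(0)|+\beta_f$. The $*$-little Bloch space is $\mathcal{B}_{0^*}(D)=\{f\in\mathcal{B}(D):\lim_{z\to\partial^*D}Q_f(z)=0\}$ with the same norm, where $\partial^*D$ is the distinguished boundary of $D$. $M_\psi f=\psi f$; the spectrum is $\sigma(T)=\{\lambda\in\mathbb{C}:T-\lambda I\text{ is not invertible}\}$. *)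

(* Defs.v *)
From HB Require Import structures.
From Stdlib Require Import ClassicalEpsilon.
From mathcomp Require Import all_boot all_order all_algebra.
From mathcomp Require Import all_classical all_reals all_analysis.
From mathcomp Require Import complex.
Set Implicit Arguments. Unset Strict Implicit. Unset Printing Implicit Defensive.
Import Order.TTheory GRing.Theory Num.Theory.
Local Open Scope classical_set_scope.
Local Open Scope ring_scope.

Definition cvec (R : realType) (n : nat) := 'I_n -> R[i].

Section Cn.
Variables (R : realType) (n : nat).
Local Notation C := R[i].
Local Notation V := (cvec R n).

Definition cabs (c : C) : R := Num.sqrt (complex.Re c ^+ 2 + complex.Im c ^+ 2).
Definition vzero : V := fun _ => 0.
Definition vadd (z w : V) : V := fun j => z j + w j.
Definition vsub (z w : V) : V := fun j => z j - w j.
Definition vscale (c : C) (z : V) : V := fun j => c * z j.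
Definition vnorm (z : V) : R :=
  Num.sqrt (\sum_(j < n) (complex.Re (z j) ^+ 2 + complex.Im (z j) ^+ 2)).
Definition vdist (z w : V) : R := vnorm (vsub z w).
Definition ereal_dir (j : 'I_n) : V := fun k => if k == j then 1 else 0.
Definition eimag_dir (j : 'I_n) : V := fun k => if k == j then 'i%C else 0.
Definition cdot (a u : V) : C := \sum_(j < n) a j * u j.

Definition openV (D : set V) : Prop :=
  forall z, D z -> exists2 e : R, 0 < e & forall w, vdist z w < e -> D w.
Definition vclosure (A : set V) : set V :=
  [set z | forall e : R, 0 < e -> exists2 w, A w & vdist z w < e].
Definition closedV (A : set V) : Prop := vclosure A `<=` A.
Definition cclosure (A : set C) : set C :=
  [set c | forall e : R, 0 < e -> exists2 w, A w & cabs (c - w) < e].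
Definition connectedV (D : set V) : Prop :=
  forall A B : set V, openV A -> openV B -> D `<=` A `|` B ->
    A `&` B `&` D = set0 -> D `<=` A \/ D `<=` B.
Definition domainV (D : set V) : Prop :=
  openV D /\ connectedV D /\ D !=set0.
Definition boundedV (D : set V) : Prop :=
  exists M : R, forall z, D z -> vnorm z <= M.

Definition has_cgrad (f : V -> C) (z a : V) : Prop :=
  forall e : R, 0 < e -> exists2 d : R, 0 < d & forall h : V, vnorm h < d ->
    cabs (f (vadd z h) - f z - cdot a h) <= e * vnorm h.
Definition holomorphic (D : set V) (f : V -> C) : Prop :=
  forall z, D z -> exists a, has_cgrad f z a.
(* the complex gradient (unique at points of an open set where f is holomorphic) *)
Definition cgrad (f : V -> C) (z : V) : V :=
  epsilon (inhabits vzero) (fun a => has_cgrad f z a).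
Definition continuous_on (A : set V) (f : V -> C) : Prop :=
  forall z, A z -> forall e : R, 0 < e -> exists2 d : R, 0 < d &
    forall w, A w -> vdist z w < d -> cabs (f w - f z) < e.

Definition holomorphic_map (D : set V) (F : V -> V) : Prop :=
  forall j : 'I_n, holomorphic D (fun z => F z j).
Definition biholomorphic_self_map (D : set V) (F : V -> V) : Prop :=
  holomorphic_map D F /\ (forall z, D z -> D (F z)) /\
  exists G : V -> V, [/\ holomorphic_map D G, (forall z, D z -> D (G z)),
    (forall z, D z -> G (F z) = z) & (forall z, D z -> F (G z) = z)].
Definition homogeneous (D : set V) : Prop :=
  forall z w, D z -> D w -> exists F, biholomorphic_self_map D F /\ F z = w.

(* Volume integral on C^n = R^{2n} (iterated Lebesgue integrals, which *)
(* for nonnegative measurable integrands is the Lebesgue integral).    *)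
Definition vupd (z : V) (k : nat) (c : C) : V :=
  fun j => if val j == k then c else z j.
Fixpoint iter_int (k : nat) (F : V -> \bar R) (z : V) : \bar R :=
  match k with
  | 0%N => F z
  | k'.+1 => (\int[@lebesgue_measure R]_(x in setT)
               \int[@lebesgue_measure R]_(y in setT)
                 iter_int k' F (vupd z k' (x +i* y)%C))%E
  end.
Definition vol_int (F : V -> \bar R) : \bar R := iter_int n F vzero.
Definition L2norm2 (D : set V) (f : V -> C) : \bar R :=
  vol_int (fun z => if `[< D z >] then ((cabs (f z)) ^+ 2)%:E else 0%E).

(* Bergman kernel on the diagonal, K(z,z) = sup { |f(z)|^2 : f in A^2(D), ||f|| <= 1 } *)
Definition bergman_diag (D : set V) (z : V) : R :=
  sup [set (cabs (f z)) ^+ 2 | f in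
        [set f : V -> C | holomorphic D f /\ (L2norm2 D f <= 1)%E]].

Definition rdir (phi : V -> R) (v : V) (z : V) : R :=
  derive1 (fun t : R => phi (vadd z (vscale (t%:C)%C v))) 0.
(* d^2 phi / dz_i d conj(z_j)
   = 1/4 (phi_{x_i x_j} + phi_{y_i y_j} + i (phi_{x_i y_j} - phi_{y_i x_j})) *)
Definition levi_coef (phi : V -> R) (i j : 'I_n) (z : V) : C :=
  let dd v w := rdir (rdir phi w) v z in
  ((dd (ereal_dir i) (ereal_dir j) + dd (eimag_dir i) (eimag_dir j)) / 4
   +i* ((dd (ereal_dir i) (eimag_dir j) - dd (eimag_dir i) (ereal_dir j)) / 4))%C.
Definition bergman_metric (D : set V) (z u : V) : R :=
  complex.Re (\sum_(i < n) \sum_(j < n)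
    levi_coef (fun w => ln (bergman_diag D w)) i j z * u i * (u j)^*%C).

Definition Q_ratios (D : set V) (f : V -> C) (z : V) : set R :=
  [set cabs (cdot (cgrad f z) u) / Num.sqrt (bergman_metric D z u) | u in
     [set u : V | u <> vzero]].
Definition Qf (D : set V) (f : V -> C) (z : V) : R := sup (Q_ratios D f z).
Definition beta (D : set V) (f : V -> C) : R := sup [set Qf D f z | z in D].
Definition bloch (D : set V) : set (V -> C) :=
  [set f | holomorphic D f /\
     exists M : R, forall z u, D z -> u <> vzero ->
       cabs (cdot (cgrad f z) u) / Num.sqrt (bergman_metric D z u) <= M].
Definition bloch_norm (D : set V) (f : V -> C) : R := cabs (f vzero) + beta D f.

Definition boundaryV (D : set V) : set V := vclosure D `\` D.
Definition disc_algebra (D : set V) : set (V -> C) :=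
  [set f | continuous_on (vclosure D) f /\ holomorphic D f].
Definition max_boundary (D : set V) (S : set V) : Prop :=
  closedV S /\ S `<=` boundaryV D /\
  forall f, disc_algebra D f -> forall z, vclosure D z ->
    exists2 w, S w & cabs (f z) <= cabs (f w).
Definition dist_boundary (D : set V) : set V :=
  \bigcap_(S in max_boundary D) S.

Definition little_bloch (D : set V) : set (V -> C) :=
  [set f | bloch D f /\
     forall e : R, 0 < e -> exists2 d : R, 0 < d &
       forall z, D z -> (exists2 w, dist_boundary D w & vdist z w < d) ->
         Qf D f z < e].

(* Operators on a normed function space X (a set of functions, with   *)
(* functions identified when they agree on D), and the spectrum.       *)
Definition eq_on (D : set V) (f g : V -> C) : Prop := forall z, D z -> f z = g z.
Definition mult_op (psi : V -> C) (f : V -> C) : V -> C := fun z => psi z * f z.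
Definition bounded_op (X : set (V -> C)) (nrm : (V -> C) -> R)
    (T : (V -> C) -> (V -> C)) : Prop :=
  (forall f, X f -> X (T f)) /\
  exists c : R, forall f, X f -> nrm (T f) <= c * nrm f.
Definition invertible_op (D : set V) (X : set (V -> C)) (nrm : (V -> C) -> R)
    (T : (V -> C) -> (V -> C)) : Prop :=
  exists S, [/\ bounded_op X nrm S,
    (forall f, X f -> eq_on D (S (T f)) f) &
    (forall g, X g -> eq_on D (T (S g)) g)].
Definition spectrum (D : set V) (X : set (V -> C)) (nrm : (V -> C) -> R)
    (T : (V -> C) -> (V -> C)) : set C :=
  [set lam | ~ invertible_op D X nrm (fun f z => T f z - lam * f z)].

End Cn.

(* Main.v *)
(** Put phi = 1 / (psi - lam).  If lam is at positive distance from psi(D), then phi is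
    bounded and phi psi = 1 + lam phi, so that
      Q_{phi f} <= |phi| |2 + lam phi| Q_f + |phi|^2 Q_{psi f},
    and M_phi is a bounded inverse of M_psi - lam.  Conversely a bounded inverse S is
    multiplication by phi; with c its norm, k |phi|^(k-1) Q_phi = Q_{phi^k} <= c^k for all k
    forces |phi| <= c wherever the gradient of phi does not vanish.  So phi is locally
    constant on {|phi| > c}; were lam in the closure of psi(D), this set would be nonempty,
    hence phi, and psi, constant by connectedness, with psi = lam.

    This needs the Bergman metric to be positive definite.  Write K(z) as the squared norm
    of the evaluation at z in the dual of the Bergman space.  The dual norm satisfies the
    parallelogram law, hence comes from an inner product (Jordan - von Neumann), and
    evaluations and directional derivatives depend differentiably on the point, by
    divided-difference estimates from the Cauchy formula on squares.  The metric at (z, u)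
    is then the squared distance of the derivative along u to the line spanned by the
    evaluation, divided by K(z); it is positive since an affine function vanishes at z but
    not its derivative along u. *)

From Pilot Require Import Defs.
From mathcomp Require Import all_boot all_order all_algebra.
From mathcomp Require Import all_classical all_reals all_analysis.
From mathcomp Require Import complex.
From mathcomp Require Import measurable_realfun.
From mathcomp Require Import ring lra.
Import Pilot.Defs.
Import Order.TTheory GRing.Theory Num.Theory numFieldNormedType.Exports.
Local Open Scope classical_set_scope.
Local Open Scope ring_scope.
Set Implicit Arguments.
Unset Strict Implicit.
Unset Printing Implicit Defensive.

(** * Complex modulus *)

Section Cabs.
Variable R : realType.
Local Notation C := R[i].
Implicit Types (c d : C) (x : R).

(** [bergman_diag] is a supremum over the unit ball of the Bergman space, so it is a squared dual
    norm; working with functionals avoids completeness, Riesz representation and a kernel function.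
    In return, polarization yields only the real part of a Hermitian product, so multiplication by
    [i] is tracked by hand, and expansions in the base point must be uniform over the unit ball.
    Hence remainders of order [t ^ 2] instead of [o(t)]. The definition of [holomorphic] does not
    say that the gradient is again differentiable; this comes from bounds on divided differences,
    which survive pointwise limits. Evaluations are locally bounded by a sub-mean value inequality
    applied one coordinate at a time, because the volume is an iterated integral. Lower
    semicontinuity of [|f| ^ 2], extended by zero off the open set [D], supplies the measurability.
    Positivity of the metric matters because division by zero yields 0: a degenerate direction would
    make a ratio in [Q_f] vanish and hide a nonzero gradient. *)

Lemma cabsE c : cabs c = Normc.normc c.
Proof. by case: c. Qed.

Lemma cabs_ge0 c : 0 <= cabs c. Proof. exact: sqrtr_ge0. Qed.
Lemma cabs0 : cabs (0 : C) = 0. Proof. by rewrite cabsE Normc.normc0. Qed.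
Lemma cabs1 : cabs (1 : C) = 1. Proof. by rewrite cabsE Normc.normc1. Qed.
Lemma cabsM c d : cabs (c * d) = cabs c * cabs d.
Proof. by rewrite !cabsE Normc.normcM. Qed.
Lemma cabsV c : cabs c^-1 = (cabs c)^-1.
Proof. by rewrite !cabsE Normc.normcV. Qed.
Lemma cabsN c : cabs (- c) = cabs c.
Proof. by rewrite /cabs; case: c => a b /=; rewrite !sqrrN. Qed.
Lemma cabsBC c d : cabs (c - d) = cabs (d - c).
Proof. by rewrite -cabsN opprB. Qed.
Lemma cabs_eq0 c : (cabs c == 0) = (c == 0).
Proof.
apply/eqP/eqP => [|->]; last exact: cabs0.
by rewrite cabsE => /Normc.eq0_normc.
Qed.
Lemma cabs_gt0 c : (0 < cabs c) = (c != 0).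
Proof. by rewrite lt_neqAle cabs_ge0 andbT eq_sym cabs_eq0. Qed.
Lemma cabsD c d : cabs (c + d) <= cabs c + cabs d.
Proof. by rewrite !cabsE le_normcD. Qed.
Lemma cabsB c d : cabs (c - d) <= cabs c + cabs d.
Proof. by rewrite -[cabs d]cabsN cabsD. Qed.
Lemma cabsX c n : cabs (c ^+ n) = cabs c ^+ n.
Proof. by elim: n => [|n IH]; rewrite ?expr0 ?cabs1// !exprS cabsM IH. Qed.
Lemma cabs_real x : cabs (x%:C)%C = `|x|.
Proof. by rewrite /cabs /= expr0n /= addr0 sqrtr_sqr. Qed.
Lemma cabs_i : cabs ('i%C : C) = 1.
Proof. by rewrite /cabs /= expr0n /= add0r expr1n sqrtr1. Qed.
Lemma sqr_cabs c : cabs c ^+ 2 = complex.Re c ^+ 2 + complex.Im c ^+ 2.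
Proof. by rewrite sqr_sqrtr // addr_ge0 // sqr_ge0. Qed.
Lemma Re_le_cabs c : `|complex.Re c| <= cabs c.
Proof.
rewrite -(ler_pXn2r (ltn0Sn 1)) ?nnegrE ?cabs_ge0 ?normr_ge0 //.
by rewrite sqr_cabs real_normK ?num_real // lerDl sqr_ge0.
Qed.
Lemma Im_le_cabs c : `|complex.Im c| <= cabs c.
Proof.
rewrite -(ler_pXn2r (ltn0Sn 1)) ?nnegrE ?cabs_ge0 ?normr_ge0 //.
by rewrite sqr_cabs real_normK ?num_real // lerDr sqr_ge0.
Qed.
Lemma cabs_le c : cabs c <= `|complex.Re c| + `|complex.Im c|.
Proof.
rewrite -(ler_pXn2r (ltn0Sn 1)) ?nnegrE ?cabs_ge0 ?addr_ge0 //.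
rewrite sqr_cabs sqrrD !real_normK ?num_real //.
by rewrite lerD2r lerDl mulrn_wge0 // mulr_ge0.
Qed.
Lemma cabs_dist c d e : cabs (c - e) <= cabs (c - d) + cabs (d - e).
Proof. by rewrite -(subrKA d) cabsD. Qed.
Lemma cabs_le0 c : cabs c <= 0 -> c = 0.
Proof. by move=> h; apply/eqP; rewrite -cabs_eq0 eq_le h cabs_ge0. Qed.
Lemma ReD c d : complex.Re (c + d) = complex.Re c + complex.Re d.
Proof. by case: c; case: d. Qed.
Lemma ImD c d : complex.Im (c + d) = complex.Im c + complex.Im d.
Proof. by case: c; case: d. Qed.
Lemma ReN c : complex.Re (- c) = - complex.Re c. Proof. by case: c. Qed.
Lemma ImN c : complex.Im (- c) = - complex.Im c. Proof. by case: c. Qed.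
Lemma ReM c d : complex.Re (c * d) =
  complex.Re c * complex.Re d - complex.Im c * complex.Im d.
Proof. by case: c; case: d. Qed.
Lemma ImM c d : complex.Im (c * d) =
  complex.Re c * complex.Im d + complex.Im c * complex.Re d.
Proof. by case: c; case: d. Qed.
Lemma complexP c d : complex.Re c = complex.Re d -> complex.Im c = complex.Im d ->
  c = d.
Proof. by case: c => a b; case: d => a' b' /= -> ->. Qed.

End Cabs.

(** * Integrals of continuous complex-valued functions *)

Section Cint.
Variable R : realType.
Local Notation C := R[i].
Local Notation mu := (@lebesgue_measure R).
Implicit Types (g h : R -> C) (a b : R).

Definition ccont g (t : R) := forall e : R, 0 < e -> exists2 d : R, 0 < d &
  forall s, `|s - t| < d -> cabs (g s - g t) < e.

Definition ccont_itv a b g := forall t, a <= t <= b -> ccont g t.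

Definition cint a b g : C :=
  ((\int[mu]_(t in `[a, b]) complex.Re (g t))
   +i* (\int[mu]_(t in `[a, b]) complex.Im (g t)))%C.

Lemma ccontD g h t : ccont g t -> ccont h t -> ccont (fun t => g t + h t) t.
Proof.
move=> gt ht e e0.
have e2 : 0 < e / 2 by rewrite divr_gt0.
have [d d0 dg] := gt _ e2; have [d' d'0 dh] := ht _ e2.
exists (Num.min d d'); first by rewrite lt_min d0.
move=> s; rewrite lt_min => /andP[/dg s1 /dh s2].
have -> : g s + h s - (g t + h t) = (g s - g t) + (h s - h t) by ring.
apply: le_lt_trans (cabsD _ _) _; lra.
Qed.

Lemma ccontZ c g t : ccont g t -> ccont (fun t => c * g t) t.
Proof.
move=> gt e e0.
have c0 := cabs_ge0 c; have c1 : 0 < cabs c + 1 by rewrite ltr_wpDl.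
have [d d0 dg] := gt _ (divr_gt0 e0 c1).
exists d => // s /dg; rewrite -mulrBr cabsM ltr_pdivlMr // => h.
by apply: le_lt_trans h; rewrite mulrC ler_wpM2l ?cabs_ge0 // lerDl.
Qed.

Lemma ccontB g h t : ccont g t -> ccont h t -> ccont (fun t => g t - h t) t.
Proof.
move=> gt ht; have := ccontD gt (ccontZ (-1) ht).
by under [X in ccont X]eq_fun do rewrite mulN1r.
Qed.

Lemma ccont_Re g t : ccont g t -> {for t, continuous (fun s => complex.Re (g s) : R)}.
Proof.
move=> gt; apply/cvgrPdist_lt => e e0; have [d d0 dg] := gt _ e0.
exists d => //= s /=; rewrite distrC => /dg; apply: le_lt_trans.
by rewrite distrC -ReN -ReD Re_le_cabs.
Qed.

Lemma ccont_Im g t : ccont g t -> {for t, continuous (fun s => complex.Im (g s) : R)}.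
Proof.
move=> gt; apply/cvgrPdist_lt => e e0; have [d d0 dg] := gt _ e0.
exists d => //= s /=; rewrite distrC => /dg; apply: le_lt_trans.
by rewrite distrC -ImN -ImD Im_le_cabs.
Qed.

Lemma cont_integrable a b (f : R -> R) :
  (forall t, a <= t <= b -> {for t, continuous f}) ->
  mu.-integrable `[a, b] (EFin \o f).
Proof.
move=> fc; apply: continuous_compact_integrable; first exact: segment_compact.
apply: continuous_in_subspaceT => t; rewrite inE /= in_itv /=; exact: fc.
Qed.

Lemma ccont_Re_integrable a b g : ccont_itv a b g ->
  mu.-integrable `[a, b] (EFin \o (fun t => complex.Re (g t))).
Proof. by move=> gc; apply: cont_integrable => t /gc /ccont_Re. Qed.

Lemma ccont_Im_integrable a b g : ccont_itv a b g ->
  mu.-integrable `[a, b] (EFin \o (fun t => complex.Im (g t))).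
Proof. by move=> gc; apply: cont_integrable => t /gc /ccont_Im. Qed.

Lemma eq_cint a b g h : (forall t, a <= t <= b -> g t = h t) ->
  cint a b g = cint a b h.
Proof.
move=> gh; rewrite /cint; congr (_ +i* _)%C; apply: eq_Rintegral => t;
  by rewrite inE /= in_itv /= => /gh ->.
Qed.

Lemma cintD a b g h : ccont_itv a b g -> ccont_itv a b h ->
  cint a b (fun t => g t + h t) = cint a b g + cint a b h.
Proof.
move=> gc hc; apply: complexP; rewrite ?ReD ?ImD /=.
- rewrite -RintegralD //; try exact: ccont_Re_integrable.
  by apply: eq_Rintegral => t _; rewrite ReD.
- rewrite -RintegralD //; try exact: ccont_Im_integrable.
  by apply: eq_Rintegral => t _; rewrite ImD.
Qed.

Lemma integrableZ_real a b (f : R -> R) r : mu.-integrable `[a, b] (EFin \o f) ->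
  mu.-integrable `[a, b] (EFin \o (fun t => r * f t)).
Proof. by move=> fi; apply: (@integrableZl _ _ R mu _ _ r (EFin \o f)). Qed.

Lemma cintZ a b c g : ccont_itv a b g ->
  cint a b (fun t => c * g t) = c * cint a b g.
Proof.
move=> gc; have rg := ccont_Re_integrable gc; have ig := ccont_Im_integrable gc.
apply: complexP; rewrite ?ReM ?ImM /=.
- rewrite -!RintegralZl // -RintegralB //; try exact: integrableZ_real.
  by apply: eq_Rintegral => t _; rewrite ReM.
- rewrite -!RintegralZl // -RintegralD //; try exact: integrableZ_real.
  by apply: eq_Rintegral => t _; rewrite ImM.
Qed.

Lemma cintB a b g h : ccont_itv a b g -> ccont_itv a b h ->
  cint a b (fun t => g t - h t) = cint a b g - cint a b h.
Proof.
move=> gc hc; rewrite -[- cint _ _ h]mulN1r -cintZ // -cintD //.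
- by apply: eq_cint => t _; rewrite mulN1r.
- by move=> t /hc; exact: ccontZ.
Qed.

Lemma Rint_cst a b (r : R) : a <= b -> \int[mu]_(t in `[a, b]) r = r * (b - a).
Proof.
move=> ab; rewrite Rintegral_cst // /= lebesgue_measure_itv /=.
case: ifPn => [_|] /=; first by [].
by rewrite lte_fin -leNgt => ba; have -> : b = a; [apply/eqP; rewrite eq_le ba | rewrite subrr].
Qed.

Lemma cint_cst a b c : a <= b -> cint a b (fun=> c) = c * ((b - a)%:C)%C.
Proof.
by move=> ab; rewrite /cint !Rint_cst //; case: c => x y; apply: complexP => /=; ring.
Qed.

Lemma Rint_split a b c (f : R -> R) : a <= c <= b ->
  (forall t, a <= t <= b -> {for t, continuous f}) ->
  \int[mu]_(t in `[a, b]) f t =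
  \int[mu]_(t in `[a, c]) f t + \int[mu]_(t in `[c, b]) f t.
Proof.
move=> /andP[ac cb] fc.
have := @Rintegral_itvB R f (BLeft a) (BRight b) c (cont_integrable fc).
rewrite !bnd_simp => /(_ ac cb) /eqP; rewrite subr_eq => /eqP ->.
rewrite addrC; congr (_ + _); rewrite Rintegral_itv_obnd_cbnd //.
have : mu.-integrable `[c, b] (EFin \o f).
  by apply: cont_integrable => t /andP[ct tb]; apply: fc; rewrite tb (le_trans ac).
by move=> /integrableS; apply => //; apply: subset_itvr; rewrite bnd_simp.
Qed.

Lemma cint_split a b c g : a <= c <= b -> ccont_itv a b g ->
  cint a b g = cint a c g + cint c b g.
Proof.
move=> acb gc; apply: complexP; rewrite ?ReD ?ImD /=; apply: Rint_split => // t /gc.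
- exact: ccont_Re.
- exact: ccont_Im.
Qed.

(** The real and the imaginary part are each bounded by the integral of the modulus, whence the
    factor 2; later constants absorb it. *)
Lemma cabs_cint_le a b g : a <= b -> ccont_itv a b g ->
  (cabs (cint a b g) <= 2 * \int[mu]_(t in `[a, b]) cabs (g t))%R.
Proof.
move=> ab gc.
have ci : mu.-integrable `[a, b] (EFin \o (fun t => cabs (g t))).
  apply: cont_integrable => t /gc gt.
  apply/cvgrPdist_lt => e e0; have [d d0 dg] := gt _ e0.
  exists d => //= s /=; rewrite distrC => /dg gs.
  apply: le_lt_trans gs.
  have := cabs_dist (g s) (g t) 0; have := cabs_dist (g t) (g s) 0.
  rewrite !subr0 (cabsBC (g t)) ler_norml => h1 h2; apply/andP; split; lra.
have rg := ccont_Re_integrable gc; have ig := ccont_Im_integrable gc.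
apply: le_trans (cabs_le _) _; rewrite /= mulr_natl mulr2n; apply: lerD.
- apply: le_trans (le_normr_Rintegral _ rg) _ => //.
  apply: le_Rintegral => //; first exact: (integrable_abse rg).
  by move=> t _; exact: Re_le_cabs.
- apply: le_trans (le_normr_Rintegral _ ig) _ => //.
  apply: le_Rintegral => //; first exact: (integrable_abse ig).
  by move=> t _; exact: Im_le_cabs.
Qed.

Lemma cabs_cint_bound a b g M : a <= b -> ccont_itv a b g ->
  (forall t, a <= t <= b -> cabs (g t) <= M) ->
  cabs (cint a b g) <= 2 * (M * (b - a)).
Proof.
move=> ab gc gM.
have rg := ccont_Re_integrable gc; have ig := ccont_Im_integrable gc.
have cM : mu.-integrable `[a, b] (EFin \o (fun=> M)).
  by apply: cont_integrable => t _; exact: cvg_cst.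
apply: le_trans (cabs_le _) _; rewrite /= mulr_natl mulr2n -Rint_cst //.
apply: lerD.
- apply: le_trans (le_normr_Rintegral _ rg) _ => //.
  apply: le_Rintegral => //; first exact: (integrable_abse rg).
  move=> t; rewrite /= in_itv /= => /gM; apply: le_trans; exact: Re_le_cabs.
- apply: le_trans (le_normr_Rintegral _ ig) _ => //.
  apply: le_Rintegral => //; first exact: (integrable_abse ig).
  move=> t; rewrite /= in_itv /= => /gM; apply: le_trans; exact: Im_le_cabs.
Qed.

End Cint.

(** * First-order approximations *)

Section LinApprox.
Variables (R : realType) (H : Type) (N : H -> R).
Hypothesis N0 : forall h, 0 <= N h.
Local Notation C := R[i].

(* Common form of complex derivatives in one variable ([N] the modulus) and of
   complex gradients ([N] the euclidean norm): [u h] is the value at the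
   displaced point, [u0] the value at the base point. *)
Definition lin_approx (u : H -> C) (u0 : C) (l : H -> C) := forall e : R, 0 < e -> exists2 d : R, 0 < d &
  forall h, N h < d -> cabs (u h - u0 - l h) <= e * N h.

Lemma lin_approx_lip (u : H -> C) (u0 : C) l A : (forall h, cabs (l h) <= A * N h) ->
  lin_approx u u0 l ->
  exists2 d, 0 < d & forall h, N h < d -> cabs (u h - u0) <= (A + 1) * N h.
Proof.
move=> lA /(_ 1 ltr01)[d d0 ud]; exists d => // h /ud; rewrite mul1r => hu.
rewrite -(subrK (l h) (u h - u0)); apply: le_trans (cabsD _ _) _.
by rewrite mulrDl mul1r addrC lerD.
Qed.

Lemma lin_approxD (u v : H -> C) (u0 v0 : C) l m : lin_approx u u0 l -> lin_approx v v0 m ->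
  lin_approx (fun h => u h + v h) (u0 + v0) (fun h => l h + m h).
Proof.
move=> uu vv e e0; have e2 : 0 < e / 2 by rewrite divr_gt0.
have [d d0 ud] := uu _ e2; have [d' d'0 vd] := vv _ e2.
exists (Num.min d d'); first by rewrite lt_min d0.
move=> h; rewrite lt_min => /andP[/ud h1 /vd h2].
have -> : u h + v h - (u0 + v0) - (l h + m h) =
  (u h - u0 - l h) + (v h - v0 - m h) by ring.
by apply: le_trans (cabsD _ _) _; have := N0 h; nra.
Qed.

Lemma lin_approxM (u v : H -> C) (u0 v0 : C) l m A B : 0 <= A -> 0 <= B ->
  (forall h, cabs (l h) <= A * N h) -> (forall h, cabs (m h) <= B * N h) ->
  lin_approx u u0 l -> lin_approx v v0 m ->
  lin_approx (fun h => u h * v h) (u0 * v0) (fun h => l h * v0 + u0 * m h).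
Proof.
move=> A0 B0 lA mB uu vv e e0.
have [du du0 ulip] := lin_approx_lip lA uu.
have [dv dv0 vlip] := lin_approx_lip mB vv.
(* The error splits into three terms with weights [|v0|], [|u0|] and 1, each allowed [e / K]; the
   last is the product of the two increments, of second order. *)
pose K := cabs u0 + cabs v0 + 1.
have K0 : 0 < K by rewrite ltr_pwDr // addr_ge0 // cabs_ge0.
have e1 : 0 < e / K by rewrite divr_gt0.
have [d d0 ud] := uu _ e1; have [d' d'0 vd] := vv _ e1.
pose L := (A + 1) * (B + 1).
have L0 : 0 < L by rewrite mulr_gt0 // ltr_pwDr.
pose r := Num.min (Num.min d d') (Num.min (Num.min du dv) ((e / K) / L)).
have r0 : 0 < r by rewrite !lt_min d0 d'0 du0 dv0 !divr_gt0.
exists r => // h.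
rewrite !lt_min -!andbA => /and5P[/ud h1 /vd h2 /ulip h3 /vlip h4 h5].
have -> : u h * v h - u0 * v0 - (l h * v0 + u0 * m h) =
  (u h - u0 - l h) * v0 + u0 * (v h - v0 - m h) + (u h - u0) * (v h - v0).
  by ring.
apply: le_trans (cabsD _ _) _.
apply: le_trans (lerD (cabsD _ _) (lexx _)) _; rewrite !cabsM.
have Nh := N0 h; have u00 := cabs_ge0 u0; have v00 := cabs_ge0 v0.
have h6 : cabs (u h - u0) * cabs (v h - v0) <= (e / K) * N h.
  apply: (@le_trans _ _ ((A + 1) * N h * ((B + 1) * N h))).
    by apply: ler_pM; rewrite ?cabs_ge0.
  have -> : (A + 1) * N h * ((B + 1) * N h) = (N h * L) * N h by rewrite /L; ring.
  by apply: ler_wpM2r => //; rewrite ltW // -ltr_pdivlMr.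
have eK : e = e / K * (cabs u0 + cabs v0 + 1) by rewrite -/K divfK // gt_eqF.
rewrite eK; move: h1 h2 h6.
set X := cabs _; set Y := cabs (v h - _ - _); set Z := _ * _; set E := e / K.
move=> h1 h2 h6.
have i1 : X * cabs v0 <= E * N h * cabs v0 by exact: ler_wpM2r.
have i2 : cabs u0 * Y <= cabs u0 * (E * N h) by exact: ler_wpM2l.
have -> : E * (cabs u0 + cabs v0 + 1) * N h =
  E * N h * cabs v0 + cabs u0 * (E * N h) + E * N h by ring.
exact: lerD (lerD i1 i2) h6.
Qed.

Lemma lin_approxV (u : H -> C) (u0 : C) l A : 0 <= A -> (forall h, cabs (l h) <= A * N h) ->
  u0 != 0 -> lin_approx u u0 l ->
  lin_approx (fun h => (u h)^-1) u0^-1 (fun h => - l h / u0 ^+ 2).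
Proof.
move=> A0 lA u0n0 uu e e0.
have c0 : 0 < cabs u0 by rewrite cabs_gt0.
set c := cabs u0 in c0.
have [du du0 ulip] := lin_approx_lip lA uu.
have e1 : 0 < e * c ^+ 2 / 4 by rewrite divr_gt0 // mulr_gt0 // exprn_gt0.
have [d d0 ud] := uu _ e1.
have A1 : 0 < A + 1 by rewrite ltr_pwDr.
(* The third radius keeps [|u h|] above [c / 2], so the denominator is at least [c ^ 3 / 2]; the
   fourth bounds the second-order term. Each of the two terms of the numerator then takes
   [e c ^ 3 / 4]. *)
pose r := Num.min (Num.min d du) (Num.min (c / 2 / (A + 1))
   (e * c ^+ 3 / 4 / (A + 1) ^+ 2)).
have r0 : 0 < r by rewrite !lt_min d0 du0 !divr_gt0 ?exprn_gt0 // mulr_gt0 ?exprn_gt0.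
exists r => // h; rewrite !lt_min -!andbA => /and4P[/ud h1 /ulip h2 h3 h4].
have Nh := N0 h.
have uc : c / 2 <= cabs (u h).
  have : cabs (u h - u0) <= c / 2.
    apply: (le_trans h2); rewrite mulrC -ler_pdivlMr //; exact: ltW.
  have := cabs_dist u0 (u h) 0; rewrite !subr0 (cabsBC u0) -/c; lra.
have uh0 : u h != 0 by rewrite -cabs_gt0; lra.
have -> : (u h)^-1 - u0^-1 - - l h / u0 ^+ 2 =
  ((u h - u0) * (u h - u0) - u0 * (u h - u0 - l h) + (u h - u0) * (l h - (u h - u0)))
   / (u h * u0 ^+ 2) by field; rewrite u0n0 uh0.
rewrite cabsM cabsV cabsM cabsX -/c.
have D0 : 0 < cabs (u h) * c ^+ 2 by rewrite mulr_gt0 ?exprn_gt0 // cabs_gt0.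
rewrite ler_pdivrMr //.
have -> : (u h - u0) * (u h - u0) - u0 * (u h - u0 - l h) +
  (u h - u0) * (l h - (u h - u0)) =
  (u h - u0) * l h - u0 * (u h - u0 - l h) by ring.
apply: le_trans (cabsB _ _) _; rewrite !cabsM -/c.
have i1 : cabs (u h - u0) * cabs (l h) <= (e * c ^+ 3 / 4) * N h.
  apply: (@le_trans _ _ ((A + 1) * N h * ((A + 1) * N h))).
    apply: ler_pM; rewrite ?cabs_ge0 //; apply: (le_trans (lA h)).
    by rewrite ler_wpM2r // lerDl.
  have -> : (A + 1) * N h * ((A + 1) * N h) = (N h * (A + 1) ^+ 2) * N h by ring.
  by apply: ler_wpM2r => //; rewrite -ler_pdivlMr ?exprn_gt0 // ltW.
have i2 : c * cabs (u h - u0 - l h) <= c * (e * c ^+ 2 / 4 * N h).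
  by apply: ler_wpM2l => //; exact: ltW.
have i3 : e * N h * (c / 2 * c ^+ 2) <= e * N h * (cabs (u h) * c ^+ 2).
  apply: ler_wpM2l; first by rewrite mulr_ge0 // ltW.
  by apply: ler_wpM2r => //; rewrite sqr_ge0.
apply: le_trans i3; apply: le_trans (lerD i1 i2) _; lra.
Qed.

End LinApprox.

(** * The Cauchy integral formula on rectangles *)

Section Cauchy.
Variable R : realType.
Local Notation C := R[i].
Implicit Types (g : C -> C) (w z : C).

Definition cderiv g w (a : C) := lin_approx (fun h : C => cabs h) (fun h => g (w + h)) (g w)
  (fun h => a * h).
Definition cdiff g w := exists a, cderiv g w a.
Definition ccontC g w := forall e : R, 0 < e -> exists2 d : R, 0 < d &
  forall w', cabs (w' - w) < d -> cabs (g w' - g w) < e.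

Lemma cderivM g k w a b : cderiv g w a -> cderiv k w b ->
  cderiv (fun w => g w * k w) w (a * k w + g w * b).
Proof.
move=> ga kb e e0.
have := @lin_approxM R C (fun h => cabs h) (@cabs_ge0 R) _ _ _ _ _ _ (cabs a) (cabs b)
  (cabs_ge0 a) (cabs_ge0 b) _ _ ga kb e e0.
case=> [h|h|d d0 gd]; rewrite ?cabsM //.
exists d => // h /gd; congr (cabs _ <= _); ring.
Qed.

Lemma cderivV g w a : g w != 0 -> cderiv g w a ->
  cderiv (fun w => (g w)^-1) w (- a / g w ^+ 2).
Proof.
move=> g0 ga e e0.
have := @lin_approxV R C (fun h => cabs h) (@cabs_ge0 R) _ _ _ (cabs a)
  (cabs_ge0 a) _ g0 ga e e0.
case=> [h|d d0 gd]; rewrite ?cabsM //.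
exists d => // h /gd; congr (cabs _ <= _); ring.
Qed.

Lemma cderiv_aff (al be : C) w : cderiv (fun w => al + be * w) w be.
Proof.
move=> e e0; exists 1 => // h _.
have -> : al + be * (w + h) - (al + be * w) - be * h = 0 by ring.
by rewrite cabs0 mulr_ge0 ?cabs_ge0 // ltW.
Qed.

Lemma cdiffM g k w : cdiff g w -> cdiff k w -> cdiff (fun w => g w * k w) w.
Proof. by move=> [a ga] [b kb]; eexists; exact: cderivM ga kb. Qed.

Lemma cdiff_sub_inv z w : w != z -> cdiff (fun w => (w - z)^-1) w.
Proof.
move=> wz; have := @cderiv_aff (- z) 1 w; under eq_fun do rewrite mul1r addrC.
move=> zd; eexists; apply: (cderivV _ zd); by rewrite subr_eq0.
Qed.

Lemma cdiff_cont g w : cdiff g w -> ccontC g w.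
Proof.
move=> [a ga] e e0.
have [|d d0 gd] := @lin_approx_lip _ _ _ _ _ _ (cabs a) _ ga.
  by move=> h; rewrite cabsM.
have A1 : 0 < cabs a + 1 by rewrite ltr_pwDr // cabs_ge0.
exists (Num.min d (e / (cabs a + 1))); first by rewrite lt_min d0 divr_gt0.
move=> w'; rewrite lt_min => /andP[/gd].
rewrite [w + _]addrC subrK => h1; rewrite ltr_pdivlMr // mulrC.
exact: le_lt_trans.
Qed.

Lemma cabs_pt_re (s t y : R) : cabs ((s +i* y) - (t +i* y))%C = `|s - t|.
Proof. by rewrite /cabs /= subrr expr0n addr0 sqrtr_sqr. Qed.
Lemma cabs_pt_im (s t x : R) : cabs ((x +i* s) - (x +i* t))%C = `|s - t|.
Proof. by rewrite /cabs /= subrr expr0n add0r sqrtr_sqr. Qed.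

Lemma ccontC_re g x y : ccontC g (x +i* y)%C -> ccont (fun t => g (t +i* y)%C) x.
Proof.
move=> gc e /gc[d d0 gd]; exists d => // s sx; apply: gd; by rewrite cabs_pt_re.
Qed.
Lemma ccontC_im g x y : ccontC g (x +i* y)%C -> ccont (fun t => g (x +i* t)%C) y.
Proof.
move=> gc e /gc[d d0 gd]; exists d => // s sx; apply: gd; by rewrite cabs_pt_im.
Qed.

(* The boundary is positively oriented; opposite sides share one integral. *)
Definition bdint (x0 x1 y0 y1 : R) g : C :=
  cint x0 x1 (fun t => g (t +i* y0)%C - g (t +i* y1)%C) +
  'i%C * cint y0 y1 (fun t => g (x1 +i* t)%C - g (x0 +i* t)%C).

Definition cont_h (x0 x1 y : R) g := forall t, x0 <= t <= x1 -> ccontC g (t +i* y)%C.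
Definition cont_v (y0 y1 x : R) g := forall t, y0 <= t <= y1 -> ccontC g (x +i* t)%C.

Lemma cont_h_itv x0 x1 y g : cont_h x0 x1 y g -> ccont_itv x0 x1 (fun t => g (t +i* y)%C).
Proof. by move=> gc t /gc /ccontC_re. Qed.
Lemma cont_v_itv y0 y1 x g : cont_v y0 y1 x g -> ccont_itv y0 y1 (fun t => g (x +i* t)%C).
Proof. by move=> gc t /gc /ccontC_im. Qed.

Definition cont_bd x0 x1 y0 y1 g :=
  [/\ cont_h x0 x1 y0 g, cont_h x0 x1 y1 g, cont_v y0 y1 x0 g & cont_v y0 y1 x1 g].

Lemma ccont_itvB (a b : R) (g h : R -> C) : ccont_itv a b g -> ccont_itv a b h ->
  ccont_itv a b (fun t => g t - h t).
Proof. by move=> gc hc t tab; apply: ccontB; [exact: gc|exact: hc]. Qed.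

Lemma bdint_splitx x0 x x1 y0 y1 g : x0 <= x <= x1 ->
  cont_bd x0 x1 y0 y1 g -> cont_v y0 y1 x g ->
  bdint x0 x1 y0 y1 g = bdint x0 x y0 y1 g + bdint x x1 y0 y1 g.
Proof.
move=> xx [/cont_h_itv h1 /cont_h_itv h2 /cont_v_itv h3 /cont_v_itv h4] /cont_v_itv h5.
rewrite /bdint (cint_split xx); last exact: ccont_itvB.
rewrite (cintB h4 h3) (cintB h5 h3) (cintB h4 h5); ring.
Qed.

Lemma bdint_splity x0 x1 y0 y y1 g : y0 <= y <= y1 ->
  cont_bd x0 x1 y0 y1 g -> cont_h x0 x1 y g ->
  bdint x0 x1 y0 y1 g = bdint x0 x1 y0 y g + bdint x0 x1 y y1 g.
Proof.
move=> xx [/cont_h_itv h1 /cont_h_itv h2 /cont_v_itv h3 /cont_v_itv h4] /cont_h_itv h5.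
rewrite /bdint (cint_split xx); last exact: ccont_itvB.
rewrite (cintB h1 h2) (cintB h1 h5) (cintB h5 h2); ring.
Qed.

Lemma ccontCB g h w : ccontC g w -> ccontC h w -> ccontC (fun w => g w - h w) w.
Proof.
move=> gt ht e e0.
have e2 : 0 < e / 2 by rewrite divr_gt0.
have [d d0 dg] := gt _ e2; have [d' d'0 dh] := ht _ e2.
exists (Num.min d d'); first by rewrite lt_min d0.
move=> s; rewrite lt_min => /andP[/dg s1 /dh s2].
have -> : g s - h s - (g w - h w) = (g s - g w) - (h s - h w) by ring.
apply: le_lt_trans (cabsB _ _) _; lra.
Qed.

Lemma ccontCZ c g w : ccontC g w -> ccontC (fun w => c * g w) w.
Proof.
move=> gt e e0.
have c0 := cabs_ge0 c; have c1 : 0 < cabs c + 1 by rewrite ltr_wpDl.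
have [d d0 dg] := gt _ (divr_gt0 e0 c1).
exists d => // s /dg; rewrite -mulrBr cabsM ltr_pdivlMr // => h.
by apply: le_lt_trans h; rewrite mulrC ler_wpM2l ?cabs_ge0 // lerDl.
Qed.

Lemma cont_bdB x0 x1 y0 y1 g h : cont_bd x0 x1 y0 y1 g -> cont_bd x0 x1 y0 y1 h ->
  cont_bd x0 x1 y0 y1 (fun w => g w - h w).
Proof.
move=> [g1 g2 g3 g4] [h1 h2 h3 h4]; split=> t ti; apply: ccontCB; auto.
Qed.

Lemma cont_bdZ x0 x1 y0 y1 c g : cont_bd x0 x1 y0 y1 g ->
  cont_bd x0 x1 y0 y1 (fun w => c * g w).
Proof. by move=> [g1 g2 g3 g4]; split=> t ti; apply: ccontCZ; auto. Qed.

Lemma bdintB x0 x1 y0 y1 g h : cont_bd x0 x1 y0 y1 g -> cont_bd x0 x1 y0 y1 h ->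
  bdint x0 x1 y0 y1 (fun w => g w - h w) = bdint x0 x1 y0 y1 g - bdint x0 x1 y0 y1 h.
Proof.
move=> [/cont_h_itv g1 /cont_h_itv g2 /cont_v_itv g3 /cont_v_itv g4].
move=> [/cont_h_itv h1 /cont_h_itv h2 /cont_v_itv h3 /cont_v_itv h4].
rewrite /bdint !(cintB (ccont_itvB _ _)) //; try exact: ccont_itvB.
rewrite !cintB //; try exact: ccont_itvB.
ring.
Qed.

Lemma bdintZ x0 x1 y0 y1 c g : cont_bd x0 x1 y0 y1 g ->
  bdint x0 x1 y0 y1 (fun w => c * g w) = c * bdint x0 x1 y0 y1 g.
Proof.
move=> [/cont_h_itv g1 /cont_h_itv g2 /cont_v_itv g3 /cont_v_itv g4].
rewrite /bdint mulrDr mulrCA -(cintZ c (ccont_itvB g1 g2)) -(cintZ c (ccont_itvB g4 g3)).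
by congr (_ + _ * _); apply: eq_cint => t _; rewrite mulrBr.
Qed.

Lemma eq_bdint x0 x1 y0 y1 g h :
  (forall t, x0 <= t <= x1 -> g (t +i* y0)%C = h (t +i* y0)%C) ->
  (forall t, x0 <= t <= x1 -> g (t +i* y1)%C = h (t +i* y1)%C) ->
  (forall t, y0 <= t <= y1 -> g (x0 +i* t)%C = h (x0 +i* t)%C) ->
  (forall t, y0 <= t <= y1 -> g (x1 +i* t)%C = h (x1 +i* t)%C) ->
  bdint x0 x1 y0 y1 g = bdint x0 x1 y0 y1 h.
Proof.
move=> h1 h2 h3 h4; rewrite /bdint; congr (_ + _ * _); apply: eq_cint => t ti.
- by rewrite h1 ?h2.
- by rewrite h3 ?h4.
Qed.

Lemma bdint_bound x0 x1 y0 y1 g M : x0 <= x1 -> y0 <= y1 ->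
  cont_bd x0 x1 y0 y1 g ->
  (forall t, x0 <= t <= x1 -> cabs (g (t +i* y0)%C) <= M) ->
  (forall t, x0 <= t <= x1 -> cabs (g (t +i* y1)%C) <= M) ->
  (forall t, y0 <= t <= y1 -> cabs (g (x0 +i* t)%C) <= M) ->
  (forall t, y0 <= t <= y1 -> cabs (g (x1 +i* t)%C) <= M) ->
  cabs (bdint x0 x1 y0 y1 g) <= 4 * M * ((x1 - x0) + (y1 - y0)).
Proof.
move=> xx yy [/cont_h_itv g1 /cont_h_itv g2 /cont_v_itv g3 /cont_v_itv g4] b1 b2 b3 b4.
apply: le_trans (cabsD _ _) _; rewrite cabsM cabs_i mul1r.
have -> : 4 * M * ((x1 - x0) + (y1 - y0)) =
  2 * ((M + M) * (x1 - x0)) + 2 * ((M + M) * (y1 - y0)) by ring.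
apply: lerD; apply: cabs_cint_bound => //; try exact: ccont_itvB;
  move=> t ti; apply: le_trans (cabsB _ _) _; apply: lerD; auto.
Qed.

(** The values of an affine function on opposite sides differ by a constant, so both integrals are
    explicit and cancel. *)
Lemma bdint_aff x0 x1 y0 y1 (al be : C) : x0 <= x1 -> y0 <= y1 ->
  bdint x0 x1 y0 y1 (fun w => al + be * w) = 0.
Proof.
move=> xx yy; rewrite /bdint.
rewrite (@eq_cint _ x0 x1 _ (fun=> be * 'i%C * ((y0 - y1)%:C)%C)); last first.
  by move=> t _; case: al => p q; case: be => r s; apply: complexP => /=; ring.
rewrite (@eq_cint _ y0 y1 _ (fun=> be * ((x1 - x0)%:C)%C)); last first.
  by move=> t _; case: al => p q; case: be => r s; apply: complexP => /=; ring.
rewrite !cint_cst //.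
by case: be => r s; apply: complexP => /=; ring.
Qed.

Definition cdiff_rect (x0 x1 y0 y1 : R) g :=
  forall x y, x0 <= x <= x1 -> y0 <= y <= y1 -> cdiff g (x +i* y)%C.

Lemma cdiff_rect_cont x0 x1 y0 y1 g : x0 <= x1 -> y0 <= y1 ->
  cdiff_rect x0 x1 y0 y1 g -> cont_bd x0 x1 y0 y1 g.
Proof.
move=> xx yy gd; split=> t ti; apply: cdiff_cont; apply: gd;
  by rewrite ?lexx ?xx ?yy.
Qed.

Lemma cdiff_rectS (x0 x1 y0 y1 a0 a1 b0 b1 : R) g :
  x0 <= a0 -> a1 <= x1 -> y0 <= b0 -> b1 <= y1 ->
  cdiff_rect x0 x1 y0 y1 g -> cdiff_rect a0 a1 b0 b1 g.
Proof.
move=> h1 h2 h3 h4 gd x y /andP[? ?] /andP[? ?]; apply: gd; apply/andP; split; lra.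
Qed.

Lemma four_max (eta : R) (c1 c2 c3 c4 : C) : eta <= cabs (c1 + c2 + (c3 + c4)) ->
  [\/ eta / 4 <= cabs c1, eta / 4 <= cabs c2, eta / 4 <= cabs c3 | eta / 4 <= cabs c4].
Proof.
have h := cabsD (c1 + c2) (c3 + c4); have h1 := cabsD c1 c2; have h2 := cabsD c3 c4.
move: h h1 h2; move: (cabs c1) (cabs c2) (cabs c3) (cabs c4) => r1 r2 r3 r4.
move: (cabs (c1 + c2)) (cabs (c3 + c4)) (cabs (_ + _)) => s1 s2 s3 h h1 h2 h3.
have [?|?] := leP (eta / 4) r1; first by constructor 1.
have [?|?] := leP (eta / 4) r2; first by constructor 2.
have [?|?] := leP (eta / 4) r3; first by constructor 3.
by constructor 4; lra.
Qed.

Lemma bdint_quarter x y l m g eta : 0 <= l -> 0 <= m ->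
  cdiff_rect x (x + l) y (y + m) g ->
  eta <= cabs (bdint x (x + l) y (y + m) g) ->
  exists x' y', [/\ x <= x', x' + l / 2 <= x + l, y <= y', y' + m / 2 <= y + m &
     eta / 4 <= cabs (bdint x' (x' + l / 2) y' (y' + m / 2) g)].
Proof.
move=> l0 m0 gd eb.
have xs : x <= x + l / 2 <= x + l by apply/andP; split; lra.
have ys : y <= y + m / 2 <= y + m by apply/andP; split; lra.
have cb (a0 a1 b0 b1 : R) : x <= a0 -> a0 <= a1 -> a1 <= x + l -> y <= b0 -> b0 <= b1 ->
    b1 <= y + m -> cont_bd a0 a1 b0 b1 g.
  by move=> *; apply: cdiff_rect_cont => //; exact: cdiff_rectS gd.
have cv (a b0 b1 : R) : x <= a -> a <= x + l -> y <= b0 -> b1 <= y + m -> cont_v b0 b1 a g.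
  by move=> ? ? ? ? t /andP[? ?]; apply: cdiff_cont; apply: gd; apply/andP; split; lra.
have ch (b a0 a1 : R) : x <= a0 -> a1 <= x + l -> y <= b -> b <= y + m -> cont_h a0 a1 b g.
  by move=> ? ? ? ? t /andP[? ?]; apply: cdiff_cont; apply: gd; apply/andP; split; lra.
move: eb; rewrite (bdint_splitx xs); [|apply: cb; lra|apply: cv; lra].
rewrite (bdint_splity ys); [|apply: cb; lra|apply: ch; lra].
rewrite (bdint_splity ys); [|apply: cb; lra|apply: ch; lra].
have xl : x + l = x + l / 2 + l / 2 by lra.
have ym : y + m = y + m / 2 + m / 2 by lra.
rewrite [in X in X -> _]xl [in X in X -> _]ym.
case/four_max=> h; [exists x, y|exists x, (y + m / 2)|exists (x + l / 2), y|
  exists (x + l / 2), (y + m / 2)]; split => //; clear -l0 m0; lra.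
Qed.

(** The common point is the supremum of the left ends. It locates the limit of the bisection, and
    later the limit of a sequence of difference quotients. *)
Lemma nested_real (a : nat -> R) (l : R) : 0 <= l ->
  (forall k, a k <= a k.+1) ->
  (forall k, a k.+1 + l / 2 ^+ k.+1 <= a k + l / 2 ^+ k) ->
  exists x, forall k, a k <= x <= a k + l / 2 ^+ k.
Proof.
move=> l0 inc dec.
have l2 k : 0 <= l / 2 ^+ k by rewrite divr_ge0 // exprn_ge0.
have amono m k : (m <= k)%N -> a m <= a k.
  move=> /subnKC <-; elim: (k - m)%N => [|j IH]; first by rewrite addn0.
  by rewrite addnS (le_trans IH).
have bmono m k : (m <= k)%N -> a k + l / 2 ^+ k <= a m + l / 2 ^+ m.
  move=> /subnKC <-; elim: (k - m)%N => [|j IH]; first by rewrite addn0.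
  by rewrite addnS; apply: le_trans IH.
have ub k : ubound (range a) (a k + l / 2 ^+ k).
  move=> _ [j _ <-]; have [jk|/ltnW kj] := leqP j k.
    by rewrite (le_trans (amono _ _ jk)) // lerDl.
  by apply: le_trans (bmono _ _ kj); rewrite lerDl.
exists (sup (range a)) => k; apply/andP; split.
- by apply: ub_le_sup; [exists (a 0%N + l / 2 ^+ 0); exact: ub | exists k].
- by apply: ge_sup; [exists (a 0%N), 0%N | exact: ub].
Qed.

Lemma exists_pow2 (L d : R) : 0 < d -> exists k, L / 2 ^+ k < d.
Proof.
move=> d0; have [k hk] : exists k, L / d < k%:R.
  by exists (Num.truncn (L / d)).+1; exact: truncnS_gt.
exists k; rewrite ltr_pdivrMr ?exprn_gt0 // mulrC -ltr_pdivrMr //.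
apply: lt_le_trans hk _; rewrite -natrX ler_nat; exact/ltnW/ltn_expl.
Qed.

Theorem goursat x0 x1 y0 y1 g : x0 <= x1 -> y0 <= y1 ->
  cdiff_rect x0 x1 y0 y1 g -> bdint x0 x1 y0 y1 g = 0.
Proof.
move=> xx yy gd; apply: cabs_le0; rewrite leNgt; apply/negP => eta0.
set eta := cabs _ in eta0.
pose l := x1 - x0; pose m := y1 - y0.
have l0 : 0 <= l by rewrite /l; lra.
have m0 : 0 <= m by rewrite /m; lra.
pose lk k := l / 2 ^+ k; pose mk k := m / 2 ^+ k.
have lk0 k : 0 <= lk k by rewrite divr_ge0 // exprn_ge0.
have mk0 k : 0 <= mk k by rewrite divr_ge0 // exprn_ge0.
have p2 k : (2 : R) ^+ k != 0 by rewrite expf_neq0.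
have lkS k : lk k.+1 = lk k / 2 by rewrite /lk exprS; field.
have mkS k : mk k.+1 = mk k / 2 by rewrite /mk exprS; field.
pose Q k (p : R * R) := [/\ x0 <= p.1, p.1 + lk k <= x1, y0 <= p.2, p.2 + mk k <= y1 &
  eta / 4 ^+ k <= cabs (bdint p.1 (p.1 + lk k) p.2 (p.2 + mk k) g)].
pose S k (p p' : R * R) := [/\ p.1 <= p'.1, p'.1 + lk k.+1 <= p.1 + lk k,
  p.2 <= p'.2 & p'.2 + mk k.+1 <= p.2 + mk k].
(* One choice function on all pairs drives the recursion, so the invariant [Q] is a premise and
   [(0, 0)] fills in where it fails. *)
have step (kp : nat * (R * R)) : exists p', Q kp.1 kp.2 ->
    Q kp.1.+1 p' /\ S kp.1 kp.2 p'.
  case: kp => k [px py] /=; have [qk|nq] := pselect (Q k (px, py)); last by exists (0, 0).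
  have [/= q1 q2 q3 q4 q5] := qk.
  have [|x' [y' [h1 h2 h3 h4 h5]]] := bdint_quarter (lk0 k) (mk0 k) _ q5.
    by apply: cdiff_rectS gd.
  exists (x', y') => _; rewrite /Q /S /= lkS mkS; split; split => //; try (clear -h1 h2 h3 h4 q1 q2 q3 q4; lra).
  rewrite exprS invfM mulrA mulrAC; apply: le_trans h5; lra.
have [f fP] := boolp.choice step.
pose s := fix s k := if k is k'.+1 then f (k', s k') else (x0, y0).
have Qs k : Q k (s k).
  elim: k => [|k IH]; last by have [] := fP (k, s k) IH.
  rewrite /Q /= /lk /mk !expr0 !divr1 /l /m.
  have -> : x0 + (x1 - x0) = x1 by lra.
  have -> : y0 + (y1 - y0) = y1 by lra.
  by split.
have Ss k : S k (s k) (s k.+1) by have [] := fP (k, s k) (Qs k).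
have [xs xsP] := @nested_real (fun k => (s k).1) l l0 (fun k => let: And4 h _ _ _ := Ss k in h)
  (fun k => let: And4 _ h _ _ := Ss k in h).
have [ys ysP] := @nested_real (fun k => (s k).2) m m0 (fun k => let: And4 _ _ h _ := Ss k in h)
  (fun k => let: And4 _ _ _ h := Ss k in h).
have [a ga] : cdiff g (xs +i* ys)%C.
  have [/= q1 q2 q3 q4 _] := Qs 0%N.
  have := xsP 0%N; have := ysP 0%N.
  rewrite /lk /mk !expr0 !divr1 /l /m /= in q1 q2 q3 q4 * => /andP[p1 p3] /andP[p4 p5].
  clear -gd q1 q2 q3 q4 p1 p3 p4 p5; apply: gd; apply/andP; split; lra.
pose L := l + m.
have L0 : 0 <= L by rewrite /L; lra.
(* Chosen so that [4 e L ^ 2 = (eta / 2) (L ^ 2 / (L ^ 2 + 1))] stays below [eta]; the [+ 1] covers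
   [L = 0]. *)
pose e := eta / (8 * (L ^+ 2 + 1)).
have L21 : 0 < L ^+ 2 + 1 by rewrite ltr_pwDr // sqr_ge0.
have e0 : 0 < e by rewrite divr_gt0 // mulr_gt0.
have [d d0 gda] := ga e e0.
have [k kd] := exists_pow2 L d0.
have [q1 q2 q3 q4 q5] := Qs k.
set X := (s k).1 in q1 q2 q3 q4 q5 xsP; set Y := (s k).2 in q1 q2 q3 q4 q5 ysP.
have /andP[px1 px2] := xsP k; have /andP[py1 py2] := ysP k.
rewrite -/(lk k) -/X in px1 px2; rewrite -/(mk k) -/Y in py1 py2.
pose rho := lk k + mk k.
have rhoE : rho = L / 2 ^+ k by rewrite /rho /lk /mk -mulrDl.
have rho0 : 0 <= rho by rewrite addr_ge0.
pose z := (xs +i* ys)%C.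
have near x y : X <= x <= X + lk k -> Y <= y <= Y + mk k ->
    cabs (g (x +i* y)%C - (g z - a * z + a * (x +i* y)%C)) <= e * rho.
  move=> /andP[i1 i2] /andP[i3 i4].
  have hr : cabs ((x +i* y)%C - z) <= rho.
    apply: le_trans (cabs_le _) _; rewrite /= /rho; clear -px1 px2 py1 py2 i1 i2 i3 i4.
    by apply: lerD; rewrite ler_norml; apply/andP; split; lra.
  have := gda ((x +i* y)%C - z); rewrite [_ + (_ - _)]addrC subrK -/z => hh.
  have {}hh := hh (le_lt_trans hr _).
  apply: le_trans (ler_wpM2l (ltW e0) hr); rewrite rhoE in hh.
  by have := hh kd; congr (cabs _ <= _); ring.
have XX : X <= X + lk k by rewrite lerDl.
have YY : Y <= Y + mk k by rewrite lerDl.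
have cg : cont_bd X (X + lk k) Y (Y + mk k) g.
  by apply: cdiff_rect_cont => //; apply: cdiff_rectS gd.
have ca : cont_bd X (X + lk k) Y (Y + mk k) (fun w => g z - a * z + a * w).
  by apply: cdiff_rect_cont => // ? ? _ _; eexists; exact: cderiv_aff.
(* Subtracting the affine approximation does not change the integral. The remainder [e rho] times
   the half perimeter [rho] scales with [4 ^ k] exactly as the lower bound [eta / 4 ^ k] does. *)
have : cabs (bdint X (X + lk k) Y (Y + mk k) g) <= 4 * (e * rho) * rho.
  rewrite -[bdint _ _ _ _ _]subr0 -(bdint_aff (g z - a * z) a XX YY) -bdintB //.
  have -> : 4 * (e * rho) * rho = 4 * (e * rho) * ((X + lk k - X) + (Y + mk k - Y)).
    by rewrite /rho; ring.
  by apply: bdint_bound => //; [exact: cont_bdB|..] => t ti; apply: near => //;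
    rewrite ?lexx ?XX ?YY.
apply/negP; rewrite -ltNge; apply: lt_le_trans q5.
have -> : 4 * (e * rho) * rho = 4 * e * L ^+ 2 / 4 ^+ k.
  rewrite rhoE (_ : 4 ^+ k = 2 ^+ k * 2 ^+ k); first by field.
  by rewrite -exprMn; congr (_ ^+ _); ring.
rewrite ltr_pM2r ?invr_gt0 ?exprn_gt0 //.
have -> : 4 * e * L ^+ 2 = eta / 2 * (L ^+ 2 / (L ^+ 2 + 1)).
  by rewrite /e; field; rewrite gt_eqF.
have : L ^+ 2 / (L ^+ 2 + 1) <= 1 by rewrite ler_pdivrMr // mul1r lerDl.
by move=> h; nra.
Qed.

End Cauchy.

(** * The integral of [1 / (w - z)] and Cauchy's formula *)

Section CauchyFormula.
Variable R : realType.
Local Notation C := R[i].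
Local Notation mu := (@lebesgue_measure R).
Implicit Types (g : C -> C) (w z : C).

(** Up to a factor [i], this is the joint contribution of two opposite sides of a square of
    half-side [d] to the integral of [1 / (w - z)]. Each side is seen from the centre at a right
    angle; [2 atan ((t - a) / d)] is a primitive. *)
Lemma Rint_atan (a d : R) : 0 < d ->
  \int[mu]_(t in `[a - d, a + d]) (2 * d / ((t - a) ^+ 2 + d ^+ 2)) = pi :> R.
Proof.
move=> d0; pose f t : R := 2 * d / ((t - a) ^+ 2 + d ^+ 2).
pose F : R -> R := fun t => 2 * atan ((t - a) / d).
have den t : (t - a) ^+ 2 + d ^+ 2 != 0.
  by rewrite gt_eqF // ltr_wpDl ?sqr_ge0 // exprn_gt0.
have dF (t : R) : is_derive t 1 F (f t).
  have h1 : is_derive t (1 : R) (fun s : R => (s - a) / d : R) d^-1.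
    rewrite (_ : (fun s : R => (s - a) / d : R) = d^-1 \*: (@id R - cst a)).
      by apply: is_derive_eq; rewrite subr0 /GRing.scale /= mulr1.
    by apply/funext => s; rewrite /GRing.scale /= mulrC.
  have h2 := @is_derive1_comp R atan (fun s : R => (s - a) / d) t _ _ (is_derive1_atan _) h1.
  rewrite (_ : F = (2 : R) \*: (atan \o (fun s : R => (s - a) / d))) //.
  apply: is_derive_eq; rewrite /f /GRing.scale /=.
  have dn0 : d != 0 by rewrite gt_eqF.
  have -> : 1 + ((t - a) / d) ^+ 2 = ((t - a) ^+ 2 + d ^+ 2) / d ^+ 2 by field.
  by field; rewrite den dn0.
have cf (t : R) : {for t, continuous f}.
  apply: cvgM; first exact: cvg_cst.
  apply: cvgV => //; apply: cvgD; last exact: cvg_cst.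
  by apply: cvgM; apply: cvgB; [exact: cvg_id|exact: cvg_cst|exact: cvg_id|exact: cvg_cst].
have cF (t : R) : {for t, continuous F}.
  by apply/differentiable_continuous/derivable1_diffP; have [] := dF t.
have ad : a - d < a + d by lra.
rewrite /Rintegral (continuous_FTC2 (F := F) ad).
- rewrite /F /= (_ : a + d - a = d); last by ring.
  rewrite (_ : a - d - a = - d); last by ring.
  have dn0 : d != 0 by rewrite gt_eqF.
  by rewrite mulNr (divff dn0) atanN atan1 /=; field.
- exact: continuous_subspaceT.
- split => [t _||]; first by have [] := dF t.
  + by apply: cvg_at_right_filter; exact: cF.
  + by apply: cvg_at_left_filter; exact: cF.
- by move=> t _; rewrite derive1E; have [_ ->] := dF t.
Qed.

Definition tpi : C := (0 +i* (2 * pi))%C.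

Lemma cabs_tpi : 1 <= cabs tpi.
Proof.
rewrite /cabs /= expr0n add0r sqrtr_sqr ger0_norm; last first.
  by rewrite mulr_ge0 // pi_ge0.
have := pi_ge2 R; lra.
Qed.

Lemma bdint_inv (a b d : R) : 0 < d ->
  bdint (a - d) (a + d) (b - d) (b + d) (fun w => (w - (a +i* b)%C)^-1) = tpi.
Proof.
move=> d0; rewrite /bdint.
pose fr (c t : R) : C := ((2 * d / ((t - c) ^+ 2 + d ^+ 2))%:C)%C.
have den (c t : R) : (t - c) ^+ 2 + d ^+ 2 != 0.
  by rewrite gt_eqF // ltr_wpDl ?sqr_ge0 // exprn_gt0.
have frc c x0 x1 : ccont_itv x0 x1 (fr c).
  move=> t _ e e0.
  have : {for t, continuous (fun t => 2 * d / ((t - c) ^+ 2 + d ^+ 2) : R)}.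
    apply: cvgM; first exact: cvg_cst.
    apply: cvgV => //; apply: cvgD; last exact: cvg_cst.
    by apply: cvgM; apply: cvgB; [exact: cvg_id|exact: cvg_cst|exact: cvg_id|exact: cvg_cst].
  move=> /cvgrPdist_lt /(_ _ e0) /nbhs_ballP[del /= del0 h].
  exists del => // s sd; rewrite /fr -rmorphB cabs_real distrC; apply: h.
  by rewrite /ball /= distrC.
have fri c : cint (c - d) (c + d) (fr c) = (pi%:C)%C.
  rewrite /cint /fr /= Rint_atan // Rint_cst ?mul0r //; lra.
rewrite (@eq_cint _ (a - d) (a + d) _ (fun t => 'i%C * fr a t)); last first.
  move=> t _; have := den a t; rewrite /fr => h.
  by apply: complexP => /=; field; rewrite h /= ?sqrrN ?andbT //;
    move: h; congr (_ != 0); ring.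
rewrite (@eq_cint _ (b - d) (b + d) _ (fr b)); last first.
  move=> t _; have := den b t; rewrite /fr => h.
  by apply: complexP => /=; field; rewrite /= ?andbT //;
    move: h; congr (_ != 0); ring.
rewrite cintZ // !fri; apply: complexP => /=; ring.
Qed.

Lemma pt_neq (x y a b : R) : (x != a) || (y != b) -> (x +i* y)%C != (a +i* b)%C.
Proof. by rewrite eq_complex /= negb_and. Qed.

(* The four rectangles surrounding the small square contribute nothing, by Goursat. *)
Lemma bdint_excise (x0 x1 y0 y1 a b d : R) g : 0 < d ->
  x0 <= a - d -> a + d <= x1 -> y0 <= b - d -> b + d <= y1 ->
  (forall x y, x0 <= x <= x1 -> y0 <= y <= y1 -> (x != a) || (y != b) ->
     cdiff g (x +i* y)%C) ->
  bdint x0 x1 y0 y1 g = bdint (a - d) (a + d) (b - d) (b + d) g.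
Proof.
move=> d0 h1 h2 h3 h4 gd.
have a1 : a - d < a by rewrite ltrBlDr ltrDl.
have a2 : a < a + d by rewrite ltrDl.
have b1 : b - d < b by rewrite ltrBlDr ltrDl.
have b2 : b < b + d by rewrite ltrDl.
have a3 : a - d <= a + d := ltW (lt_trans a1 a2).
have b3 : b - d <= b + d := ltW (lt_trans b1 b2).
have x2 : x0 <= a + d := le_trans h1 a3.
have x3 : a - d <= x1 := le_trans a3 h2.
have y2 : y0 <= b + d := le_trans h3 b3.
have y3 : b - d <= y1 := le_trans b3 h4.
have xx1 : x0 <= x1 := le_trans x2 h2.
have yy1 : y0 <= y1 := le_trans y2 h4.
have cv x u v : x0 <= x <= x1 -> y0 <= u -> v <= y1 -> (x != a) -> cont_v u v x g.
  move=> xx uu vv xa t /andP[ut tv]; apply: cdiff_cont; apply: gd => //; last by rewrite xa.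
  by rewrite (le_trans uu ut) (le_trans tv vv).
have ch y u v : y0 <= y <= y1 -> x0 <= u -> v <= x1 -> (y != b) -> cont_h u v y g.
  move=> xx uu vv xa t /andP[ut tv]; apply: cdiff_cont; apply: gd => //; last by rewrite xa orbT.
  by rewrite (le_trans uu ut) (le_trans tv vv).
have i1 : x0 <= a - d <= x1 by rewrite h1.
have i2 : a - d <= a + d <= x1 by rewrite a3.
have i3 : x0 <= a + d <= x1 by rewrite x2.
have j1 : y0 <= b - d <= y1 by rewrite h3.
have j2 : b - d <= b + d <= y1 by rewrite b3.
have j3 : y0 <= b + d <= y1 by rewrite y2.
have k1 : x0 <= x0 <= x1 by rewrite lexx.
have k2 : x0 <= x1 <= x1 by rewrite lexx andbT.
have k3 : y0 <= y0 <= y1 by rewrite lexx.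
have k4 : y0 <= y1 <= y1 by rewrite lexx andbT.
have n1 : a - d != a by rewrite lt_eqF.
have n2 : a + d != a by rewrite gt_eqF.
have n3 : b - d != b by rewrite lt_eqF.
have n4 : b + d != b by rewrite gt_eqF.
have n5 : x0 != a by rewrite lt_eqF // (le_lt_trans h1).
have n6 : x1 != a by rewrite gt_eqF // (lt_le_trans a2).
have n7 : y0 != b by rewrite lt_eqF // (le_lt_trans h3).
have n8 : y1 != b by rewrite gt_eqF // (lt_le_trans b2).
have gz u0 u1 v0 v1 : x0 <= u0 -> u0 <= u1 -> u1 <= x1 -> y0 <= v0 -> v0 <= v1 -> v1 <= y1 ->
    (forall x y, u0 <= x <= u1 -> v0 <= y <= v1 -> (x != a) || (y != b)) ->
    bdint u0 u1 v0 v1 g = 0.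
  move=> p1 p2 p3 p4 p5 p6 ne; apply: goursat => // x y xx yy.
  have nxy := ne _ _ xx yy; move/andP: xx => [xl xr]; move/andP: yy => [yl yr].
  apply: gd nxy; first by rewrite (le_trans p1 xl) (le_trans xr p3).
  by rewrite (le_trans p4 yl) (le_trans yr p6).
have z1 : bdint x0 (a - d) y0 y1 g = 0.
  by apply: gz => // x y /andP[_ xr] _; rewrite lt_eqF // (le_lt_trans xr).
have z2 : bdint (a + d) x1 y0 y1 g = 0.
  by apply: gz => // x y /andP[xl _] _; rewrite gt_eqF // (lt_le_trans a2).
have z3 : bdint (a - d) (a + d) y0 (b - d) g = 0.
  by apply: gz => // x y _ /andP[_ yr]; rewrite orbC lt_eqF // (le_lt_trans yr).
have z4 : bdint (a - d) (a + d) (b + d) y1 g = 0.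
  by apply: gz => // x y _ /andP[yl _]; rewrite orbC gt_eqF // (lt_le_trans b2).
rewrite (bdint_splitx i1) ?z1 ?add0r; last exact: cv.
  2: by split; [exact: ch|exact: ch|exact: cv|exact: cv].
rewrite (bdint_splitx i2) ?z2 ?addr0; last exact: cv.
  2: by split; [exact: ch|exact: ch|exact: cv|exact: cv].
rewrite (bdint_splity j1) ?z3 ?add0r; last exact: ch.
  2: by split; [exact: ch|exact: ch|exact: cv|exact: cv].
rewrite (bdint_splity j2) ?z4 ?addr0 //; last exact: ch.
by split; [exact: ch|exact: ch|exact: cv|exact: cv].
Qed.

Lemma le_eps (x y : R) : (forall e, 0 < e -> x <= y + e) -> x <= y.
Proof. by move=> h; apply/ler_addgt0Pr => e; exact: h. Qed.

Theorem cauchy_formula (x0 x1 y0 y1 a b : R) g :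
  x0 < a -> a < x1 -> y0 < b -> b < y1 -> cdiff_rect x0 x1 y0 y1 g ->
  bdint x0 x1 y0 y1 (fun w => g w / (w - (a +i* b)%C)) = g (a +i* b)%C * tpi.
Proof.
move=> h1 h2 h3 h4 gd; set z := (a +i* b)%C.
apply/eqP; rewrite -subr_eq0; apply/eqP; apply: cabs_le0; apply: le_eps => e e0.
rewrite add0r.
have e1 : 0 < e / 32 by rewrite divr_gt0.
have [|d1 d10 gz] := cdiff_cont (g := g) (w := z) _ e1.
  by apply: gd; apply/andP; split; exact: ltW.
pose d := Num.min (d1 / 4) (Num.min (Num.min (a - x0) (x1 - a)) (Num.min (b - y0) (y1 - b))).
have d0 : 0 < d by rewrite !lt_min !subr_gt0 h1 h2 h3 h4 divr_gt0.
have : d <= d by []; rewrite {2}/d !le_min -!andbA => /and5P[e2 e3 e4 e5 e6].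
have i1 : x0 <= a - d by clear -e3; lra.
have i2 : a + d <= x1 by clear -e4; lra.
have i3 : y0 <= b - d by clear -e5; lra.
have i4 : b + d <= y1 by clear -e6; lra.
have a1 : a - d < a by rewrite ltrBlDr ltrDl.
have a2 : a < a + d by rewrite ltrDl.
have b1 : b - d < b by rewrite ltrBlDr ltrDl.
have b2 : b < b + d by rewrite ltrDl.
have ad : a - d <= a + d := ltW (lt_trans a1 a2).
have bdd : b - d <= b + d := ltW (lt_trans b1 b2).
have hd x y : x0 <= x <= x1 -> y0 <= y <= y1 -> (x != a) || (y != b) ->
    cdiff (fun w => g w / (w - z)) (x +i* y)%C.
  move=> xx yy ne; apply: cdiffM; first exact: gd.
  by apply: cdiff_sub_inv; exact: pt_neq.
have vd x y : x0 <= x <= x1 -> y0 <= y <= y1 -> (x != a) || (y != b) ->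
    cdiff (fun w => (w - z)^-1) (x +i* y)%C.
  by move=> xx yy ne; apply: cdiff_sub_inv; exact: pt_neq.
rewrite (bdint_excise d0 i1 i2 i3 i4 hd).
(* [2 pi i] is written as the integral of [1 / (w - z)] over the same small square, so the integrand
   becomes [(g w - g z) / (w - z)], at most [e / 16 / d] by continuity. Four times this bound times
   the half perimeter [4 d] is [e]. *)
rewrite -(bdint_inv a b d0) -/z.
have bd k : (forall x y, x0 <= x <= x1 -> y0 <= y <= y1 -> (x != a) || (y != b) ->
    cdiff k (x +i* y)%C) -> cont_bd (a - d) (a + d) (b - d) (b + d) k.
  move=> kd; split=> t /andP[t1 t2]; apply: cdiff_cont; apply: kd.
  - by rewrite (le_trans i1 t1) (le_trans t2 i2).
  - by rewrite i3 (le_trans bdd i4).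
  - by rewrite orbC lt_eqF.
  - by rewrite (le_trans i1 t1) (le_trans t2 i2).
  - by rewrite (le_trans i3 bdd) i4.
  - by rewrite orbC gt_eqF.
  - by rewrite i1 (le_trans ad i2).
  - by rewrite (le_trans i3 t1) (le_trans t2 i4).
  - by rewrite lt_eqF.
  - by rewrite (le_trans i1 ad) i2.
  - by rewrite (le_trans i3 t1) (le_trans t2 i4).
  - by rewrite gt_eqF.
have cg := bd _ hd; have cv := bd _ vd.
rewrite -bdintZ // -bdintB //; last exact: cont_bdZ.
have -> : e = 4 * (e / 16 / d) * ((a + d - (a - d)) + (b + d - (b - d))) .
  by field; rewrite gt_eqF.
have pt x y : a - d <= x <= a + d -> b - d <= y <= b + d ->
    d <= `|x - a| \/ d <= `|y - b| ->
    cabs (g (x +i* y)%C / ((x +i* y)%C - z) - g z * ((x +i* y)%C - z)^-1) <= e / 16 / d.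
  move=> /andP[x2 x3] /andP[y2 y3] xy.
  rewrite -mulrBl cabsM cabsV.
  have hn : d <= cabs ((x +i* y)%C - z).
    case: xy => xy; apply: (le_trans xy).
    - exact: (Re_le_cabs ((x +i* y)%C - z)).
    - exact: (Im_le_cabs ((x +i* y)%C - z)).
  have hp : cabs ((x +i* y)%C - z) < d1.
    apply: le_lt_trans (cabs_le _) _ => /=.
    have xd : `|x - a| <= d by rewrite ler_distl x2.
    have yd : `|y - b| <= d by rewrite ler_distl y2.
    by clear -xd yd e2 d10; lra.
  have := gz _ hp; set A := cabs _ => hA.
  have n0 : 0 < cabs ((x +i* y)%C - z) by exact: lt_le_trans hn.
  apply: ler_pM; rewrite ?cabs_ge0 ?invr_ge0 ?cabs_ge0 //; last by rewrite lef_pV2 ?posrE.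
  by clear -hA e0; lra.
apply: bdint_bound => //; first by apply: cont_bdB => //; exact: cont_bdZ.
- move=> t tt; apply: pt; rewrite ?lexx ?bdd //; right.
  by rewrite (_ : b - d - b = - d) ?normrN ?ler_norm //; ring.
- move=> t tt; apply: pt; rewrite ?lexx ?bdd //; right.
  by rewrite (_ : b + d - b = d) ?ler_norm //; ring.
- move=> t tt; apply: pt; rewrite ?lexx ?ad //; left.
  by rewrite (_ : a - d - a = - d) ?normrN ?ler_norm //; ring.
- move=> t tt; apply: pt; rewrite ?lexx ?ad //; left.
  by rewrite (_ : a + d - a = d) ?ler_norm //; ring.
Qed.

End CauchyFormula.

(** * Divided differences of functions of one complex variable *)

Section DividedDifferences.
Variable R : realType.
Local Notation C := R[i].
Implicit Types (g : C -> C) (w z a b c : C).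

Definition insq (r : R) z := (`|complex.Re z| < r) && (`|complex.Im z| < r).

(* Bounds on divided differences of order two and one; unlike differentiability
   they pass to pointwise limits. *)
Definition dd2_bound (r K : R) g := forall a b c, insq r a -> insq r b -> insq r c ->
  a != b -> a != c ->
  cabs ((g b - g a) / (b - a) - (g c - g a) / (c - a)) <= K * cabs (b - c).
Definition dd1_bound (r K : R) g := forall a b, insq r a -> insq r b ->
  cabs (g b - g a) <= K * cabs (b - a).

Definition on_bd (r : R) w := [/\ `|complex.Re w| <= r, `|complex.Im w| <= r &
  (`|complex.Re w| == r) || (`|complex.Im w| == r)].

Lemma on_bd_far (r : R) w a : on_bd r w -> insq (r / 2) a -> r / 2 <= cabs (w - a).
Proof.
move=> [_ _ wr] /andP[a1 a2]; case/orP: wr => /eqP e.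
- apply: le_trans (Re_le_cabs _); rewrite ReD ReN.
  have := lerB_dist (complex.Re w) (complex.Re a); lra.
- apply: le_trans (Im_le_cabs _); rewrite ImD ImN.
  have := lerB_dist (complex.Im w) (complex.Im a); lra.
Qed.

Lemma on_bd_sides (r t : R) : 0 <= r -> - r <= t <= r ->
  [/\ on_bd r (t +i* - r)%C, on_bd r (t +i* r)%C, on_bd r (- r +i* t)%C &
      on_bd r (r +i* t)%C].
Proof.
move=> r0; rewrite -ler_norml => tr.
by split; split; rewrite /= ?normrN ?(ger0_norm r0) ?lexx ?eqxx ?orbT.
Qed.

Section Bounds.
Variables (r M : R) (g : C -> C).
Hypothesis r0 : 0 < r.
Hypothesis gd : forall w, `|complex.Re w| <= r -> `|complex.Im w| <= r -> cdiff g w.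
Hypothesis gM : forall w, `|complex.Re w| <= r -> `|complex.Im w| <= r -> cabs (g w) <= M.

Let bdr g := bdint (- r) r (- r) r g.

Lemma bdr_ext k h : (forall w, on_bd r w -> k w = h w) -> bdr k = bdr h.
Proof.
by move=> kh; apply: eq_bdint => t tr; apply: kh;
  have [] := on_bd_sides (ltW r0) tr.
Qed.

Lemma cdiff_bd k : (forall w, on_bd r w -> cdiff k w) -> cont_bd (- r) r (- r) r k.
Proof.
by move=> kh; split=> t tr; apply/cdiff_cont/kh; have [] := on_bd_sides (ltW r0) tr.
Qed.

Lemma bdr_bound k B : (forall w, on_bd r w -> cdiff k w) ->
  (forall w, on_bd r w -> cabs (k w) <= B) -> cabs (bdr k) <= 16 * B * r.
Proof.
move=> kd kB; have rr : - r <= r by rewrite -subr_ge0 opprK addr_ge0 // ltW.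
have -> : 16 * B * r = 4 * B * ((r - - r) + (r - - r)) by ring.
apply: bdint_bound => //; first exact: cdiff_bd.
all: by move=> t tr; apply: kB; have [] := on_bd_sides (ltW r0) tr.
Qed.

Lemma bdr_cauchy a : insq (r / 2) a -> bdr (fun w => g w * (w - a)^-1) = g a * tpi R.
Proof.
move: (r0) => rp; case: a => x y; rewrite /insq /= !ltr_norml => /andP[/andP[? ?] /andP[? ?]].
apply: cauchy_formula; try lra.
by move=> u v ur vr; apply: gd; rewrite ler_norml.
Qed.

Lemma on_bd_neq w a : on_bd r w -> insq (r / 2) a -> w != a.
Proof.
move=> wb ai; rewrite -subr_eq0 -cabs_gt0; apply: lt_le_trans (on_bd_far wb ai).
by rewrite divr_gt0.
Qed.

Lemma cabs_bd_inv w a : on_bd r w -> insq (r / 2) a -> cabs (w - a)^-1 <= 2 / r.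
Proof.
move=> wb ai; rewrite cabsV -[2 / r]invrK invf_div lef_pV2 ?posrE ?divr_gt0 //.
  exact: on_bd_far.
by rewrite cabs_gt0 subr_eq0 on_bd_neq.
Qed.

Lemma cdiff_bd_inv w a : on_bd r w -> insq (r / 2) a -> cdiff (fun w => (w - a)^-1) w.
Proof. by move=> wb ai; apply: cdiff_sub_inv; exact: on_bd_neq. Qed.

Lemma cdiff_bdg w : on_bd r w -> cdiff g w.
Proof. by case=> *; exact: gd. Qed.

Lemma cdiff_bd1 a w : insq (r / 2) a -> on_bd r w -> cdiff (fun w => g w * (w - a)^-1) w.
Proof. by move=> ai wb; exact: (cdiffM (cdiff_bdg wb) (cdiff_bd_inv wb ai)). Qed.

Lemma cdiff_bd2 a b w : insq (r / 2) a -> insq (r / 2) b -> on_bd r w ->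
  cdiff (fun w => g w * ((w - a)^-1 * (w - b)^-1)) w.
Proof.
move=> ai bi wb.
exact: (cdiffM (cdiff_bdg wb) (cdiffM (cdiff_bd_inv wb ai) (cdiff_bd_inv wb bi))).
Qed.

Lemma cdiff_bd3 a b c w : insq (r / 2) a -> insq (r / 2) b -> insq (r / 2) c ->
  on_bd r w -> cdiff (fun w => g w * ((w - a)^-1 * ((w - b)^-1 * (w - c)^-1))) w.
Proof.
move=> ai bi ci wb.
exact: (cdiffM (cdiff_bdg wb) (cdiffM (cdiff_bd_inv wb ai)
  (cdiffM (cdiff_bd_inv wb bi) (cdiff_bd_inv wb ci)))).
Qed.

(** Partial fractions under the Cauchy integral: [1 / (w - b) - 1 / (w - a) = (b - a) / ((w - a) (w
    - b))]. *)
Lemma dd1_formula a b : insq (r / 2) a -> insq (r / 2) b ->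
  (g b - g a) * tpi R = (b - a) * bdr (fun w => g w * ((w - a)^-1 * (w - b)^-1)).
Proof.
move=> ai bi; rewrite mulrBl -!bdr_cauchy // -bdintB -?bdintZ.
- apply: bdr_ext => w wb.
  have wa : w - a != 0 by rewrite subr_eq0 on_bd_neq.
  have wb' : w - b != 0 by rewrite subr_eq0 on_bd_neq.
  by field; rewrite wa wb'.
- by apply: cdiff_bd => w wb; exact: cdiff_bd2.
- by apply: cdiff_bd => w wb; exact: cdiff_bd1.
- by apply: cdiff_bd => w wb; exact: cdiff_bd1.
Qed.

Lemma le_tpi c (B : R) : cabs (c * tpi R) <= B -> cabs c <= B.
Proof.
rewrite cabsM; apply: le_trans; rewrite -{1}[cabs c]mulr1.
by apply: ler_wpM2l; [exact: cabs_ge0|exact: cabs_tpi].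
Qed.

(** The contour contributes [16 r] and each factor [1 / (w - a)] at most [2 / r], since [a] stays in
    the square of half the size: 64 with two such factors, 128 with three in [dd2_boundP]. *)
Lemma dd1_boundP : dd1_bound (r / 2) (64 * M / r) g.
Proof.
move=> a b ai bi; apply: le_tpi; rewrite dd1_formula // cabsM mulrC.
apply: ler_wpM2r; first exact: cabs_ge0.
have -> : 64 * M / r = 16 * (M * (2 / r * (2 / r))) * r by field; rewrite gt_eqF.
apply: bdr_bound => w wb.
  exact: cdiff_bd2.
rewrite !cabsM; have [w1 w2 _] := wb.
by do !apply: ler_pM; rewrite ?mulr_ge0 ?cabs_ge0 //; [exact: gM|exact: cabs_bd_inv..].
Qed.

Lemma dd2_boundP : dd2_bound (r / 2) (128 * M / r ^+ 2) g.
Proof.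
move=> a b c ai bi ci ab ac; apply: le_tpi.
have ba : b - a != 0 by rewrite subr_eq0 eq_sym.
have ca : c - a != 0 by rewrite subr_eq0 eq_sym.
rewrite mulrBl mulrAC dd1_formula // [in X in _ - X]mulrAC dd1_formula //.
rewrite mulrAC divff // mul1r [in X in _ - X]mulrAC divff // mul1r -bdintB; last 2 first.
- by apply: cdiff_bd => w wb; exact: cdiff_bd2.
- by apply: cdiff_bd => w wb; exact: cdiff_bd2.
rewrite -/(bdr _) (@bdr_ext _ (fun w => (b - c) * (g w * ((w - a)^-1 * ((w - b)^-1 * (w - c)^-1)))));
    last first.
  move=> w wb.
  have wa : w - a != 0 by rewrite subr_eq0 on_bd_neq.
  have wb' : w - b != 0 by rewrite subr_eq0 on_bd_neq.
  have wc : w - c != 0 by rewrite subr_eq0 on_bd_neq.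
  by field; rewrite wa wb' wc.
rewrite /bdr bdintZ; last first.
  by apply: cdiff_bd => w wb; exact: cdiff_bd3.
rewrite cabsM mulrC; apply: ler_wpM2r; first exact: cabs_ge0.
have -> : 128 * M / r ^+ 2 = 16 * (M * (2 / r * (2 / r * (2 / r)))) * r.
  by field; rewrite gt_eqF.
apply: bdr_bound => w wb.
  exact: cdiff_bd3.
rewrite !cabsM; have [w1 w2 _] := wb.
by do !apply: ler_pM; rewrite ?mulr_ge0 ?cabs_ge0 //; [exact: gM|exact: cabs_bd_inv..].
Qed.

End Bounds.

Lemma le_pow2 (x y K : R) : (forall k, x <= y + K / 2 ^+ k) -> x <= y.
Proof.
move=> h; apply: le_eps => e e0; have [k kK] := exists_pow2 K e0.
by apply: le_trans (h k) _; rewrite lerD2l ltW.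
Qed.

(** The bound itself is a Cauchy condition on the difference quotients at [a]; their limit along a
    sequence tending to [a] is the derivative. Differentiability of [g] is thus a conclusion, as
    required for limits of holomorphic functions. *)
Lemma dd2_bound_deriv r K g a : 0 <= K -> dd2_bound r K g -> insq r a ->
  exists al, forall b, insq r b -> cabs (g b - g a - al * (b - a)) <= K * cabs (b - a) ^+ 2.
Proof.
move=> K0 gK ai; have /andP[] := ai; rewrite !ltr_norml => /andP[a1 a2] _.
pose d := (r - complex.Re a) / 2.
have d0 : 0 < d by rewrite /d; lra.
pose b k : C := a + ((d / 2 ^+ k)%:C)%C.
have p2 k : 0 < (2 : R) ^+ k by rewrite exprn_gt0.
have dk k : 0 < d / 2 ^+ k by rewrite divr_gt0.
have bi k : insq r (b k).
  have /andP[_ h] := ai; apply/andP; split; rewrite ?ReD ?ImD /= ?addr0 //.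
  have dkd : d / 2 ^+ k <= d.
    by rewrite ler_pdivrMr // ler_peMr ?(ltW d0) // exprn_ege1 // ler1n.
  have := dk k; rewrite ltr_norml => h2; move: dkd h2; rewrite /d => dkd h2.
  by apply/andP; split; lra.
have ab k : a != b k.
  rewrite eq_sym -subr_eq0 /b addrAC subrr add0r; apply/eqP => /(congr1 (@complex.Re R)) /= /eqP.
  by rewrite gt_eqF.
pose Q w := (g w - g a) / (w - a).
have bb k : cabs (b k - b k.+1) = d / 2 ^+ k.+1.
  rewrite /b opprD addrACA subrr add0r -rmorphB cabs_real.
  rewrite (_ : d / 2 ^+ k - _ = d / 2 ^+ k.+1) ?ger0_norm //; first exact: ltW.
  by rewrite exprS; field; rewrite gt_eqF.
have Qstep k : cabs (Q (b k) - Q (b k.+1)) <= K * (d / 2 ^+ k.+1).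
  by rewrite -bb; apply: gK.
have half k : K * (d / 2 ^+ k) = K * (d / 2 ^+ k.+1) + K * (d / 2 ^+ k.+1).
  by rewrite exprS; field; rewrite gt_eqF.
(* [P] stands for the real or the imaginary part. Its values along the sequence are the centres of
   nested intervals of length [2 K d / 2 ^ k]. *)
have lim (P : C -> R) : (forall c c', `|P c - P c'| <= cabs (c - c')) ->
    exists x, forall k, `|x - P (Q (b k))| <= K * (d / 2 ^+ k).
  move=> Pl; have Ps k : `|P (Q (b k)) - P (Q (b k.+1))| <= K * (d / 2 ^+ k.+1).
    exact: le_trans (Pl _ _) (Qstep k).
  have E k : (2 * K * d) / 2 ^+ k = 2 * (K * (d / 2 ^+ k)) by ring.
  have [|k|k|x xP] := @nested_real R (fun k => P (Q (b k)) - K * (d / 2 ^+ k)) (2 * K * d).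
  - by have d0' := ltW d0; rewrite mulr_ge0 // mulr_ge0.
  - have := Ps k; have := half k; rewrite ler_norml => h /andP[h1 h2]; lra.
  - have := Ps k; have := half k; rewrite !E ler_norml => h /andP[h1 h2]; lra.
  exists x => k; have := xP k; rewrite E ler_norml => /andP[h1 h2].
  by apply/andP; split; lra.
have [|x xP] := lim (@complex.Re R).
  by move=> c c'; rewrite -ReN -ReD Re_le_cabs.
have [|y yP] := lim (@complex.Im R).
  by move=> c c'; rewrite -ImN -ImD Im_le_cabs.
exists (x +i* y)%C => c ci.
have [->|ca] := eqVneq c a; first by rewrite !subrr mulr0 subrr cabs0 expr0n mulr0.
have ca0 : c - a != 0 by rewrite subr_eq0.
have -> : g c - g a - (x +i* y)%C * (c - a) = (Q c - (x +i* y)%C) * (c - a).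
  by rewrite /Q; field.
rewrite cabsM expr2 mulrA; apply: ler_wpM2r; first exact: cabs_ge0.
apply: (@le_pow2 _ _ (3 * (K * d))) => k.
apply: le_trans (cabs_dist _ (Q (b k)) _) _.
have h1 : cabs (Q c - Q (b k)) <= K * (cabs (c - a) + d / 2 ^+ k).
  apply: le_trans (gK _ _ _ ai ci (bi k) _ (ab k)) _; first by rewrite eq_sym.
  apply: ler_wpM2l => //; rewrite /b opprD addrA.
  by apply: le_trans (cabsB _ _) _; rewrite cabs_real (ger0_norm (ltW (dk k))).
have h2 : cabs (Q (b k) - (x +i* y)%C) <= 2 * (K * (d / 2 ^+ k)).
  apply: le_trans (cabs_le _) _; rewrite ReD ReN ImD ImN /=.
  have := xP k; have := yP k; rewrite distrC [X in _ -> X <= _ -> _]distrC; lra.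
have -> : K * cabs (c - a) + 3 * (K * d) / 2 ^+ k =
  K * (cabs (c - a) + d / 2 ^+ k) + 2 * (K * (d / 2 ^+ k)) by ring.
exact: lerD.
Qed.

Lemma quad_cderiv (K d : R) g a al : 0 <= K -> 0 < d ->
  (forall h, cabs h < d -> cabs (g (a + h) - g a - al * h) <= K * cabs h ^+ 2) ->
  cderiv g a al.
Proof.
move=> K0 d0 gK e e0; exists (Num.min d (e / (K + 1))).
  by rewrite lt_min d0 divr_gt0 // ltr_pwDr.
move=> h; rewrite lt_min => /andP[/gK h1].
rewrite ltr_pdivlMr ?ltr_pwDr // => h2; apply: (le_trans h1).
rewrite expr2 mulrA; apply: ler_wpM2r; first exact: cabs_ge0.
by have := cabs_ge0 h; nra.
Qed.

Lemma cderiv_unique g a al be : cderiv g a al -> cderiv g a be -> al = be.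
Proof.
move=> ga gb; apply/eqP; rewrite -subr_eq0; apply/eqP/cabs_le0/le_eps => e e0.
rewrite add0r; have e2 : 0 < e / 2 by rewrite divr_gt0.
have [d d0 da] := ga _ e2; have [d' d'0 db] := gb _ e2.
pose m := Num.min d d' / 2.
have m0 : 0 < m by rewrite divr_gt0 // lt_min d0.
have hm : cabs ((m%:C)%C : C) = m by rewrite cabs_real gtr0_norm.
have [h1 h2] : m < d /\ m < d'.
  have : 2 * m <= d by rewrite /m mulrC divfK // ge_min lexx.
  have : 2 * m <= d' by rewrite /m mulrC divfK // ge_min lexx orbT.
  by split; lra.
have := da (m%:C)%C; have := db (m%:C)%C; rewrite hm => /(_ h2) q2 /(_ h1) q1.
rewrite -(ler_pM2r m0) -{1}hm -cabsM.
have -> : (al - be) * (m%:C)%C = (g (a + (m%:C)%C) - g a - be * (m%:C)%C)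
  - (g (a + (m%:C)%C) - g a - al * (m%:C)%C) by ring.
by apply: le_trans (cabsB _ _) _; lra.
Qed.

Lemma insq_near r a : insq r a -> exists2 d, 0 < d & forall h, cabs h < d -> insq r (a + h).
Proof.
move=> /andP[a1 a2]; exists (Num.min (r - `|complex.Re a|) (r - `|complex.Im a|)).
  by rewrite lt_min !subr_gt0 a1.
move=> h; rewrite lt_min => /andP[h1 h2]; rewrite /insq ReD ImD.
have := Re_le_cabs h; have := Im_le_cabs h => i1 i2.
by apply/andP; split; apply: le_lt_trans (ler_normD _ _) _; lra.
Qed.

Lemma dd2_bound_cderiv r K g a al : 0 <= K -> dd2_bound r K g -> insq r a ->
  cderiv g a al ->
  forall b, insq r b -> cabs (g b - g a - al * (b - a)) <= K * cabs (b - a) ^+ 2.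
Proof.
move=> K0 gK ai ga; have [be hb] := dd2_bound_deriv K0 gK ai.
have [d d0 dP] := insq_near ai.
rewrite (cderiv_unique ga (be := be)) //; apply: (quad_cderiv K0 d0) => h /dP /hb.
by rewrite [a + h - a]addrAC subrr add0r.
Qed.

Lemma dd2_bound_lim r K g (q : nat -> C -> C) :
  (forall k, dd2_bound r K (q k)) ->
  (forall w, insq r w -> forall e : R, 0 < e -> exists N, forall k, (N <= k)%N ->
     cabs (q k w - g w) < e) ->
  dd2_bound r K g.
Proof.
move=> qK ql a b c ai bi ci ab ac; apply: le_eps => e e0.
have ba : 0 < cabs (b - a) by rewrite cabs_gt0 subr_eq0 eq_sym.
have ca : 0 < cabs (c - a) by rewrite cabs_gt0 subr_eq0 eq_sym.
pose m := Num.min (cabs (b - a)) (cabs (c - a)).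
have m0 : 0 < m by rewrite lt_min ba.
pose e' := e * m / 4.
have e'0 : 0 < e' by rewrite !mulr_gt0.
have [N1 h1] := ql _ ai _ e'0; have [N2 h2] := ql _ bi _ e'0; have [N3 h3] := ql _ ci _ e'0.
pose k := maxn N1 (maxn N2 N3).
have {}h1 : cabs (q k a - g a) < e' by apply: h1; rewrite leq_maxl.
have {}h2 : cabs (q k b - g b) < e' by apply: h2; rewrite leq_max leq_maxl orbT.
have {}h3 : cabs (q k c - g c) < e' by apply: h3; rewrite !leq_max leqnn !orbT.
have near x : 0 < cabs (x - a) -> m <= cabs (x - a) -> cabs (q k x - g x) < e' ->
    cabs ((g x - g a) / (x - a) - (q k x - q k a) / (x - a)) <= e / 2.
  move=> xa mx hx; rewrite -mulrBl cabsM cabsV ler_pdivrMr //.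
  have -> : g x - g a - (q k x - q k a) = (q k a - g a) - (q k x - g x) by ring.
  apply: le_trans (cabsB _ _) _.
  have i : e / 2 * m <= e / 2 * cabs (x - a) by apply: ler_wpM2l => //; rewrite ltW ?divr_gt0.
  by apply: le_trans i; rewrite /e' in h1 hx *; lra.
have {}nb : cabs ((g b - g a) / (b - a) - (q k b - q k a) / (b - a)) <= e / 2.
  by apply: near => //; rewrite ge_min lexx.
have {}nc : cabs ((g c - g a) / (c - a) - (q k c - q k a) / (c - a)) <= e / 2.
  by apply: near => //; rewrite ge_min lexx orbT.
have := qK k a b c ai bi ci ab ac.
set X := (g b - _) / _; set Y := (g c - _) / _.
set X' := (q k b - _) / _ in nb *; set Y' := (q k c - _) / _ in nc * => hq.
have -> : X - Y = (X - X') - (Y - Y') + (X' - Y') by ring.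
apply: le_trans (cabsD _ _) _; have := cabsB (X - X') (Y - Y'); rewrite -/X -/Y in nb nc; lra.
Qed.

Lemma dd1_bound_cderiv r K g a al : insq r a -> dd1_bound r K g -> cderiv g a al ->
  cabs al <= K.
Proof.
move=> ai gK ga; apply: le_eps => e e0.
have [d d0 dP] := insq_near ai; have [d' d'0 da] := ga _ e0.
pose m := Num.min d d' / 2.
have m0 : 0 < m by rewrite divr_gt0 // lt_min d0.
have hm : cabs ((m%:C)%C : C) = m by rewrite cabs_real gtr0_norm.
have [h1 h2] : m < d /\ m < d'.
  have : 2 * m <= d by rewrite /m mulrC divfK // ge_min lexx.
  have : 2 * m <= d' by rewrite /m mulrC divfK // ge_min lexx orbT.
  by split; lra.
have := da (m%:C)%C; have := dP (m%:C)%C; rewrite hm => /(_ h1) q1 /(_ h2) q2.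
have := gK _ _ ai q1; rewrite [a + _ - a]addrAC subrr add0r hm => q3.
rewrite -(ler_pM2r m0) -{1}hm -cabsM.
have -> : al * (m%:C)%C = (g (a + (m%:C)%C) - g a) -
  (g (a + (m%:C)%C) - g a - al * (m%:C)%C) by ring.
by apply: le_trans (cabsB _ _) _; lra.
Qed.

End DividedDifferences.

(** * Integrals of nonnegative lower semicontinuous functions *)

Section LscIntegral.
Variable R : realType.
Local Notation C := R[i].
Local Notation mu := (@lebesgue_measure R).

Lemma limn_einf_ge (u : (\bar R)^nat) (a : \bar R) (N : nat) :
  (forall k, (N <= k)%N -> (a <= u k)%E) -> (a <= limn_einf u)%E.
Proof.
move=> au; rewrite limn_einf_lim; apply: lime_ge; first exact: is_cvg_einfs.
exists N => // k /= Nk; apply: le_ereal_inf_tmp => _ [j /= kj <-].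
by apply: au; exact: leq_trans kj.
Qed.

Lemma limn_einf_le (u : (\bar R)^nat) (a : \bar R) :
  (forall k, (u k <= a)%E) -> (limn_einf u <= a)%E.
Proof.
move=> au; rewrite limn_einf_lim; apply: lime_le; first exact: is_cvg_einfs.
by apply: nearW => k; apply: le_trans (au k); apply: ereal_inf_lbound; exists k => /=.
Qed.

Lemma lee_lt (x y : \bar R) : (0 <= y)%E ->
  (forall a : R, (a%:E < x)%E -> (a%:E <= y)%E) -> (x <= y)%E.
Proof.
move=> y0 h; case: x h => [x| |] h; last by rewrite leNye.
- apply/lee_addgt0Pr => e e0; rewrite -leeBlDr // -EFinB; apply: h.
  by rewrite lte_fin ltrBlDr ltrDl.
- rewrite leye_eq; case: y y0 h => [y| |] // y0 h.
  by have := h (y + 1) (ltry _); rewrite lee_fin gerDl ler10.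
Qed.

Lemma exists_natV (d : R) : 0 < d -> exists N, N.+1%:R^-1 < d.
Proof.
move=> d0; exists (Num.truncn d^-1); rewrite invf_plt ?posrE //; exact: truncnS_gt.
Qed.

Lemma lsc_measurable (u : R -> \bar R) :
  (forall x (a : R), (a%:E < u x)%E ->
    exists2 d : R, 0 < d & forall y, `|y - x| < d -> (a%:E < u y)%E) ->
  measurable_fun setT u.
Proof.
move=> uP; apply: measurable_realfun.lower_semicontinuous_measurable => x a /uP[d d0 dP].
exists [set y | `|y - x| < d]; last by move=> y; exact: dP.
apply/nbhs_ballP; exists d => // y; rewrite /ball /= distrC; exact.
Qed.

(* Fatou's lemma along a sequence converging to [z]. *)
Lemma lsc_integral (T : Type) (dist : T -> T -> R) (H : T -> R -> \bar R) :
  (forall z t, (0 <= H z t)%E) -> (forall z, measurable_fun setT (H z)) ->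
  (forall z t (a : R), (a%:E < H z t)%E ->
    exists2 d : R, 0 < d & forall w, dist z w < d -> (a%:E < H w t)%E) ->
  forall z (a : R), (a%:E < \int[mu]_t H z t)%E ->
    exists2 d : R, 0 < d & forall w, dist z w < d -> (a%:E < \int[mu]_t H w t)%E.
Proof.
move=> H0 Hm Hl z a az; apply: contrapT => nd.
have zk k : exists w, dist z w < k.+1%:R^-1 /\ (\int[mu]_t H w t <= a%:E)%E.
  apply: contrapT => nw; apply: nd; exists k.+1%:R^-1; first by rewrite invr_gt0.
  move=> w zw; rewrite ltNge; apply/negP => wa; apply: nw; by exists w.
have [s sP] := boolp.choice zk.
have h1 : (\int[mu]_t H z t <= \int[mu]_t limn_einf (fun k => H (s k) t))%E.
  have lm : measurable_fun setT (fun t => limn_einf (fun k => H (s k) t)).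
    rewrite /limn_einf; apply: measurableT_comp => //.
    apply: measurable_fun_limn_esup => k; exact: measurableT_comp.
  apply: ge0_le_integral; [by []|by []|exact: Hm|exact: lm|move=> t _; apply: lee_lt].
    by apply: (@limn_einf_ge _ _ 0) => k _.
  move=> b /Hl[d d0 dP]; have [N NP] : exists N, N.+1%:R^-1 < d.
    exact: exists_natV.
  apply: (@limn_einf_ge _ _ N) => k Nk; apply/ltW/dP.
  apply: lt_le_trans (proj1 (sP k)) _; apply: le_trans (ltW NP).
  by rewrite lef_pV2 ?posrE // ler_nat.
have h2 : (\int[mu]_t limn_einf (fun k => H (s k) t) <=
    limn_einf (fun k => \int[mu]_t H (s k) t))%E.
  exact: (@fatou _ _ R mu setT measurableT (fun k t => H (s k) t)
    (fun k => Hm (s k)) (fun k t _ => H0 (s k) t)).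
have h3 : (limn_einf (fun k => \int[mu]_t H (s k) t) <= a%:E)%E.
  by apply: limn_einf_le => k; exact: (proj2 (sP k)).
by have := lt_le_trans az (le_trans h1 (le_trans h2 h3)); rewrite ltxx.
Qed.

(** The product measurable structure is generated by rectangles; an open set is exhausted by those
    countably many squares of rational centre and radius [1 / (N + 1)] that it contains. *)
Lemma open2_measurable (O : set (R * R)) :
  (forall x y, O (x, y) -> exists2 d : R, 0 < d &
    forall x' y', `|x' - x| < d -> `|y' - y| < d -> O (x', y')) ->
  measurable O.
Proof.
move=> OP.
pose B (i : rat * rat * nat) : set (R * R) :=
  [set x | `|x - ratr i.1.1| < i.2.+1%:R^-1] `*` [set y | `|y - ratr i.1.2| < i.2.+1%:R^-1].
have Bm i : measurable (B i).
  have bm (q : R) (e : R) : measurable [set x | `|x - q| < e].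
    have -> : [set x | `|x - q| < e] = `]q - e, q + e[%classic.
      by apply/seteqP; split=> x /=; rewrite in_itv /= ltr_distl.
    exact: measurable_itv.
  by apply: measurableX; exact: bm.
have -> : O = \bigcup_i (if `[< B i `<=` O >] then B i else set0).
  apply/seteqP; split=> [[x y] /OP[d d0 dO]|p [i _]]; last first.
    by case: asboolP => // bO /bO.
  have [N NP] : exists N, N.+1%:R^-1 < d / 2.
    by apply: exists_natV; rewrite divr_gt0.
  have e0 : 0 < N.+1%:R^-1 :> R by rewrite invr_gt0.
  have rat_near (t : R) : exists q : rat, `|t - ratr q| < N.+1%:R^-1.
    have [|q] := @rat_in_itvoo R (t - N.+1%:R^-1) (t + N.+1%:R^-1).
      by move: e0; set e := _^-1 => e0; lra.
    by rewrite in_itv /= -ltr_distl => h; exists q; rewrite distrC.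
  have [p pP] := rat_near x; have [q qP] := rat_near y.
  exists (p, q, N) => //; case: asboolP => [|[]]; first by split.
  move=> [x' y'] [/= hx hy]; apply: dO.
  - have hh : `|x' - x| <= `|x' - ratr p| + `|x - ratr p|.
      by rewrite (distrC x); exact: ler_distD.
    by apply: le_lt_trans hh _; apply: lt_trans (ltrD hx pP) _; rewrite [d]splitr; exact: ltrD.
  - have hh : `|y' - y| <= `|y' - ratr q| + `|y - ratr q|.
      by rewrite (distrC y); exact: ler_distD.
    by apply: le_lt_trans hh _; apply: lt_trans (ltrD hy qP) _; rewrite [d]splitr; exact: ltrD.
apply: countable_bigcupT_measurable => //.
by move=> i; case: asboolP.
Qed.

Definition lscC (U : C -> \bar R) := forall w (a : R), (a%:E < U w)%E ->
  exists2 d : R, 0 < d & forall w', cabs (w' - w) < d -> (a%:E < U w')%E.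

Lemma lscC_measurable2 U : lscC U ->
  measurable_fun setT (fun p : R * R => U (p.1 +i* p.2)%C).
Proof.
move=> Ul; apply: (measurability _ (ErealGenOInfty.measurableE R)).
move=> /= _ [_ [a ->]] <-; rewrite setTI; apply: open2_measurable => x y /=.
rewrite in_itv /= andbT => /Ul[d d0 dP]; exists (d / 2); first by rewrite divr_gt0.
move=> x' y' hx hy; rewrite in_itv /= andbT; apply: dP.
by apply: le_lt_trans (cabs_le _) _ => /=; lra.
Qed.

Lemma lscC_re U y : lscC U -> measurable_fun setT (fun x => U (x +i* y)%C).
Proof.
move=> Ul; apply: lsc_measurable => x a /Ul[d d0 dP]; exists d => // x' xx.
by apply: dP; rewrite cabs_pt_re.
Qed.

Lemma lscC_im U x : lscC U -> measurable_fun setT (fun y => U (x +i* y)%C).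
Proof.
move=> Ul; apply: lsc_measurable => y a /Ul[d d0 dP]; exists d => // x' xx.
by apply: dP; rewrite cabs_pt_im.
Qed.

End LscIntegral.

(** * Sub-mean value inequality *)

Section MeanValue.
Variable R : realType.
Local Notation C := R[i].
Local Notation mu := (@lebesgue_measure R).

Lemma cabs_ccont (h : R -> C) t : ccont h t -> {for t, continuous (fun t => cabs (h t))}.
Proof.
move=> ht; apply/cvgrPdist_lt => e e0; have [d d0 dg] := ht _ e0.
exists d => //= s /=; rewrite distrC => /dg gs.
apply: le_lt_trans gs.
have := cabs_dist (h s) (h t) 0; have := cabs_dist (h t) (h s) 0.
rewrite !subr0 (cabsBC (h t)) ler_norml => h1 h2; apply/andP; split; lra.
Qed.

(** Here [m] is a weight carried along, [B] a bound of the Cauchy kernel on the side, and [s] the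
    Chebyshev bound for the integral of [u] over the whole line. *)
Lemma side_bound (a b m B s : R) (h : R -> C) (u : R -> \bar R) : a <= b -> 0 <= m -> 0 <= B ->
  ccont_itv a b h -> measurable_fun setT u -> (forall t, (0 <= u t)%E) ->
  (forall t, a <= t <= b -> ((m * cabs (h t))%:E <= B%:E * u t)%E) ->
  (\int[mu]_t u t <= s%:E)%E ->
  m * cabs (cint a b h) <= 2 * (B * s).
Proof.
move=> ab m0 B0 hc um u0 hu us.
have ci : mu.-integrable `[a, b] (EFin \o (fun t => cabs (h t))).
  by apply: cont_integrable => t /hc /cabs_ccont.
apply: le_trans (ler_wpM2l m0 (cabs_cint_le ab hc)) _.
rewrite mulrCA; apply: ler_wpM2l => //.
rewrite -RintegralZl // -lee_fin.
have cm := integrableZ_real m ci.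
rewrite /Rintegral fineK; last exact: (integrable_fin_num _ cm).
apply: (@le_trans _ _ (\int[mu]_(t in `[a, b]) (B%:E * u t)))%E.
  apply: ge0_le_integral; first by [].
  - by move=> t _; rewrite lee_fin mulr_ge0 // cabs_ge0.
  - exact: (measurable_int _ cm).
  - by apply: measurable_funeM; exact: measurable_funS um.
  - by move=> t; rewrite /= in_itv /= => /hu.
apply: (@le_trans _ _ (\int[mu]_t (B%:E * u t)))%E.
  apply: ge0_subset_integral => //; first exact: measurable_funeM.
  by move=> t _; rewrite mule_ge0.
rewrite ge0_integralZl_EFin //; last by rewrite EFinM; apply: lee_wpmul2l.
Qed.

Lemma chebyshev_pick (a b s : R) (al : R -> \bar R) : a < b -> 0 < s ->
  measurable_fun setT al -> (forall t, (0 <= al t)%E) ->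
  (\int[mu]_t al t < s%:E)%E ->
  exists2 q, a <= q <= b & (al q <= (s / (b - a))%:E)%E.
Proof.
move=> ab s0 am a0 als; apply: contrapT => nq; move: als; apply/negP; rewrite -leNgt.
have ba : 0 < b - a by lra.
apply: (@le_trans _ _ (\int[mu]_(t in `[a, b]) (cst (s / (b - a))%:E t)))%E.
  rewrite integral_cst //= lebesgue_measure_itv /= lte_fin ab -EFinB -EFinM divfK //.
  by rewrite gt_eqF.
apply: (@le_trans _ _ (\int[mu]_(t in `[a, b]) al t))%E; last exact: ge0_subset_integral.
apply: ge0_le_integral => //.
- by move=> t _; rewrite lee_fin divr_ge0 // ltW.
- exact: measurable_funS am.
- move=> t; rewrite /= in_itv /= => tab; rewrite leNgt; apply/negP => lt.
  by apply: nq; exists t => //; exact: ltW.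
Qed.

(* Cauchy's formula for [g ^ 2] on a rectangle whose four sides are picked, by
   Chebyshev's inequality, so that the line integrals are controlled by the area integral. *)
Lemma sub_mean_value (r m a b : R) (g : C -> C) (U : C -> \bar R) : 0 < r -> 0 <= m ->
  (forall x y, `|x - a| <= r -> `|y - b| <= r -> cdiff g (x +i* y)%C) ->
  lscC U -> (forall w, (0 <= U w)%E) ->
  (forall x y, `|x - a| <= r -> `|y - b| <= r ->
     ((m * cabs (g (x +i* y)%C) ^+ 2)%:E <= U (x +i* y)%C)%E) ->
  ((m * cabs (g (a +i* b)%C) ^+ 2)%:E <=
    (32 / r ^+ 2)%:E * \int[mu]_x \int[mu]_y U (x +i* y)%C)%E.
Proof.
move=> r0 m0 gd Ul U0 gU.
have K0 : 0 < 32 / r ^+ 2 by rewrite divr_gt0 // exprn_gt0.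
have um2 := lscC_measurable2 Ul.
have U20 (p : R * R) : (0 <= U (p.1 +i* p.2)%C)%E by [].
set T := (\int[mu]_x _)%E.
have T0 : (0 <= T)%E by apply: integral_ge0 => x _; exact: integral_ge0.
have TE : T = (\int[mu]_y \int[mu]_x U (x +i* y)%C)%E.
  exact: (@fubini_tonelli _ _ _ _ R mu mu (fun p : R * R => U (p.1 +i* p.2)%C) um2 U20).
pose al x := (\int[mu]_y U (x +i* y)%C)%E.
pose be y := (\int[mu]_x U (x +i* y)%C)%E.
have alm : measurable_fun setT al.
  exact: (@measurable_fun_fubini_tonelli_F _ _ _ _ R mu (fun p : R * R => U (p.1 +i* p.2)%C) um2 U20).
have bem : measurable_fun setT be.
  exact: (@measurable_fun_fubini_tonelli_G _ _ _ _ R mu (fun p : R * R => U (p.1 +i* p.2)%C) um2 U20).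
have al0 x : (0 <= al x)%E by apply: integral_ge0.
have be0 x : (0 <= be x)%E by apply: integral_ge0.
have TA : T = (\int[mu]_t al t)%E by [].
clearbody T; case: T TE TA T0 => [tau| |] TE TA T0 //; last first.
  by rewrite gt0_muley ?lte_fin // leey.
rewrite -EFinM lee_fin; apply: le_eps => e e0.
rewrite lee_fin in T0.
(* Chebyshev's inequality is used with a strict bound on the mass, so [tau] is enlarged by what
   costs [e] in the end. *)
pose s := tau + e * r ^+ 2 / 32.
have es : 0 < e * r ^+ 2 / 32 by rewrite divr_gt0 // mulr_gt0 // exprn_gt0.
have s0 : 0 < s by rewrite ltr_wpDl.
have -> : 32 / r ^+ 2 * tau + e = 32 / r ^+ 2 * s.
  by rewrite /s; field; rewrite gt_eqF.
have taus : (tau%:E < s%:E)%E by rewrite lte_fin ltrDl.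
have als : (\int[mu]_t al t < s%:E)%E by rewrite -TA.
have bes : (\int[mu]_t be t < s%:E)%E by rewrite -TE.
have r20 : 0 < r / 2 by rewrite divr_gt0.
have h1 t : t - r < t - r / 2 by rewrite ltrD2l ltrN2 ltr_pdivrMr // ltr_pMr // ltr1n.
have h2 t : t + r / 2 < t + r by rewrite ltrD2l ltr_pdivrMr // ltr_pMr // ltr1n.
(* Each side is chosen at distance between [r / 2] and [r] from the centre: the kernel is at most
   [2 / r] there, and the length [r / 2] of the range of choice gives line integrals at most
   [2 s / r]. *)
have [p pr pP] := chebyshev_pick (h1 a) s0 alm al0 als.
have [q qr qP] := chebyshev_pick (h2 a) s0 alm al0 als.
have [p' p'r p'P] := chebyshev_pick (h1 b) s0 bem be0 bes.
have [q' q'r q'P] := chebyshev_pick (h2 b) s0 bem be0 bes.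
pose S := s / (r / 2).
have S1 t : s / (t - r / 2 - (t - r)) = S by rewrite /S; congr (_ / _); clear; lra.
have S2 t : s / (t + r - (t + r / 2)) = S by rewrite /S; congr (_ / _); clear; lra.
rewrite (S1 a) in pP; rewrite (S1 b) in p'P; rewrite (S2 a) in qP; rewrite (S2 b) in q'P.
move: pr qr p'r q'r => /andP[p1 p2] /andP[q1 q2] /andP[p3 p4] /andP[q3 q4].
have inr x y : p <= x <= q -> p' <= y <= q' -> `|x - a| <= r /\ `|y - b| <= r.
  clear -p1 p2 q1 q2 p3 p4 q3 q4 r0.
  by move=> /andP[? ?] /andP[? ?]; split; rewrite ler_norml; apply/andP; split; lra.
pose G w := g w * g w.
have Gd : cdiff_rect p q p' q' G.
  by move=> x y xx yy; have [hx hy] := inr _ _ xx yy; apply: cdiffM; apply: gd.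
have pa : p < a by clear -p2 r0; lra.
have aq : a < q by clear -q1 r0; lra.
have pb : p' < b by clear -p4 r0; lra.
have bq : b < q' by clear -q3 r0; lra.
have pq : p <= q by apply/ltW/(lt_trans pa).
have pq' : p' <= q' by apply/ltW/(lt_trans pb).
set c := (a +i* b)%C.
have CF : bdint p q p' q' (fun w => G w / (w - c)) = G c * tpi R.
  exact: cauchy_formula.
pose h w : C := G w / (w - c).
have hd x y : `|x - a| <= r -> `|y - b| <= r -> r / 2 <= cabs ((x +i* y)%C - c) ->
    cdiff h (x +i* y)%C.
  move=> wr wi w0; apply: cdiffM; [apply: cdiffM; exact: gd|apply: cdiff_sub_inv].
  by rewrite -subr_eq0 -cabs_gt0; apply: lt_le_trans w0.
have hU x y : `|x - a| <= r -> `|y - b| <= r -> r / 2 <= cabs ((x +i* y)%C - c) ->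
    ((m * cabs (h (x +i* y)%C))%:E <= (2 / r)%:E * U (x +i* y)%C)%E.
  set w := (x +i* y)%C => wr wi wb.
  have w0 : 0 < cabs (w - c) by apply: lt_le_trans wb.
  apply: (@le_trans _ _ ((2 / r)%:E * (m * cabs (g w) ^+ 2)%:E))%E.
    rewrite -EFinM lee_fin /h !cabsM cabsV -expr2 mulrA mulrC.
    apply: ler_wpM2r; first by rewrite mulr_ge0 // sqr_ge0.
    by rewrite -[2 / r]invrK invf_div lef_pV2 ?posrE.
  by apply: lee_wpmul2l; [rewrite lee_fin divr_ge0 // ltW|exact: gU].
have r2i : 0 <= 2 / r by rewrite divr_ge0 // ltW.
have lep x y : p <= x <= q -> p' <= y <= q' -> r / 2 <= `|x - a| \/ r / 2 <= `|y - b| ->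
    [/\ `|x - a| <= r, `|y - b| <= r & r / 2 <= cabs ((x +i* y)%C - c)].
  move=> xx yy hxy; have [hx hy] := inr _ _ xx yy; split=> //.
  case: hxy => hh; apply: (le_trans hh); [exact: (Re_le_cabs ((x +i* y)%C - c))|
    exact: (Im_le_cabs ((x +i* y)%C - c))].
have hcont x y : p <= x <= q -> p' <= y <= q' -> r / 2 <= `|x - a| \/ r / 2 <= `|y - b| ->
    ccontC h (x +i* y)%C.
  move=> xx yy hxy; have [hx hy hc] := lep _ _ xx yy hxy.
  by apply/cdiff_cont/hd.
have far1 t u : u <= t - r / 2 -> r / 2 <= `|u - t|.
  by move=> ut; rewrite -normrN; apply: le_trans (ler_norm _); clear -ut; lra.
have far2 t u : t + r / 2 <= u -> r / 2 <= `|u - t|.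
  by move=> ut; apply: le_trans (ler_norm _); clear -ut; lra.
have np := far1 _ _ p2; have nq := far2 _ _ q1.
have np' := far1 _ _ p4; have nq' := far2 _ _ q3.
have ip : p <= p <= q by rewrite lexx pq.
have iq : p <= q <= q by rewrite lexx pq.
have ip' : p' <= p' <= q' by rewrite lexx pq'.
have iq' : p' <= q' <= q' by rewrite lexx pq'.
have ch y : p' <= y <= q' -> r / 2 <= `|y - b| -> ccont_itv p q (fun t => h (t +i* y)%C).
  by move=> yy hy t tt; apply: ccontC_re; apply: hcont => //; right.
have cv x : p <= x <= q -> r / 2 <= `|x - a| -> ccont_itv p' q' (fun t => h (x +i* t)%C).
  by move=> yy hy t tt; apply: ccontC_im; apply: hcont => //; left.
have sh y : p' <= y <= q' -> r / 2 <= `|y - b| -> (be y <= S%:E)%E ->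
    m * cabs (cint p q (fun t => h (t +i* y)%C)) <= 2 * (2 / r * S).
  move=> yy hy bS; apply: (side_bound pq m0 r2i (ch _ yy hy) (lscC_re y Ul) _ _ bS) => // t tt.
  have [i1 i2 i3] := lep _ _ tt yy (or_intror hy); exact: hU.
have sv x : p <= x <= q -> r / 2 <= `|x - a| -> (al x <= S%:E)%E ->
    m * cabs (cint p' q' (fun t => h (x +i* t)%C)) <= 2 * (2 / r * S).
  move=> yy hy bS; apply: (side_bound pq' m0 r2i (cv _ yy hy) (lscC_im x Ul) _ _ bS) => // t tt.
  have [i1 i2 i3] := lep _ _ yy tt (or_introl hy); exact: hU.
have e1 := sh _ ip' np' p'P; have e2 := sh _ iq' nq' q'P.
have e3 := sv _ ip np pP; have e4 := sv _ iq nq qP.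
have -> : cabs (g c) ^+ 2 = cabs (G c) by rewrite /G cabsM.
apply: (@le_trans _ _ (m * cabs (G c * tpi R))).
  apply: ler_wpM2l => //; rewrite cabsM -{1}[cabs (G c)]mulr1.
  by apply: ler_wpM2l; [exact: cabs_ge0|exact: cabs_tpi].
rewrite -CF -/h /bdint (cintB (ch _ ip' np') (ch _ iq' nq')) (cintB (cv _ iq nq) (cv _ ip np)).
(* Four sides at [2 (2 / r) S = 8 s / r ^ 2] each. *)
have -> : 32 / r ^+ 2 * s = 2 * (2 / r * S) + 2 * (2 / r * S) + (2 * (2 / r * S) + 2 * (2 / r * S)).
  by rewrite /S; field; rewrite gt_eqF.
apply: (@le_trans _ _ (m * (cabs (cint p q (fun t => h (t +i* p')%C)) +
  cabs (cint p q (fun t => h (t +i* q')%C)) + (cabs (cint p' q' (fun t => h (q +i* t)%C)) +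
  cabs (cint p' q' (fun t => h (p +i* t)%C)))))).
  apply: ler_wpM2l => //; apply: le_trans (cabsD _ _) _; rewrite cabsM cabs_i mul1r.
  by apply: lerD; exact: cabsB.
rewrite !mulrDr; exact: lerD (lerD e1 e2) (lerD e4 e3).
Qed.

End MeanValue.

(** * The space C^n and iterated integrals *)

Section Cn.
Variables (R : realType) (n : nat).
Local Notation C := R[i].
Local Notation V := (cvec R n).
Local Notation mu := (@lebesgue_measure R).
Implicit Types (z w u v : V) (F G : V -> \bar R).

Lemma vnormE z : vnorm z = Num.sqrt (\sum_(j < n) cabs (z j) ^+ 2).
Proof. by congr Num.sqrt; apply: eq_bigr => j _; rewrite sqr_cabs. Qed.

Lemma vnorm_ge0 z : 0 <= vnorm z. Proof. exact: sqrtr_ge0. Qed.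

Lemma sqr_vnorm z : vnorm z ^+ 2 = \sum_(j < n) cabs (z j) ^+ 2.
Proof. by rewrite vnormE sqr_sqrtr // sumr_ge0 // => j _; rewrite sqr_ge0. Qed.

Lemma le_vnorm z w : (forall j, cabs (z j) <= cabs (w j)) -> vnorm z <= vnorm w.
Proof.
move=> zw; rewrite !vnormE ler_sqrt; last by rewrite sumr_ge0 // => j _; rewrite sqr_ge0.
by apply: ler_sum => j _; rewrite ler_pXn2r ?nnegrE ?cabs_ge0.
Qed.

Lemma coord_le_vnorm z j : cabs (z j) <= vnorm z.
Proof.
rewrite -(ler_pXn2r (ltn0Sn 1)) ?nnegrE ?cabs_ge0 ?vnorm_ge0 // sqr_vnorm.
by rewrite (bigD1 j) //= lerDl sumr_ge0 // => i _; rewrite sqr_ge0.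
Qed.

Lemma vnorm_single z (k : 'I_n) : (forall j, j != k -> z j = 0) -> vnorm z = cabs (z k).
Proof.
move=> z0; rewrite vnormE (bigD1 k) //= big1 ?addr0 ?sqrtr_sqr ?ger0_norm ?cabs_ge0 //.
by move=> j /z0 ->; rewrite cabs0 expr0n.
Qed.

Lemma vnorm0P z : (forall j, z j = 0) -> vnorm z = 0.
Proof. by move=> z0; rewrite vnormE big1 ?sqrtr0 // => j _; rewrite z0 cabs0 expr0n. Qed.

Lemma vnorm_le_sum z : vnorm z <= \sum_(j < n) cabs (z j).
Proof.
rewrite -(ler_pXn2r (ltn0Sn 1)) ?nnegrE ?vnorm_ge0 ?sumr_ge0 // => [|j _]; last exact: cabs_ge0.
rewrite sqr_vnorm expr2 mulr_suml; apply: ler_sum => j _.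
rewrite expr2; apply: ler_wpM2l; first exact: cabs_ge0.
by rewrite (bigD1 j) //= lerDl sumr_ge0 // => i _; rewrite cabs_ge0.
Qed.

Lemma vdistC z w : vdist z w = vdist w z.
Proof. by apply/le_anti; rewrite !le_vnorm // => j; rewrite /vsub cabsBC. Qed.

Lemma vdist0 z : vdist z z = 0.
Proof. by apply: vnorm0P => j; rewrite /vsub subrr. Qed.

Lemma vnormZ c z : vnorm (vscale c z) = cabs c * vnorm z.
Proof.
rewrite !vnormE -[cabs c]ger0_norm ?cabs_ge0 // -sqrtr_sqr -sqrtrM ?sqr_ge0 // mulr_sumr.
by congr Num.sqrt; apply: eq_bigr => j _; rewrite cabsM exprMn.
Qed.

(** Lagrange's identity: the difference of the two sides is half a double sum of squares. *)
Lemma cauchy_schwarz_sum (I : finType) (a b : I -> R) :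
  (\sum_i a i * b i) ^+ 2 <= (\sum_i a i ^+ 2) * (\sum_i b i ^+ 2).
Proof.
rewrite -subr_ge0.
suff -> : (\sum_i a i ^+ 2) * (\sum_i b i ^+ 2) - (\sum_i a i * b i) ^+ 2 =
   (\sum_i \sum_j (a i * b j - a j * b i) ^+ 2) / 2.
  by rewrite divr_ge0 // sumr_ge0 // => i _; rewrite sumr_ge0 // => j _; rewrite sqr_ge0.
apply: (@mulIf _ 2) => //; rewrite divfK //.
have E : \sum_i \sum_j (a i * b j - a j * b i) ^+ 2 =
    \sum_i \sum_j (a i ^+ 2 * b j ^+ 2) + \sum_i \sum_j (b i ^+ 2 * a j ^+ 2)
     - (\sum_i \sum_j ((a i * b i) * (a j * b j))) * 2.
  rewrite mulr_suml -!big_split -sumrB /=; apply: eq_bigr => i _.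
  rewrite mulr_suml -!big_split -sumrB /=; apply: eq_bigr => j _; ring.
have S (x y : I -> R) : \sum_i \sum_j (x i * y j) = (\sum_i x i) * (\sum_j y j).
  by rewrite mulr_suml; apply: eq_bigr => i _; rewrite mulr_sumr.
rewrite E (S (fun i => a i ^+ 2) (fun i => b i ^+ 2)) (S (fun i => b i ^+ 2) (fun i => a i ^+ 2)).
rewrite (S (fun i => a i * b i) (fun i => a i * b i)); ring.
Qed.

Lemma cabs_sum (I : finType) (f : I -> C) : cabs (\sum_i f i) <= \sum_i cabs (f i).
Proof.
elim/big_rec2: _ => [|i y x _ h]; first by rewrite cabs0.
by apply: le_trans (cabsD _ _) _; rewrite lerD2l.
Qed.

Lemma cabs_cdot a u : cabs (cdot a u) <= vnorm a * vnorm u.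
Proof.
apply: le_trans (cabs_sum _) _.
rewrite -(ler_pXn2r (ltn0Sn 1)) ?nnegrE ?mulr_ge0 ?vnorm_ge0 ?sumr_ge0 //; last first.
  by move=> j _; exact: cabs_ge0.
rewrite exprMn !sqr_vnorm; apply: le_trans (cauchy_schwarz_sum _ _).
by under eq_bigr do rewrite cabsM.
Qed.

Lemma vnormD z w : vnorm (vadd z w) <= vnorm z + vnorm w.
Proof.
rewrite -(ler_pXn2r (ltn0Sn 1)) ?nnegrE ?addr_ge0 ?vnorm_ge0 // sqr_vnorm.
apply: (@le_trans _ _ (\sum_(j < n) (cabs (z j) ^+ 2 + cabs (w j) ^+ 2 +
   2 * (cabs (z j) * cabs (w j))))).
  apply: ler_sum => j _; have h := cabsD (z j) (w j).
  have {}h : cabs (z j + w j) ^+ 2 <= (cabs (z j) + cabs (w j)) ^+ 2.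
    by rewrite ler_pXn2r ?nnegrE ?addr_ge0 ?cabs_ge0.
  by apply: (le_trans h); rewrite le_eqVlt; apply/orP; left; apply/eqP; ring.
rewrite !big_split /= -!sqr_vnorm -mulr_sumr sqrrD.
rewrite [leRHS]addrAC; apply: lerD => //; rewrite -[leRHS]mulr_natl; apply: ler_wpM2l => //.
rewrite -(ler_pXn2r (ltn0Sn 1)) ?nnegrE ?mulr_ge0 ?vnorm_ge0 ?sumr_ge0 //; last first.
  by move=> j _; rewrite mulr_ge0 ?cabs_ge0.
by rewrite exprMn !sqr_vnorm; exact: cauchy_schwarz_sum.
Qed.

Lemma vdist_triangle z w u : vdist z u <= vdist z w + vdist w u.
Proof.
apply: le_trans (vnormD _ _); apply: le_vnorm => j.
by rewrite /vadd /vsub addrA subrK.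
Qed.

Lemma vdist_vadd z h : vdist z (vadd z h) = vnorm h.
Proof. by rewrite vdistC; apply/le_anti; rewrite !le_vnorm // => j; rewrite /vsub /vadd addrAC subrr add0r. Qed.

Lemma vaddBK z w : vadd z (vsub w z) = w.
Proof. by apply/funext => j; rewrite /vadd /vsub addrC subrK. Qed.

Lemma vupd_id z (k : 'I_n) : vupd z k (z k) = z.
Proof. by apply/funext => j; rewrite /vupd; case: eqP => // /val_inj ->. Qed.

Lemma vdist_vupd_c z k c c' : vdist (vupd z k c) (vupd z k c') <= cabs (c - c').
Proof.
have [kn|kn] := ltnP k n; last first.
  rewrite /vdist vnorm0P ?cabs_ge0 // => j; rewrite /vsub /vupd.
  by case: eqP => [jk|]; [have := ltn_ord j; rewrite jk ltnNge kn | rewrite subrr].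
rewrite /vdist (@vnorm_single _ (Ordinal kn)); first by rewrite /vsub /vupd /= eqxx.
move=> j; rewrite -val_eqE /= => /negbTE jk; by rewrite /vsub /vupd jk subrr.
Qed.

(** The squared modulus of a holomorphic function, extended by zero off an open set, is lower
    semicontinuous but in general not continuous. This property survives partial integration, by
    Fatou, and makes every slice measurable, so iterated integrals are additive one variable at a
    time. *)
Definition lscV F := forall z (a : R), (a%:E < F z)%E ->
  exists2 d : R, 0 < d & forall w, vdist z w < d -> (a%:E < F w)%E.
Definition nnlsc F := (forall z, (0 <= F z)%E) /\ lscV F.

(** Changing the real and the imaginary part separately turns each complex coordinate into two
    one-parameter integrals of the kind treated by [nnlsc_partial]. *)
Definition upd_im z k (y : R) : V :=
  fun j => if val j == k then (complex.Re (z j) +i* y)%C else z j.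
Definition upd_re z k (x : R) : V :=
  fun j => if val j == k then (x +i* complex.Im (z j))%C else z j.

Lemma upd_im_re z k x y : upd_im (upd_re z k x) k y = vupd z k (x +i* y)%C.
Proof. by apply/funext => j; rewrite /upd_im /upd_re /vupd; case: (val j == k). Qed.

Lemma nnlsc_partial (P : V -> R -> V) F :
  (forall z w t, vdist (P z t) (P w t) <= vdist z w) ->
  (forall z t s, vdist (P z t) (P z s) <= `|s - t|) ->
  nnlsc F ->
  nnlsc (fun z => \int[mu]_t F (P z t))%E /\ forall z, measurable_fun setT (fun t => F (P z t)).
Proof.
move=> P1 P2 [F0 Fl].
have Fm z : measurable_fun setT (fun t => F (P z t)).
  apply: lsc_measurable => t a /Fl[d d0 dP]; exists d => // s st; apply: dP.
  exact: le_lt_trans (P2 _ _ _) st.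
split=> //; split=> [z|]; first by apply: integral_ge0.
move=> z a; apply: (@lsc_integral _ _ (@vdist R n) (fun z t => F (P z t))) => //.
move=> w t b /Fl[d d0 dP]; exists d => // w' ww; apply: dP.
exact: le_lt_trans (P1 _ _ _) ww.
Qed.

Lemma nnlsc_im k F : nnlsc F -> nnlsc (fun z => \int[mu]_t F (upd_im z k t))%E /\
  forall z, measurable_fun setT (fun t => F (upd_im z k t)).
Proof.
apply: nnlsc_partial => [z w t|z t s].
- apply: le_vnorm => j; rewrite /vsub /upd_im; case: ifP => // _.
  by rewrite (_ : _ - _ = ((complex.Re (z j - w j))%:C)%C) ?cabs_real ?Re_le_cabs //;
    apply: complexP; rewrite /= ?ReD ?ReN ?subrr.
- have [kn|kn] := ltnP k n; last first.
    rewrite /vdist vnorm0P // => j; rewrite /vsub /upd_im.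
    by case: eqP => [jk|]; [have := ltn_ord j; rewrite jk ltnNge kn | rewrite subrr].
  rewrite /vdist (@vnorm_single _ (Ordinal kn)).
    by rewrite /vsub /upd_im /= eqxx cabs_pt_im distrC.
  by move=> j; rewrite -val_eqE /= => /negbTE jk; rewrite /vsub /upd_im jk subrr.
Qed.

Lemma nnlsc_re k F : nnlsc F -> nnlsc (fun z => \int[mu]_t F (upd_re z k t))%E /\
  forall z, measurable_fun setT (fun t => F (upd_re z k t)).
Proof.
apply: nnlsc_partial => [z w t|z t s].
- apply: le_vnorm => j; rewrite /vsub /upd_re; case: ifP => // _.
  rewrite (_ : _ - _ = (0 +i* complex.Im (z j - w j))%C); last first.
    by apply: complexP; rewrite /= ?ImD ?ImN ?subrr.
  by apply: le_trans (cabs_le _) _; rewrite /= normr0 add0r Im_le_cabs.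
- have [kn|kn] := ltnP k n; last first.
    rewrite /vdist vnorm0P // => j; rewrite /vsub /upd_re.
    by case: eqP => [jk|]; [have := ltn_ord j; rewrite jk ltnNge kn | rewrite subrr].
  rewrite /vdist (@vnorm_single _ (Ordinal kn)).
    by rewrite /vsub /upd_re /= eqxx cabs_pt_re distrC.
  by move=> j; rewrite -val_eqE /= => /negbTE jk; rewrite /vsub /upd_re jk subrr.
Qed.

Definition step_int k F z := (\int[mu]_x \int[mu]_y F (vupd z k (x +i* y)%C))%E.

Lemma step_intE k F z :
  step_int k F z = (\int[mu]_x (fun w => \int[mu]_y F (upd_im w k y)) (upd_re z k x))%E.
Proof.
by apply: eq_integral => x _; apply: eq_integral => y _; rewrite upd_im_re.
Qed.

Lemma nnlsc_step k F : nnlsc F -> nnlsc (step_int k F).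
Proof.
move=> Fn; have [h1 _] := nnlsc_im k Fn; have [h2 _] := nnlsc_re k h1.
suff <- : (fun z => \int[mu]_x (fun w => \int[mu]_y F (upd_im w k y)) (upd_re z k x))%E =
  step_int k F by [].
by apply/funext => z; rewrite step_intE.
Qed.

Lemma measurable_step_in k F z x : nnlsc F ->
  measurable_fun setT (fun y => F (vupd z k (x +i* y)%C)).
Proof.
move=> Fn; have [_ /(_ (upd_re z k x))] := nnlsc_im k Fn.
by under eq_fun do rewrite upd_im_re.
Qed.

Lemma measurable_step_out k F z : nnlsc F ->
  measurable_fun setT (fun x => \int[mu]_y F (vupd z k (x +i* y)%C))%E.
Proof.
move=> Fn; have [h1 _] := nnlsc_im k Fn; have [_ /(_ z)] := nnlsc_re k h1.
by under eq_fun do under eq_integral do rewrite upd_im_re.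
Qed.

Lemma step_intD k F G z : nnlsc F -> nnlsc G ->
  step_int k (fun w => F w + G w)%E z = (step_int k F z + step_int k G z)%E.
Proof.
move=> Fn Gn; have [F0 _] := Fn; have [G0 _] := Gn.
rewrite /step_int -ge0_integralD //.
- apply: eq_integral => x _; rewrite ge0_integralD //; exact: measurable_step_in.
- by move=> x _; exact: integral_ge0.
- exact: measurable_step_out.
- by move=> x _; exact: integral_ge0.
- exact: measurable_step_out.
Qed.

Lemma step_intZ k (c : R) F z : 0 <= c -> nnlsc F ->
  step_int k (fun w => c%:E * F w)%E z = (c%:E * step_int k F z)%E.
Proof.
move=> c0 Fn; have [F0 _] := Fn.
rewrite /step_int -ge0_integralZl_EFin //.
- apply: eq_integral => x _; rewrite ge0_integralZl_EFin //; exact: measurable_step_in.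
- by move=> x _; exact: integral_ge0.
- exact: measurable_step_out.
Qed.

Lemma iter_intS k F z : iter_int k.+1 F z = step_int k (iter_int k F) z.
Proof. by []. Qed.

Lemma nnlsc_iter k F : nnlsc F -> nnlsc (iter_int k F).
Proof. by move=> Fn; elim: k => //= k; exact: nnlsc_step. Qed.

Lemma iter_intD k F G : nnlsc F -> nnlsc G ->
  iter_int k (fun w => F w + G w)%E = (fun z => iter_int k F z + iter_int k G z)%E.
Proof.
move=> Fn Gn; elim: k => [|k IH]; apply/funext => z //; rewrite !iter_intS IH.
by apply: step_intD; exact: nnlsc_iter.
Qed.

Lemma iter_intZ k (c : R) F : 0 <= c -> nnlsc F ->
  iter_int k (fun w => c%:E * F w)%E = (fun z => c%:E * iter_int k F z)%E.
Proof.
move=> c0 Fn; elim: k => [|k IH]; apply/funext => z //; rewrite !iter_intS IH.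
by apply: step_intZ => //; exact: nnlsc_iter.
Qed.

Lemma int_bound (u : R -> \bar R) (M S : R) : 0 < S -> 0 <= M ->
  measurable_fun setT u -> (forall t, (0 <= u t)%E) -> (forall t, (u t <= M%:E)%E) ->
  (forall t, S <= `|t| -> u t = 0%E) -> (\int[mu]_t u t <= (M * (2 * S))%:E)%E.
Proof.
move=> S0 M0 um u0 uM uS.
have -> : (\int[mu]_t u t = \int[mu]_(t in `[(- S)%R, S]) u t)%E.
  rewrite [RHS]integral_mkcond; apply: eq_integral => t _; rewrite /patch.
  case: ifPn => //; rewrite notin_setE /= in_itv /= => tS; apply: uS.
  by rewrite leNgt; apply/negP => h; apply: tS; rewrite -ler_norml ltW.
apply: (@le_trans _ _ (\int[mu]_(t in `[(- S)%R, S]) cst M%:E t))%E.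
  apply: ge0_le_integral => //; exact: measurable_funS um.
rewrite integral_cst //= lebesgue_measure_itv /= lte_fin.
have -> : - S < S by lra.
by rewrite -EFinB -EFinM lee_fin opprK mulr_natl mulr2n.
Qed.

(** Only coordinates of index at least [k] count, because [iter_int k] has integrated out the
    others. *)
Definition outbox (S : R) (k : nat) z :=
  exists2 j : 'I_n, (k <= j)%N & S <= `|complex.Re (z j)| \/ S <= `|complex.Im (z j)|.

(** Vanishing off a box is carried through the induction because a bounded integrand has a
    controlled integral only over a bounded range; each coordinate multiplies the bound by
    [(2 S) ^ 2]. *)
Lemma iter_int_bound F (M S : R) : 0 < S -> 0 <= M -> nnlsc F ->
  (forall z, (F z <= M%:E)%E) -> (forall z, outbox S 0 z -> F z = 0%E) ->
  forall k, (k <= n)%N -> exists2 M', 0 <= M' & (forall z, (iter_int k F z <= M'%:E)%E) /\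
    (forall z, outbox S k z -> iter_int k F z = 0%E).
Proof.
move=> S0 M0 Fn FM FS; elim=> [_|k IH kn]; first by exists M.
have [M' M'0 [bM bS]] := IH (ltnW kn); have In := nnlsc_iter k Fn; have [I0 _] := In.
exists (M' * (2 * S) * (2 * S)); first by rewrite !mulr_ge0 // ltW.
pose j := Ordinal kn.
split=> z; rewrite iter_intS.
- apply: int_bound => //; first by rewrite !mulr_ge0 // ltW.
  + exact: measurable_step_out.
  + by move=> x; exact: integral_ge0.
  + move=> x; apply: int_bound => //; first exact: measurable_step_in.
    by move=> y yS; apply: bS; exists j => //; rewrite /vupd /= eqxx /=; right.
  + move=> x xS; apply: integral0_eq => y _; apply: bS; exists j => //.
    by rewrite /vupd /= eqxx /=; left.
- move=> [i ki iS]; apply: integral0_eq => x _; apply: integral0_eq => y _.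
  apply: bS; exists i; first exact: ltnW.
  by rewrite /vupd gtn_eqF.
Qed.

(** For [k = n] the base point becomes irrelevant: [L2norm2] starts at 0, while the pointwise lower
    bound for the integral is proved at the point of evaluation. *)
Lemma iter_int_indep k F z w : (k <= n)%N -> (forall j : 'I_n, (k <= j)%N -> z j = w j) ->
  iter_int k F z = iter_int k F w.
Proof.
elim: k z w => [|k IH] z w kn zw.
  by congr F; apply/funext => j; exact: zw.
rewrite !iter_intS; apply: eq_integral => x _; apply: eq_integral => y _.
apply: IH => [|j kj]; first exact: ltnW.
rewrite /vupd; case: eqP => // /eqP jk; apply: zw.
by rewrite ltn_neqAle eq_sym jk.
Qed.

End Cn.

(** * The dual of a pre-Hilbert space of functions *)

Section AdditiveBounded.
Variable R : realType.

(** Additivity and [phi 1 = 0] make [phi] periodic, hence bounded on the half-line; then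
    [phi (k t) = k phi t] for all [k] leaves only 0. This upgrades additivity of the polarized form
    to real homogeneity. *)
Lemma additive_bounded_eq0 (phi : R -> R) (K : R) :
  (forall s t, phi (s + t) = phi s + phi t) -> phi 1 = 0 ->
  (forall t, 0 <= t <= 1 -> `|phi t| <= K) -> forall t, phi t = 0.
Proof.
move=> pD p1 pK.
have p0 : phi 0 = 0 by have := pD 0 0; rewrite addr0 => /eqP; rewrite -subr_eq subrr => /eqP.
have pn (k : nat) t : phi (k%:R * t) = k%:R * phi t.
  elim: k => [|k IH]; first by rewrite !mul0r.
  by rewrite -natr1 !mulrDl !mul1r pD IH.
have pb t : 0 <= t -> `|phi t| <= K.
  move=> t0; have /andP[h1 h2] := truncn_itv t0.
  have -> : t = (Num.truncn t)%:R * 1 + (t - (Num.truncn t)%:R) by ring.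
  rewrite pD pn p1 mulr0 add0r; apply: pK; rewrite subr_ge0 h1 /= lerBlDl natr1.
  exact: ltW.
have pp t : 0 <= t -> phi t = 0.
  move=> t0; apply/eqP; rewrite -normr_eq0 eq_le normr_ge0 andbT leNgt; apply/negP => h.
  pose k := (Num.truncn (K / `|phi t|)).+1.
  have : `|phi (k%:R * t)| <= K by apply: pb; rewrite mulr_ge0.
  rewrite pn normrM ger0_norm // leNgt -ltr_pdivrMr // => /negP; apply.
  exact: truncnS_gt.
move=> t; have [/pp //|t0] := leP 0 t.
have := pD t (- t); rewrite subrr p0 (pp (- t)) ?addr0 // oppr_ge0; exact: ltW.
Qed.

End AdditiveBounded.

(** * The dual norm and its real inner product *)

Section DualNorm.
Variables (R : realType) (T : Type).
Local Notation C := R[i].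
Local Notation W := (T -> C).
Variables (A : set W) (N : W -> R).

Definition fadd (X : Type) (f g : X -> C) : X -> C := fun x => f x + g x.
Definition fscale (X : Type) (c : C) (f : X -> C) : X -> C := fun x => c * f x.

Hypothesis A0 : A (fun=> 0).
Hypothesis AD : forall f g, A f -> A g -> A (fadd f g).
Hypothesis AZ : forall c f, A f -> A (fscale c f).
Hypothesis N0 : forall f, 0 <= N f.
Hypothesis NZ : forall c f, A f -> N (fscale c f) = cabs c ^+ 2 * N f.
Hypothesis NP : forall f g, A f -> A g ->
  N (fadd f g) + N (fadd f (fscale (-1) g)) = 2 * (N f + N g).

Definition uball : set W := [set f | A f /\ N f <= 1].

(** Functionals are total functions on [T -> C], so linearity is asked on [A] only: derivatives are
    meaningless off the holomorphic functions. *)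
Definition bfun (L : W -> C) := [/\ forall f g, A f -> A g -> L (fadd f g) = L f + L g,
  forall c f, A f -> L (fscale c f) = c * L f & exists M, forall f, uball f -> cabs (L f) <= M].

Definition dnorm2 (L : W -> C) : R := sup [set cabs (L f) ^+ 2 | f in uball].

Implicit Types L M : W -> C.

Lemma uball0 : uball (fun=> 0).
Proof.
split=> //; have -> : (fun=> 0 : C) = fscale 0 (fun=> 0 : C) :> W.
  by apply/funext => x; rewrite /fscale mul0r.
by rewrite NZ // cabs0 expr0n mul0r.
Qed.

Lemma bfunD L M : bfun L -> bfun M -> bfun (fadd L M).
Proof.
move=> [L1 L2 [l Ll]] [M1 M2 [m Mm]]; split=> [f g Af Ag|c f Af|].
- by rewrite /fadd L1 // M1 //; ring.
- by rewrite /fadd L2 // M2 //; ring.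
- exists (l + m) => f uf; apply: le_trans (cabsD _ _) _; apply: lerD; auto.
Qed.

Lemma bfunZ c L : bfun L -> bfun (fscale c L).
Proof.
move=> [L1 L2 [l Ll]]; split=> [f g Af Ag|d f Af|].
- by rewrite /fscale L1 //; ring.
- by rewrite /fscale L2 //; ring.
- exists (cabs c * l) => f uf; rewrite cabsM; apply: ler_wpM2l; rewrite ?cabs_ge0 //; auto.
Qed.

Lemma dnorm2_le L K : (forall f, uball f -> cabs (L f) ^+ 2 <= K) -> dnorm2 L <= K.
Proof.
move=> LK; apply: ge_sup; first by exists (cabs (L (fun=> 0)) ^+ 2), (fun=> 0) => //; exact: uball0.
by move=> _ [f uf <-]; exact: LK.
Qed.

Lemma dnorm2_ge L f : bfun L -> uball f -> cabs (L f) ^+ 2 <= dnorm2 L.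
Proof.
move=> [_ _ [m Lm]] uf; apply: ub_le_sup; last by exists f.
have m0 : 0 <= m := le_trans (cabs_ge0 _) (Lm _ uf).
by exists (m ^+ 2) => _ [g ug <-]; rewrite ler_pXn2r ?nnegrE ?cabs_ge0 ?m0 ?Lm.
Qed.

Lemma dnorm2_ge0 L : bfun L -> 0 <= dnorm2 L.
Proof. by move=> bL; apply: le_trans (dnorm2_ge bL uball0); rewrite sqr_ge0. Qed.

Lemma dnorm2_bound L f : bfun L -> A f -> cabs (L f) ^+ 2 <= dnorm2 L * N f.
Proof.
move=> bL Af; have q0 := dnorm2_ge0 bL; apply: le_eps => e e0.
(* [N f] may be 0, so [f] is normalized by the root of [N f + e'], with [e'] chosen to cost at most
   [e]. *)
pose e' := e / (dnorm2 L + 1).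
have q1 : 0 < dnorm2 L + 1 by rewrite ltr_pwDr.
have e'0 : 0 < e' by rewrite divr_gt0.
have n0 : 0 < N f + e' by rewrite ltr_wpDl.
pose c : C := ((Num.sqrt (N f + e'))^-1%:C)%C.
have c2 : cabs c ^+ 2 = (N f + e')^-1.
  rewrite /c cabs_real ger0_norm ?invr_ge0 ?sqrtr_ge0 //.
  by rewrite exprVn sqr_sqrtr // ltW.
have uf : uball (fscale c f).
  split; first exact: AZ.
  by rewrite NZ // c2 mulrC ler_pdivrMr // mul1r lerDl ltW.
have := dnorm2_ge bL uf; have [_ -> // _] := bL.
rewrite cabsM exprMn c2 mulrC ler_pdivrMr // => h; apply: (le_trans h).
rewrite mulrDr lerD2l /e' mulrA ler_pdivrMr // mulrC; apply: ler_wpM2l; first exact: ltW.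
by rewrite lerDl.
Qed.

Lemma dnorm2Z_le c L : bfun L -> dnorm2 (fscale c L) <= cabs c ^+ 2 * dnorm2 L.
Proof.
move=> bL; apply: dnorm2_le => f uf; rewrite /fscale cabsM exprMn.
by apply: ler_wpM2l; [exact: sqr_ge0|exact: dnorm2_ge].
Qed.

Lemma dnorm2Z c L : bfun L -> dnorm2 (fscale c L) = cabs c ^+ 2 * dnorm2 L.
Proof.
move=> bL; apply/le_anti; rewrite dnorm2Z_le //=.
have [->|c0] := eqVneq c 0.
  by rewrite cabs0 expr0n mul0r; apply: dnorm2_ge0; exact: bfunZ.
have E : L = fscale c^-1 (fscale c L).
  by apply/funext => f; rewrite /fscale mulrA mulVf // mul1r.
rewrite {1}E; apply: le_trans (ler_wpM2l (sqr_ge0 _) (dnorm2Z_le _ (bfunZ _ bL))) _.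
by rewrite mulrA -exprMn -cabsM divff // cabs1 expr1n mul1r.
Qed.

(** Cauchy-Schwarz in the plane for the vectors of square roots of [(p, p')] and [(m, m')], stated
    without roots. *)
Lemma sum_cs (x y p m p' m' : R) : 0 <= x -> 0 <= y -> 0 <= p -> 0 <= m -> 0 <= p' -> 0 <= m' ->
  x ^+ 2 <= p * m -> y ^+ 2 <= p' * m' -> (x + y) ^+ 2 <= (p + p') * (m + m').
Proof.
move=> x0 y0 p0 m0 p'0 m'0 h1 h2.
have h3 : (x * y) ^+ 2 <= (p * m') * (p' * m).
  rewrite exprMn (_ : p * m' * (p' * m) = (p * m) * (p' * m')); last by ring.
  by apply: ler_pM => //; exact: sqr_ge0.
have u0 : 0 <= p * m' by rewrite mulr_ge0.
have v0 : 0 <= p' * m by rewrite mulr_ge0.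
have h4 : 2 * (x * y) <= p * m' + p' * m.
  rewrite -(ler_pXn2r (ltn0Sn 1)) ?nnegrE ?addr_ge0 ?mulr_ge0 //.
  have -> : (2 * (x * y)) ^+ 2 = 4 * (x * y) ^+ 2 by ring.
  have -> : (p * m' + p' * m) ^+ 2 = 4 * (p * m' * (p' * m)) + (p * m' - p' * m) ^+ 2 by ring.
  by have := sqr_ge0 (p * m' - p' * m); lra.
have -> : (x + y) ^+ 2 = x ^+ 2 + y ^+ 2 + 2 * (x * y) by ring.
have -> : (p + p') * (m + m') = p * m + p' * m' + (p * m' + p' * m) by ring.
by do !apply: lerD.
Qed.

Lemma phase (c : C) : exists2 u : C, cabs u = 1 & u * c = ((cabs c)%:C)%C.
Proof.
have [->|c0] := eqVneq c 0; first by exists 1; rewrite ?cabs1 // cabs0 mulr0.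
have ca : cabs c != 0 by rewrite cabs_eq0.
exists (((cabs c)%:C)%C / c).
  by rewrite cabsM cabsV cabs_real ger0_norm ?cabs_ge0 // divff.
by rewrite mulrAC -mulrA divff // mulr1.
Qed.

(* Test the sum on [a f + b g] and the difference on [a f - b g], where [f], [g] nearly
   attain the norms [a] of [L] and [b] of [M]. *)
Lemma dnorm2_par_ge L M : bfun L -> bfun M ->
  2 * (dnorm2 L + dnorm2 M) <= dnorm2 (fadd L M) + dnorm2 (fadd L (fscale (-1) M)).
Proof.
move=> bL bM; set P := _ + dnorm2 (fadd L (fscale (-1) M)).
have bp := bfunD bL bM; have bm := bfunD bL (bfunZ (-1) bM).
have P0 : 0 <= P by rewrite addr_ge0 // dnorm2_ge0.
have key f g : uball f -> uball g -> 2 * (cabs (L f) ^+ 2 + cabs (M g) ^+ 2) <= P.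
  move=> [Af Nf] [Ag Ng]; set a := cabs (L f); set b := cabs (M g).
  have a0 : 0 <= a by exact: cabs_ge0.
  have b0 : 0 <= b by exact: cabs_ge0.
  have [u u1 uE] := phase (L f); have [v v1 vE] := phase (M g).
  pose f1 := fscale ((a%:C)%C * u) f; pose g1 := fscale ((b%:C)%C * v) g.
  have Af1 : A f1 by exact: AZ.
  have Ag1 : A g1 by exact: AZ.
  have [LD LZ _] := bL; have [MD MZ _] := bM.
  have Lf1 : L f1 = ((a ^+ 2)%:C)%C.
    by rewrite LZ // -mulrA uE -rmorphM -expr2.
  have Mg1 : M g1 = ((b ^+ 2)%:C)%C.
    by rewrite MZ // -mulrA vE -rmorphM -expr2.
  have nf1 : N f1 <= a ^+ 2.
    rewrite NZ // cabsM u1 mulr1 cabs_real ger0_norm // -[leRHS]mulr1.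
    by apply: ler_wpM2l => //; exact: sqr_ge0.
  have ng1 : N g1 <= b ^+ 2.
    rewrite NZ // cabsM v1 mulr1 cabs_real ger0_norm // -[leRHS]mulr1.
    by apply: ler_wpM2l => //; exact: sqr_ge0.
  pose g2 := fscale (-1) g1; have Ag2 : A g2 by exact: AZ.
  have Ap : A (fadd f1 g1) by exact: AD.
  have Am : A (fadd f1 g2) by exact: AD.
  have := sum_cs (cabs_ge0 (fadd L M (fadd f1 g1)))
    (cabs_ge0 (fadd L (fscale (-1) M) (fadd f1 g2)))
    (dnorm2_ge0 bp) (N0 _) (dnorm2_ge0 bm) (N0 _) (dnorm2_bound bp Ap) (dnorm2_bound bm Am).
  rewrite NP // -/P => h.
  set S := a ^+ 2 + b ^+ 2.
  have S0 : 0 <= S by rewrite addr_ge0 // sqr_ge0.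
  have hS : 2 * S <= cabs (fadd L M (fadd f1 g1)) + cabs (fadd L (fscale (-1) M) (fadd f1 g2)).
    apply: le_trans (cabsD _ _).
    have -> : fadd L M (fadd f1 g1) + fadd L (fscale (-1) M) (fadd f1 g2) = ((2 * S)%:C)%C.
      rewrite /fadd -/(fadd f1 g1) -/(fadd f1 g2) /fscale !LD // !MD // /g2 LZ // MZ // Lf1 Mg1.
      have -> : ((2 * S)%:C)%C = ((a ^+ 2)%:C)%C + ((a ^+ 2)%:C)%C +
          (((b ^+ 2)%:C)%C + ((b ^+ 2)%:C)%C) :> C.
        by rewrite /S; apply: complexP => /=; ring.
      by ring.
    by rewrite cabs_real ler_norm.
  have h2 : (2 * S) ^+ 2 <= P * (2 * S).
    apply: (le_trans _ (le_trans h _)).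
      by rewrite ler_pXn2r ?nnegrE ?addr_ge0 ?cabs_ge0 // mulr_ge0.
    apply: ler_wpM2l => //; apply: ler_wpM2l => //; exact: lerD.
  have [S00|Sp] := leP S 0; first by apply: le_trans P0; lra.
  by rewrite expr2 ler_pM2r in h2 => //; lra.
have half f : uball f -> 2 * cabs (L f) ^+ 2 + 2 * dnorm2 M <= P.
  move=> uf; rewrite addrC -lerBrDr -ler_pdivlMl //; apply: dnorm2_le => g ug.
  by rewrite ler_pdivlMl // lerBrDr; apply: le_trans (key f g uf ug); rewrite mulrDr addrC.
rewrite mulrDr -lerBrDr -ler_pdivlMl //; apply: dnorm2_le => f uf.
by rewrite ler_pdivlMl // lerBrDr; exact: half.
Qed.

(** The missing inequality is [dnorm2_par_ge] for [L + M] and [L - M], whose sum and difference are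
    [2 L] and [2 M]. *)
Lemma dnorm2_par L M : bfun L -> bfun M ->
  dnorm2 (fadd L M) + dnorm2 (fadd L (fscale (-1) M)) = 2 * (dnorm2 L + dnorm2 M).
Proof.
move=> bL bM; apply/le_anti; rewrite dnorm2_par_ge // andbT.
have bp := bfunD bL bM; have bm := bfunD bL (bfunZ (-1) bM).
have := dnorm2_par_ge bp bm.
have -> : fadd (fadd L M) (fadd L (fscale (-1) M)) = fscale 2 L.
  by apply/funext => f; rewrite /fadd /fscale; ring.
have -> : fadd (fadd L M) (fscale (-1) (fadd L (fscale (-1) M))) = fscale 2 M.
  by apply/funext => f; rewrite /fadd /fscale; ring.
rewrite !dnorm2Z // (_ : cabs (2 : C) = 2); last first.
  by rewrite (_ : (2 : C) = (2%:C)%C) ?cabs_real ?ger0_norm //; rewrite rmorph_nat.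
by lra.
Qed.

(** Polarization gives the real part of the Hermitian product with squared norm [dnorm2]. It is only
    real bilinear; [dinner_i] and [dinner_il] account for complex scalars. *)
Definition dinner L M := (dnorm2 (fadd L M) - dnorm2 L - dnorm2 M) / 2.

Lemma dinnerC L M : dinner L M = dinner M L.
Proof.
rewrite /dinner (_ : fadd L M = fadd M L); last by apply/funext => f; rewrite /fadd addrC.
ring.
Qed.

(** The argument of Jordan and von Neumann: additivity is a linear combination of four parallelogram
    identities. *)
Lemma dinnerDl L L' M : bfun L -> bfun L' -> bfun M ->
  dinner (fadd L L') M = dinner L M + dinner L' M.
Proof.
move=> bx by_ bz.
have h1 := dnorm2_par (bfunD bx bz) by_.
have h2 := dnorm2_par (bfunD bx (bfunZ (-1) by_)) bz.
have h3 := dnorm2_par bx (bfunD by_ bz).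
have h4 := dnorm2_par bx by_.
rewrite /dinner.
have e1 : fadd (fadd L M) L' = fadd (fadd L L') M.
  by apply/funext => f; rewrite /fadd; ring.
have e2 : fadd (fadd L M) (fscale (-1) L') = fadd (fadd L (fscale (-1) L')) M.
  by apply/funext => f; rewrite /fadd /fscale; ring.
have e3 : fadd L (fadd L' M) = fadd (fadd L L') M.
  by apply/funext => f; rewrite /fadd; ring.
have e4 : fadd (fadd L (fscale (-1) L')) (fscale (-1) M) = fadd L (fscale (-1) (fadd L' M)).
  by apply/funext => f; rewrite /fadd /fscale; ring.
by rewrite e1 e2 in h1; rewrite e4 in h2; rewrite e3 in h3; lra.
Qed.

Lemma dinnerDr L M M' : bfun L -> bfun M -> bfun M' ->
  dinner L (fadd M M') = dinner L M + dinner L M'.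
Proof. by move=> *; rewrite dinnerC dinnerDl // !(dinnerC L). Qed.

Lemma dinner_diag L : bfun L -> dinner L L = dnorm2 L.
Proof.
move=> bL; rewrite /dinner.
have -> : fadd L L = fscale 2 L by apply/funext => f; rewrite /fadd /fscale; ring.
rewrite dnorm2Z // (_ : cabs (2 : C) = 2); last first.
  by rewrite (_ : (2 : C) = (2%:C)%C) ?cabs_real ?ger0_norm //; rewrite rmorph_nat.
by field.
Qed.

Lemma dinnerZl (t : R) L M : bfun L -> bfun M ->
  dinner (fscale (t%:C)%C L) M = t * dinner L M.
Proof.
move=> bL bM; apply/eqP; rewrite -subr_eq0; apply/eqP.
have q0 := dnorm2_ge0.
(* Cauchy-Schwarz is derived from homogeneity, so boundedness on [[0, 1]] is drawn from the
   parallelogram law instead. *)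
pose K := 3 / 2 * (dnorm2 L + dnorm2 M) + `|dinner L M|.
apply: (@additive_bounded_eq0 R (fun t => dinner (fscale (t%:C)%C L) M - t * dinner L M) K).
- move=> s u /=; rewrite (_ : fscale _ L = fadd (fscale (s%:C)%C L) (fscale (u%:C)%C L)).
    by rewrite dinnerDl //; [ring|exact: bfunZ|exact: bfunZ].
  by apply/funext => f; rewrite /fscale /fadd rmorphD mulrDl.
- rewrite (_ : fscale _ L = L) ?mul1r ?subrr //.
  by apply/funext => f; rewrite /fscale mul1r.
- move=> u /andP[u0 u1]; apply: le_trans (ler_normB _ _) _; apply: lerD; last first.
    by rewrite normrM -[leRHS]mul1r ler_wpM2r // ger0_norm.
  have bu : bfun (fscale (u%:C)%C L) by exact: bfunZ.
  have h1 := dnorm2_par bu bM.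
  have h2 := q0 _ (bfunD bu bM); have h3 := q0 _ (bfunD bu (bfunZ (-1) bM)).
  have h4 := q0 _ bu; have h5 := q0 _ bM.
  have h6 : dnorm2 (fscale (u%:C)%C L) <= dnorm2 L.
    rewrite dnorm2Z // -[leRHS]mul1r ler_wpM2r //; first exact: q0.
    by rewrite cabs_real ger0_norm // expr_le1.
  by rewrite /dinner ler_norml; apply/andP; split; lra.
Qed.

Lemma dinnerZr (t : R) L M : bfun L -> bfun M ->
  dinner L (fscale (t%:C)%C M) = t * dinner L M.
Proof. by move=> bL bM; rewrite dinnerC dinnerZl // dinnerC. Qed.

Lemma dinner_i L M : bfun L -> bfun M ->
  dinner (fscale 'i%C L) (fscale 'i%C M) = dinner L M.
Proof.
move=> bL bM; rewrite /dinner.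
have -> : fadd (fscale 'i%C L) (fscale 'i%C M) = fscale 'i%C (fadd L M).
  by apply/funext => f; rewrite /fadd /fscale; ring.
by rewrite !dnorm2Z ?cabs_i ?expr1n ?mul1r //; exact: bfunD.
Qed.

Lemma dinnerNl L M : bfun L -> bfun M -> dinner (fscale (-1) L) M = - dinner L M.
Proof.
move=> bL bM; rewrite (_ : (-1 : C) = ((-1)%:C)%C) ?dinnerZl ?mulN1r //.
by rewrite rmorphN rmorph1.
Qed.

Lemma dinner_il L M : bfun L -> bfun M ->
  dinner (fscale 'i%C L) M = - dinner L (fscale 'i%C M).
Proof.
move=> bL bM; rewrite -(dinner_i bL (bfunZ 'i%C bM)).
have -> : fscale 'i%C (fscale 'i%C M) = fscale (-1) M.
  by apply/funext => f; rewrite /fscale mulrA -expr2 sqr_i.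
rewrite [in RHS]dinnerC dinnerNl ?opprK 1?dinnerC //; exact: bfunZ.
Qed.

Lemma dinner_cs L M : bfun L -> bfun M -> dinner L M ^+ 2 <= dnorm2 L * dnorm2 M.
Proof.
move=> bL bM; set b := dinner L M.
have quad t : 0 <= dnorm2 L + 2 * t * b + t ^+ 2 * dnorm2 M.
  have bt := bfunZ (t%:C)%C bM.
  have -> : dnorm2 L + 2 * t * b + t ^+ 2 * dnorm2 M = dnorm2 (fadd L (fscale (t%:C)%C M)).
    have E : dinner L (fscale (t%:C)%C M) = t * b by rewrite dinnerZr.
    move: E; rewrite /dinner dnorm2Z // cabs_real real_normK ?num_real // => E.
    rewrite -[t ^+ 2 * _](addrK (dnorm2 L)); lra.
  by apply: dnorm2_ge0; exact: bfunD.
have q0 := dnorm2_ge0 bM; have p0 := dnorm2_ge0 bL.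
have [M0|Mp] := leP (dnorm2 M) 0.
  have M00 : dnorm2 M = 0 by apply/le_anti; rewrite M0 q0.
  have [->|b0] := eqVneq b 0; first by rewrite expr0n mulr_ge0.
  (* When [M] has norm 0 the quadratic form is affine in [t]; this value of [t] would make it -1. *)
  have := quad (- (dnorm2 L + 1) / (2 * b)); rewrite M00 mulr0 addr0.
  have -> : 2 * (- (dnorm2 L + 1) / (2 * b)) * b = - (dnorm2 L + 1) by field.
  by rewrite opprD addrA subrr add0r oppr_ge0 ler10.
have := quad (- b / dnorm2 M).
have -> : dnorm2 L + 2 * (- b / dnorm2 M) * b + (- b / dnorm2 M) ^+ 2 * dnorm2 M =
  (dnorm2 L * dnorm2 M - b ^+ 2) / dnorm2 M by field; rewrite gt_eqF.
by rewrite pmulr_lge0 ?invr_gt0 // subr_ge0.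
Qed.

Lemma dinner_bound L M (l m : R) : bfun L -> bfun M -> 0 <= l -> 0 <= m ->
  (forall f, uball f -> cabs (L f) <= l) -> (forall f, uball f -> cabs (M f) <= m) ->
  `|dinner L M| <= l * m.
Proof.
move=> bL bM l0 m0 Ll Mm.
rewrite -(ler_pXn2r (ltn0Sn 1)) ?nnegrE ?mulr_ge0 // real_normK ?num_real //.
apply: le_trans (dinner_cs bL bM) _; rewrite exprMn; apply: ler_pM; try exact: dnorm2_ge0.
- by apply: dnorm2_le => f uf; rewrite ler_pXn2r ?nnegrE ?cabs_ge0 //; exact: Ll.
- by apply: dnorm2_le => f uf; rewrite ler_pXn2r ?nnegrE ?cabs_ge0 //; exact: Mm.
Qed.

Lemma dnorm2_gt0 L f : bfun L -> A f -> L f != 0 -> 0 < dnorm2 L.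
Proof.
move=> bL Af Lf; rewrite lt_neqAle dnorm2_ge0 // andbT eq_sym; apply/eqP => q0.
have := dnorm2_bound bL Af; rewrite q0 mul0r leNgt => /negP; apply.
by rewrite exprn_gt0 // cabs_gt0.
Qed.

Lemma bfun_bound L : bfun L -> exists2 l, 0 <= l & forall f, uball f -> cabs (L f) <= l.
Proof.
move=> [_ _ [l Ll]]; exists l => //; exact: le_trans (cabs_ge0 _) (Ll _ uball0).
Qed.

(** A product rule for two curves of functionals. The remainders [rho] and [sig] are small on the
    unit ball, hence in dual norm, which is why the expansions are assumed uniform there; [|t| < 1]
    lets higher powers of [t] be absorbed in [t ^ 2]. *)
Lemma dinner_curve (L L' M M' : W -> C) (Lt Mt : R -> W -> C) (d K : R) :
  0 < d -> 0 <= K -> bfun L -> bfun L' -> bfun M -> bfun M' ->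
  (forall t, `|t| < d -> bfun (Lt t)) -> (forall t, `|t| < d -> bfun (Mt t)) ->
  (forall t f, `|t| < d -> uball f -> cabs (Lt t f - L f - (t%:C)%C * L' f) <= K * t ^+ 2) ->
  (forall t f, `|t| < d -> uball f -> cabs (Mt t f - M f - (t%:C)%C * M' f) <= K * t ^+ 2) ->
  exists2 d' : R, 0 < d' & exists K' : R, forall t, `|t| < d' ->
    `|dinner (Lt t) (Mt t) - dinner L M - t * (dinner L' M + dinner L M')| <= K' * t ^+ 2.
Proof.
move=> d0 K0 bL bL' bM bM' bLt bMt eL eM.
have [l l0 Ll] := bfun_bound bL; have [l' l'0 Ll'] := bfun_bound bL'.
have [m m0 Mm] := bfun_bound bM; have [m' m'0 Mm'] := bfun_bound bM'.
exists (Num.min d 1); first by rewrite lt_min d0 ?ltr01.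
exists (`|dinner L' M'| + K * (m + m' + K) + (l + l') * K) => t.
rewrite lt_min => /andP[td t1].
have t2 : 0 <= t ^+ 2 by rewrite sqr_ge0.
have t21 : t ^+ 2 <= 1 by rewrite -real_normK ?num_real // expr_le1 // ltW.
have Kt : 0 <= K * t ^+ 2 by rewrite mulr_ge0.
pose L1 := fadd L (fscale (t%:C)%C L'); pose M1 := fadd M (fscale (t%:C)%C M').
pose rho := fadd (Lt t) (fscale (-1) L1); pose sig := fadd (Mt t) (fscale (-1) M1).
have bLt' := bLt _ td; have bMt' := bMt _ td.
have bL1 : bfun L1 by apply: bfunD => //; exact: bfunZ.
have bM1 : bfun M1 by apply: bfunD => //; exact: bfunZ.
have brho : bfun rho by apply: bfunD => //; exact: bfunZ.
have bsig : bfun sig by apply: bfunD => //; exact: bfunZ.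
have LE : Lt t = fadd L1 rho by apply/funext => f; rewrite /rho /fadd /fscale; ring.
have ME : Mt t = fadd M1 sig by apply/funext => f; rewrite /sig /fadd /fscale; ring.
have hrho f : uball f -> cabs (rho f) <= K * t ^+ 2.
  move=> uf; have := eL t f td uf; congr (cabs _ <= _).
  by rewrite /rho /L1 /fadd /fscale; ring.
have hsig f : uball f -> cabs (sig f) <= K * t ^+ 2.
  move=> uf; have := eM t f td uf; congr (cabs _ <= _).
  by rewrite /sig /M1 /fadd /fscale; ring.
have ct : cabs ((t%:C)%C : C) <= 1 by rewrite cabs_real ltW.
have hL1 f : uball f -> cabs (L1 f) <= l + l'.
  move=> uf; apply: le_trans (cabsD _ _) _; apply: lerD; first exact: Ll.
  rewrite /fscale cabsM -[l']mul1r; apply: ler_pM; rewrite ?cabs_ge0 //; exact: Ll'.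
have hMt f : uball f -> cabs (Mt t f) <= m + m' + K.
  move=> uf; rewrite ME; apply: le_trans (cabsD _ _) _; apply: lerD; last first.
    by apply: le_trans (hsig _ uf) _; rewrite -[leRHS]mulr1 ler_wpM2l.
  apply: le_trans (cabsD _ _) _; apply: lerD; first exact: Mm.
  rewrite /fscale cabsM -[m']mul1r; apply: ler_pM; rewrite ?cabs_ge0 //; exact: Mm'.
have b1 := dinner_bound brho bMt' Kt (addr_ge0 (addr_ge0 m0 m'0) K0) hrho hMt.
have b2 := dinner_bound bL1 bsig (addr_ge0 l0 l'0) Kt hL1 hsig.
have E : dinner (Lt t) (Mt t) - dinner L M - t * (dinner L' M + dinner L M') =
  t ^+ 2 * dinner L' M' + dinner rho (Mt t) + dinner L1 sig.
  rewrite {1}LE dinnerDl // {1}ME dinnerDr // /L1 /M1.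
  rewrite dinnerDl //; try exact: bfunZ.
  rewrite !dinnerDr //; try exact: bfunZ.
  rewrite !dinnerZl // ?dinnerZr //; try exact: bfunZ.
  ring.
rewrite E; apply: le_trans (ler_normD _ _) _.
apply: le_trans (lerD (ler_normD _ _) (lexx _)) _.
rewrite normrM (ger0_norm t2).
have -> : (`|dinner L' M'| + K * (m + m' + K) + (l + l') * K) * t ^+ 2 =
  t ^+ 2 * `|dinner L' M'| + K * t ^+ 2 * (m + m' + K) + (l + l') * (K * t ^+ 2) by ring.
by apply: lerD => //; apply: lerD.
Qed.

Lemma bfun0 : bfun (fun=> 0).
Proof.
split=> [f g _ _|c f _|]; rewrite ?addr0 ?mulr0 //; by exists 0 => f _; rewrite cabs0.
Qed.

Lemma dinner0l M : bfun M -> dinner (fun=> 0) M = 0.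
Proof.
move=> bM; rewrite (_ : (fun=> 0) = fscale (0%:C)%C (fun=> 0)).
  by rewrite dinnerZl ?mul0r //; exact: bfun0.
by apply/funext => f; rewrite /fscale mul0r.
Qed.

Lemma fscale_split (c : C) L : fscale c L =
  fadd (fscale ((complex.Re c)%:C)%C L) (fscale ((complex.Im c)%:C)%C (fscale 'i%C L)).
Proof.
apply/funext => f; rewrite /fadd /fscale mulrA -mulrDl; congr (_ * _).
by case: c => a b; apply: complexP => /=; ring.
Qed.

(** * The Levi form of the logarithm of a squared norm *)

Section FiniteSum.
Variables (I : finType) (c : I -> C) (F : I -> W -> C).
Hypothesis bF : forall i, bfun (F i).

Lemma bfun_sum (s : seq I) : bfun (fun f => \sum_(i <- s) c i * F i f).
Proof.
elim: s => [|i s IH].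
  by under [X in bfun X]eq_fun do rewrite big_nil; exact: bfun0.
under [X in bfun X]eq_fun do rewrite big_cons.
exact: (bfunD (bfunZ (c i) (bF i)) IH).
Qed.

Lemma dinner_sum (s : seq I) M : bfun M -> dinner (fun f => \sum_(i <- s) c i * F i f) M =
  \sum_(i <- s) (complex.Re (c i) * dinner (F i) M
                 + complex.Im (c i) * dinner (fscale 'i%C (F i)) M).
Proof.
move=> bM; elim: s => [|i s IH].
  by under [X in dinner X _]eq_fun do rewrite big_nil; rewrite big_nil dinner0l.
under [X in dinner X _]eq_fun do rewrite big_cons.
rewrite big_cons -IH.
rewrite (dinnerDl (bfunZ (c i) (bF i)) (bfun_sum s) bM) fscale_split.
have bi := bfunZ 'i%C (bF i).
by rewrite dinnerDl ?dinnerZl //; exact: bfunZ.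
Qed.

Variables (e : W -> C).
Hypotheses (be : bfun e) (e0 : 0 < dnorm2 e).

Let S : W -> C := fun f => \sum_i c i * F i f.
Let K := dnorm2 e.

(* Coefficients of the Levi form of the logarithm of the squared norm of a
   holomorphically varying functional [e] with first derivatives [F i]. *)
Definition log_levi (i j : I) : C :=
  ((dinner (F i) (F j) / K - (dinner e (F i) * dinner e (F j)
      + dinner e (fscale 'i%C (F i)) * dinner e (fscale 'i%C (F j))) / K ^+ 2)
   +i* (dinner (F i) (fscale 'i%C (F j)) / K - (dinner e (F i) * dinner e (fscale 'i%C (F j))
      - dinner e (fscale 'i%C (F i)) * dinner e (F j)) / K ^+ 2))%C.

Lemma Re_sum (X : finType) (f : X -> C) :
  complex.Re (\sum_i f i) = \sum_i complex.Re (f i).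
Proof.
by elim/big_rec2: _ => //= i x y _ <-; rewrite ReD.
Qed.

(* [k] makes [S + k e] orthogonal to [e]. *)
Lemma log_levi_sum : exists k : C,
  complex.Re (\sum_i \sum_j log_levi i j * c i * (c j)^*%C) =
  dnorm2 (fadd S (fscale k e)) / K.
Proof.
have K0 : K != 0 by rewrite gt_eqF.
have bS : bfun S by exact: bfun_sum.
pose x i := complex.Re (c i); pose y i := complex.Im (c i).
pose p i := dinner e (F i); pose q i := dinner e (fscale 'i%C (F i)).
have bi i : bfun (fscale 'i%C (F i)) by exact: bfunZ.
have bie : bfun (fscale 'i%C e) by exact: bfunZ.
pose P := \sum_i (x i * p i + y i * q i); pose Q := \sum_i (x i * q i - y i * p i).
have PE : dinner S e = P.
  rewrite dinner_sum //; apply: eq_bigr => i _.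
  by rewrite (dinnerC (F i)) (dinnerC (fscale _ (F i))).
have QE : dinner S (fscale 'i%C e) = - Q.
  rewrite dinner_sum // /Q -sumrN; apply: eq_bigr => i _.
  rewrite dinner_i // (dinnerC (F i) e) -/(p i) (dinnerC (F i)) dinner_il // -/(q i).
  by rewrite -/(x i) -/(y i); ring.
pose al := - P / K; pose be' := Q / K.
exists (al +i* be')%C.
have key : dnorm2 (fadd S (fscale (al +i* be')%C e)) = dnorm2 S - (P ^+ 2 + Q ^+ 2) / K.
  have bk : bfun (fscale (al +i* be')%C e) by exact: bfunZ.
  have h : dinner S (fscale (al +i* be')%C e) = al * P - be' * Q.
    rewrite fscale_split /= dinnerDr //; try exact: bfunZ.
    by rewrite !dinnerZr // PE QE; ring.
  move: h; rewrite {1}/dinner dnorm2Z // sqr_cabs /= -/K => h.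
  have -> : dnorm2 (fadd S (fscale (al +i* be')%C e)) =
    2 * (al * P - be' * Q) + dnorm2 S + (al ^+ 2 + be' ^+ 2) * K by lra.
  by rewrite /al /be'; field.
rewrite key -dinner_diag //.
(* [SS] and [PP] bring the right side into a double sum that matches the real part of the [log_levi]
   sum term by term. *)
have SS : dinner S S = \sum_i \sum_j ((x i * x j + y i * y j) * dinner (F i) (F j) +
    (x i * y j - y i * x j) * dinner (F i) (fscale 'i%C (F j))).
  rewrite dinner_sum //; apply: eq_bigr => i _; rewrite -/(x i) -/(y i).
  rewrite (dinnerC (F i)) (dinnerC (fscale _ (F i))) !dinner_sum // !mulr_sumr -big_split /=.
  apply: eq_bigr => j _; rewrite -/(x j) -/(y j) dinner_i // (dinnerC (F j) (F i)).
  rewrite (dinnerC (fscale 'i%C (F j)) (F i)) (dinnerC (F j)) dinner_il //; ring.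
have PP : P ^+ 2 + Q ^+ 2 = \sum_i \sum_j ((x i * p i + y i * q i) * (x j * p j + y j * q j) +
    (x i * q i - y i * p i) * (x j * q j - y j * p j)).
  rewrite !expr2 /P /Q !mulr_suml -big_split /=; apply: eq_bigr => i _.
  by rewrite !mulr_sumr -big_split.
rewrite SS PP mulrBl -mulrA !mulr_suml -sumrB Re_sum; apply: eq_bigr => i _.
rewrite !mulr_suml -sumrB Re_sum; apply: eq_bigr => j _.
rewrite /log_levi -/(p i) -/(p j) -/(q i) -/(q j) !ReM !ImM /=.
have -> : complex.Re (c j)^*%C = x j by rewrite /x; case: (c j).
have -> : complex.Im (c j)^*%C = - y j by rewrite /y; case: (c j).
by rewrite -/(x i) -/(y i); field.
Qed.

End FiniteSum.

End DualNorm.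

(** * Holomorphic functions on C^n *)

Section Gradients.
Variables (R : realType) (n : nat).
Local Notation C := R[i].
Local Notation V := (cvec R n).
Implicit Types (z w u v a b : V) (f g : V -> C) (D : set V).

Lemma cdotD a b u : cdot (vadd a b) u = cdot a u + cdot b u.
Proof. by rewrite /cdot -big_split; apply: eq_bigr => j _; rewrite mulrDl. Qed.
Lemma cdotZ c a u : cdot (vscale c a) u = c * cdot a u.
Proof. by rewrite /cdot mulr_sumr; apply: eq_bigr => j _; rewrite mulrA. Qed.
Lemma cdotZr c a u : cdot a (vscale c u) = c * cdot a u.
Proof. by rewrite /cdot mulr_sumr; apply: eq_bigr => j _; rewrite mulrCA. Qed.
Lemma cdot_ereal a j : cdot a (ereal_dir R j) = a j.
Proof.
rewrite /cdot (bigD1 j) //= /ereal_dir eqxx mulr1 big1 ?addr0 // => i /negbTE ij.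
by rewrite ij mulr0.
Qed.
Lemma eimag_scale (j : 'I_n) : eimag_dir R j = vscale 'i%C (ereal_dir R j).
Proof.
by apply/funext => k; rewrite /eimag_dir /vscale /ereal_dir; case: eqP; rewrite ?mulr1 ?mulr0.
Qed.
Lemma cdot0 u : cdot (@vzero R n) u = 0.
Proof. by rewrite /cdot big1 // => j _; rewrite /vzero mul0r. Qed.

Lemma has_cgradD f g z a b : has_cgrad f z a -> has_cgrad g z b ->
  has_cgrad (fadd f g) z (vadd a b).
Proof.
move=> fa gb e e0.
have [d d0 dP] := @lin_approxD R V (@vnorm R n) (@vnorm_ge0 R n) _ _ _ _ _ _ fa gb e e0.
by exists d => // h /dP; rewrite cdotD.
Qed.

Lemma has_cgradM f g z a b : has_cgrad f z a -> has_cgrad g z b ->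
  has_cgrad (fun w => f w * g w) z (vadd (vscale (g z) a) (vscale (f z) b)).
Proof.
move=> fa gb e e0.
have [||d d0 dP] := @lin_approxM R V (@vnorm R n) (@vnorm_ge0 R n) _ _ _ _ _ _ (vnorm a)
  (vnorm b) (vnorm_ge0 a) (vnorm_ge0 b) _ _ fa gb e e0; try exact: cabs_cdot.
by exists d => // h /dP; rewrite cdotD !cdotZ (mulrC (g z)).
Qed.

Lemma has_cgradV f z a : f z != 0 -> has_cgrad f z a ->
  has_cgrad (fun w => (f w)^-1) z (vscale (- (f z) ^- 2) a).
Proof.
move=> f0 fa e e0.
have [|d d0 dP] := @lin_approxV R V (@vnorm R n) (@vnorm_ge0 R n) _ _ _ (vnorm a)
  (vnorm_ge0 a) _ f0 fa e e0; first exact: cabs_cdot.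
by exists d => // h /dP; rewrite cdotZ mulNr mulNr [_ * cdot a h]mulrC.
Qed.

Lemma has_cgrad_cst c z : has_cgrad (fun=> c) z (@vzero R n).
Proof.
by move=> e e0; exists 1 => // h _; rewrite cdot0 !subrr cabs0 mulr_ge0 ?vnorm_ge0 // ltW.
Qed.

Lemma has_cgrad_lin b z : has_cgrad (cdot b) z b.
Proof.
move=> e e0; exists 1 => // h _; rewrite (_ : _ - _ - _ = 0).
  by rewrite cabs0 mulr_ge0 ?vnorm_ge0 // ltW.
rewrite /cdot -sumrB -sumrB big1 // => j _; rewrite /vadd; ring.
Qed.

Lemma has_cgradZ c f z a : has_cgrad f z a -> has_cgrad (fscale c f) z (vscale c a).
Proof.
move=> fa; have := has_cgradM (has_cgrad_cst c z) fa.
by congr has_cgrad; apply/funext => j; rewrite /vadd /vscale /vzero mulr0 add0r.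
Qed.

Lemma vadd_line z v (w h : C) :
  vadd z (vscale (w + h) v) = vadd (vadd z (vscale w v)) (vscale h v).
Proof. by apply/funext => j; rewrite /vadd /vscale mulrDl addrA. Qed.

Lemma vadd0 z v : vadd z (vscale 0 v) = z.
Proof. by apply/funext => j; rewrite /vadd /vscale mul0r addr0. Qed.

Lemma cderiv_comp f (q : C -> V) (w0 : C) v a :
  (forall h, q (w0 + h) = vadd (q w0) (vscale h v)) -> has_cgrad f (q w0) a ->
  cderiv (fun w : C => f (q w)) w0 (cdot a v).
Proof.
move=> ql fa e e0.
have v1 : 0 < vnorm v + 1 by rewrite ltr_wpDl // vnorm_ge0.
have [d d0 dP] := fa _ (divr_gt0 e0 v1).
exists (d / (vnorm v + 1)); first by rewrite divr_gt0.
move=> h; rewrite ltr_pdivlMr // => hd.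
have hv : vnorm (vscale h v) <= cabs h * (vnorm v + 1).
  by rewrite vnormZ ler_wpM2l ?cabs_ge0 // lerDl.
have := dP _ (le_lt_trans hv hd); rewrite ql cdotZr mulrC => hh.
apply: (le_trans hh); rewrite mulrAC ler_pdivrMr // -mulrA.
by apply: ler_wpM2l => //; exact: ltW.
Qed.

Lemma cderiv_line f z v (w : C) a : has_cgrad f (vadd z (vscale w v)) a ->
  cderiv (fun w : C => f (vadd z (vscale w v))) w (cdot a v).
Proof. by apply: cderiv_comp => h; exact: vadd_line. Qed.

Lemma has_cgrad_unique f z a b : has_cgrad f z a -> has_cgrad f z b -> a = b.
Proof.
move=> fa fb; apply/funext => j; rewrite -!cdot_ereal.
apply: (@cderiv_unique _ (fun w : C => f (vadd z (vscale w (ereal_dir R j)))) 0);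
  by apply: cderiv_line; rewrite vadd0.
Qed.

Lemma cgradE f z a : has_cgrad f z a -> cgrad f z = a.
Proof.
move=> fa; apply: (has_cgrad_unique _ fa).
by rewrite /cgrad; apply: ClassicalEpsilon.epsilon_spec; exists a.
Qed.

Lemma cgradP D f z : holomorphic D f -> D z -> has_cgrad f z (cgrad f z).
Proof. by move=> fh /fh[a fa]; rewrite (cgradE fa). Qed.

Definition dirder v z f := cdot (cgrad f z) v.

Lemma holoD D f g : holomorphic D f -> holomorphic D g -> holomorphic D (fadd f g).
Proof. by move=> fh gh z Dz; eexists; apply: has_cgradD; [exact: cgradP fh Dz|exact: cgradP gh Dz]. Qed.
Lemma holoZ D c f : holomorphic D f -> holomorphic D (fscale c f).
Proof. by move=> fh z Dz; eexists; apply: has_cgradZ; exact: cgradP fh Dz. Qed.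
Lemma holo_cst D c : holomorphic D (fun=> c).
Proof. by move=> z _; exists (@vzero R n); exact: has_cgrad_cst. Qed.
Lemma holo_lin D b : holomorphic D (cdot b).
Proof. by move=> z _; exists b; exact: has_cgrad_lin. Qed.

Lemma dirderD D v z f g : D z -> holomorphic D f -> holomorphic D g ->
  dirder v z (fadd f g) = dirder v z f + dirder v z g.
Proof.
move=> Dz fh gh; rewrite /dirder -cdotD.
by rewrite (cgradE (has_cgradD (cgradP fh Dz) (cgradP gh Dz))).
Qed.
Lemma dirderZ D v z c f : D z -> holomorphic D f ->
  dirder v z (fscale c f) = c * dirder v z f.
Proof. by move=> Dz fh; rewrite /dirder -cdotZ (cgradE (has_cgradZ c (cgradP fh Dz))). Qed.

Lemma has_cgrad_cont f z a : has_cgrad f z a -> forall e : R, 0 < e ->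
  exists2 d : R, 0 < d & forall w, vdist z w < d -> cabs (f w - f z) < e.
Proof.
move=> fa e e0; have [|d d0 dP] := @lin_approx_lip _ _ _ _ _ _ (vnorm a) _ fa.
  exact: cabs_cdot.
have a1 : 0 < vnorm a + 1 by rewrite ltr_wpDl // vnorm_ge0.
exists (Num.min d (e / (vnorm a + 1))); first by rewrite lt_min d0 divr_gt0.
move=> w; rewrite lt_min ltr_pdivlMr // mulrC => /andP[h1 h2].
have := dP (vsub w z); rewrite vaddBK -/(vdist w z) vdistC => /(_ h1) h3.
exact: le_lt_trans h3 h2.
Qed.

End Gradients.

(** * The Bergman space *)

Section Bergman.
Variables (R : realType) (n : nat) (D : set (cvec R n)).
Local Notation C := R[i].
Local Notation V := (cvec R n).
Hypothesis Do : openV D.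
Implicit Types (z w u v : V) (f g : V -> C).

Definition sqabs f : V -> \bar R :=
  fun z => if `[< D z >] then (cabs (f z) ^+ 2)%:E else 0%E.

Lemma L2norm2E f : L2norm2 D f = iter_int n (sqabs f) (@vzero R n).
Proof. by []. Qed.

Lemma sqabs_ge0 f z : (0 <= sqabs f z)%E.
Proof. by rewrite /sqabs; case: asboolP => // _; rewrite lee_fin sqr_ge0. Qed.

Lemma nnlsc_sqabs f : holomorphic D f -> nnlsc (sqabs f).
Proof.
move=> fh; split; first exact: sqabs_ge0.
move=> z a az; have [a0|a0] := ltP a 0.
  exists 1 => // w _; apply: lt_le_trans (sqabs_ge0 f w); by rewrite lte_fin.
move: az; rewrite /sqabs; case: asboolP => [Dz|_]; last by rewrite lte_fin ltNge a0.
rewrite lte_fin => az.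
have sa : Num.sqrt a < cabs (f z).
  rewrite -(ltr_pXn2r (ltn0Sn 1)) ?nnegrE ?sqrtr_ge0 ?cabs_ge0 //.
  by rewrite sqr_sqrtr.
have e0 : 0 < cabs (f z) - Num.sqrt a by rewrite subr_gt0.
have [b fb] := fh _ Dz; have [d d0 dP] := has_cgrad_cont fb e0.
have [d' d'0 d'P] := Do Dz.
exists (Num.min d d'); first by rewrite lt_min d0.
move=> w; rewrite lt_min => /andP[/dP h1 /d'P Dw]; case: asboolP => // _.
rewrite lte_fin -[ltLHS]sqr_sqrtr // ltr_pXn2r ?nnegrE ?sqrtr_ge0 ?cabs_ge0 //.
have := cabs_dist (f z) (f w) 0; rewrite !subr0 (cabsBC (f z)); lra.
Qed.

Lemma L2norm2_ge0 f : holomorphic D f -> (0 <= L2norm2 D f)%E.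
Proof. by move=> fh; rewrite L2norm2E; have [] := nnlsc_iter n (nnlsc_sqabs fh). Qed.

Lemma sqr_cabs_par (c d : C) :
  cabs (c + d) ^+ 2 + cabs (c + -1 * d) ^+ 2 = 2 * cabs c ^+ 2 + 2 * cabs d ^+ 2.
Proof. by rewrite !sqr_cabs; case: c => a b; case: d => a' b' /=; ring. Qed.

Lemma L2norm2Z c f : holomorphic D f ->
  L2norm2 D (fscale c f) = ((cabs c ^+ 2)%:E * L2norm2 D f)%E.
Proof.
move=> fh; rewrite !L2norm2E.
have := congr1 (fun F => F (@vzero R n))
  (iter_intZ n (sqr_ge0 (cabs c)) (nnlsc_sqabs fh)) => /= <-.
congr (iter_int n _ _); apply/funext => z.
rewrite /sqabs; case: asboolP => _; last by rewrite mule0.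
by rewrite -EFinM /fscale cabsM exprMn.
Qed.

Lemma L2norm2_par f g : holomorphic D f -> holomorphic D g ->
  (L2norm2 D (fadd f g) + L2norm2 D (fadd f (fscale (-1)%R g)) =
   2%:E * L2norm2 D f + 2%:E * L2norm2 D g)%E.
Proof.
(* The factor 2 is written [|s| ^ 2], so that it moves into the integrand by homogeneity; the law
   then holds pointwise. *)
move=> fh gh; pose s : C := ((Num.sqrt 2)%:C)%C.
have s2 : cabs s ^+ 2 = 2 by rewrite cabs_real real_normK ?num_real // sqr_sqrtr.
rewrite -s2 -!L2norm2Z // !L2norm2E.
have nsf := nnlsc_sqabs (holoZ s fh); have nsg := nnlsc_sqabs (holoZ s gh).
have np := nnlsc_sqabs (holoD fh gh).
have nm := nnlsc_sqabs (holoD fh (holoZ (-1) gh)).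
have := congr1 (fun F => F (@vzero R n)) (iter_intD n np nm) => /= <-.
have := congr1 (fun F => F (@vzero R n)) (iter_intD n nsf nsg) => /= <-.
congr (iter_int n _ _); apply/funext => z.
rewrite /sqabs; case: asboolP => _; last by rewrite !adde0.
by rewrite -!EFinD /fadd /fscale sqr_cabs_par !cabsM !exprMn s2.
Qed.

Definition A2 : set (V -> C) := [set f | holomorphic D f /\ (L2norm2 D f < +oo)%E].
(* The value [0] off [A2] keeps the seminorm nonnegative on arbitrary functions. *)
Definition A2norm2 f : R := if `[< holomorphic D f >] then fine (L2norm2 D f) else 0.

Lemma A2norm2E f : A2 f -> L2norm2 D f = (A2norm2 f)%:E.
Proof.
move=> [fh fi]; rewrite /A2norm2; case: asboolP => // _; rewrite fineK //.
by rewrite ge0_fin_numE // L2norm2_ge0.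
Qed.

Lemma A2norm2_ge0 f : 0 <= A2norm2 f.
Proof. by rewrite /A2norm2; case: asboolP => // fh; rewrite fine_ge0 // L2norm2_ge0. Qed.

Lemma A2Z c f : A2 f -> A2 (fscale c f).
Proof.
move=> Af; have [fh fi] := Af; split; first exact: holoZ.
by rewrite L2norm2Z // A2norm2E // -EFinM ltry.
Qed.

(** Finiteness comes from the parallelogram law, in which the norm of the difference is
    nonnegative. *)
Lemma A2D f g : A2 f -> A2 g -> A2 (fadd f g).
Proof.
move=> Af Ag; have [fh fi] := Af; have [gh gi] := Ag; split; first exact: holoD.
have := L2norm2_par fh gh; rewrite (A2norm2E Af) (A2norm2E Ag) -!EFinM -EFinD => h.
apply: le_lt_trans (ltry (2 * A2norm2 f + 2 * A2norm2 g)); rewrite -h.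
by rewrite leeDl // L2norm2_ge0 //; apply: holoD => //; exact: holoZ.
Qed.

Lemma A2norm2Z c f : A2 f -> A2norm2 (fscale c f) = cabs c ^+ 2 * A2norm2 f.
Proof.
move=> Af; have [fh _] := Af; apply: EFin_inj.
by rewrite EFinM -!A2norm2E ?L2norm2Z //; exact: A2Z.
Qed.

Lemma A2norm2_par f g : A2 f -> A2 g ->
  A2norm2 (fadd f g) + A2norm2 (fadd f (fscale (-1) g)) = 2 * (A2norm2 f + A2norm2 g).
Proof.
move=> Af Ag; have [fh _] := Af; have [gh _] := Ag; apply: EFin_inj.
have Ap := A2D Af Ag; have Am := A2D Af (A2Z (-1) Ag).
by rewrite mulrDr !EFinD !EFinM -!A2norm2E // L2norm2_par.
Qed.

Lemma ubA2E f : uball A2 A2norm2 f <-> holomorphic D f /\ (L2norm2 D f <= 1)%E.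
Proof.
split=> [[Af fN]|[fh fN]].
  by have [fh _] := Af; split=> //; rewrite A2norm2E // lee_fin.
have Af : A2 f by split=> //; apply: le_lt_trans fN (ltry _).
by split=> //; rewrite -lee_fin -A2norm2E.
Qed.

Lemma A2_bounded f (B : R) : boundedV D -> holomorphic D f ->
  (forall z, D z -> cabs (f z) <= B) -> A2 f.
Proof.
move=> [M DM] fh fB; split=> //.
pose S := Num.max M 0 + 1.
have S0 : 0 < S by rewrite ltr_wpDl // le_max lexx orbT.
have [||||M' M'0 [h _]] := @iter_int_bound R n (sqabs f) (B ^+ 2) S S0 _ _ _ _ n (leqnn n).
- exact: sqr_ge0.
- exact: nnlsc_sqabs.
- move=> z; rewrite /sqabs; case: asboolP => Dz; last by rewrite lee_fin sqr_ge0.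
  have b0 := le_trans (cabs_ge0 _) (fB _ Dz).
  by rewrite lee_fin ler_pXn2r ?nnegrE ?cabs_ge0 ?fB.
- move=> z [j _ jS]; rewrite /sqabs; case: asboolP => // Dz; exfalso.
  have h1 : cabs (z j) < S.
    apply: le_lt_trans (coord_le_vnorm _ _) _; apply: le_lt_trans (DM _ Dz) _.
    by apply: (@le_lt_trans _ _ (Num.max M 0)); rewrite ?le_max ?lexx // ltrDl.
  case: jS => h2.
  + by have := lt_le_trans h1 (le_trans h2 (Re_le_cabs _)); rewrite ltxx.
  + by have := lt_le_trans h1 (le_trans h2 (Im_le_cabs _)); rewrite ltxx.
- rewrite L2norm2E; apply: le_lt_trans (h _) (ltry _).
Qed.

Definition inbox (p : V) (r : R) z :=
  forall j, `|complex.Re (z j) - complex.Re (p j)| <= r /\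
            `|complex.Im (z j) - complex.Im (p j)| <= r.

(** Each integrated coordinate costs the factor [r ^ 2 / 32] of the one-variable sub-mean value
    inequality, whose weight [m] is the factor accumulated so far. *)
Lemma iter_lower p (r : R) f : 0 < r -> (forall z, inbox p r z -> D z) ->
  holomorphic D f -> forall k, (k <= n)%N -> forall z, inbox p r z ->
  (forall j : 'I_n, (j < k)%N -> z j = p j) ->
  (((r ^+ 2 / 32) ^+ k * cabs (f z) ^+ 2)%:E <= iter_int k (sqabs f) z)%E.
Proof.
move=> r0 bD fh; have nf := nnlsc_sqabs fh.
have c0 : 0 <= r ^+ 2 / 32 by rewrite divr_ge0 // sqr_ge0.
elim=> [_ z zb _|k IH kn z zb zp].
  rewrite expr0 mul1r /= /sqabs; case: asboolP => // nD; by case: nD; exact: bD.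
have [I0 Il] := nnlsc_iter k nf.
pose j := Ordinal kn; have zj : z j = p j by exact: zp.
set a := complex.Re (p j); set b := complex.Im (p j).
have pj : p j = (a +i* b)%C by apply: complexP.
have ib x y : `|x - a| <= r -> `|y - b| <= r -> inbox p r (vupd z k (x +i* y)%C).
  move=> xa yb i; rewrite /vupd; case: eqP => [ik|_]; last exact: zb.
  by have -> : i = j by exact: val_inj.
have := @sub_mean_value R r ((r ^+ 2 / 32) ^+ k) a b (fun w : C => f (vupd z k w))
  (fun w : C => iter_int k (sqabs f) (vupd z k w)) r0 (exprn_ge0 _ c0).
rewrite -pj -zj (vupd_id z j : vupd z k (z j) = z) iter_intS => smv.
have {}smv := smv _ _ _ _.
have h : (((r ^+ 2 / 32) ^+ k * cabs (f z) ^+ 2)%:E <=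
    (32 / r ^+ 2)%:E * step_int k (iter_int k (sqabs f)) z)%E.
  apply: smv => //.
  - move=> x y xa yb; have Dw := bD _ (ib _ _ xa yb).
    have [q fq] := fh _ Dw; exists (cdot q (ereal_dir R j)).
    apply: (@cderiv_comp _ _ _ (fun w : C => vupd z k w)) => // h.
    apply/funext => i; rewrite /vupd /vadd /vscale /ereal_dir -(inj_eq val_inj) /=.
    by case: ifP => _; rewrite ?mulr1 // mulr0 addr0.
  - move=> w t /Il[d d0 dP]; exists d => // w' ww; apply: dP.
    by rewrite vdistC; apply: le_lt_trans (vdist_vupd_c _ _ _ _) ww.
  - move=> x y xa yb; apply: IH; [exact: ltnW|exact: ib|].
    move=> i ik; rewrite /vupd ltn_eqF //; apply: zp; exact: ltnW.
rewrite exprS -mulrA EFinM.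
apply: le_trans (lee_wpmul2l _ h) _; first by rewrite lee_fin.
rewrite muleA -EFinM (_ : r ^+ 2 / 32 * (32 / r ^+ 2) = 1) ?mul1e //.
by field; rewrite gt_eqF.
Qed.

Lemma local_bound z0 : D z0 -> exists2 r : R, 0 < r & exists2 K : R, 0 <= K &
  forall z, vdist z0 z < r -> D z /\ forall f, uball A2 A2norm2 f -> cabs (f z) <= K.
Proof.
move=> Dz0; have [e e0 eP] := Do Dz0.
have n0 : 0 < n.+1%:R :> R by rewrite ltr0n.
(* A box of half-side [r] around a point at distance below [r] from [z0] stays within
   [r + 2 r n < e]. *)
pose r := e / 4 / n.+1%:R.
have r0 : 0 < r by rewrite !divr_gt0.
have e4 : e = r * 4 * n.+1%:R by rewrite /r; field; rewrite gt_eqF.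
have boxD z : vdist z0 z < r -> forall w, inbox z r w -> D w.
  move=> zr w wb; apply: eP; apply: le_lt_trans (vdist_triangle _ z _) _.
  have : vdist z w <= \sum_(j < n) (2 * r).
    apply: le_trans (vnorm_le_sum _) _; apply: ler_sum => j _.
    apply: le_trans (cabs_le _) _; rewrite /vsub ReD ImD ReN ImN mulr_natl mulr2n.
    by have [h1 h2] := wb j; apply: lerD; rewrite distrC.
  rewrite sumr_const card_ord -mulr_natr => h.
  have n1 : n.+1%:R = n%:R + 1 :> R by rewrite -natr1.
  have nn : 0 <= n%:R :> R by rewrite ler0n.
  by rewrite e4 n1; nra.
pose c := (r ^+ 2 / 32) ^+ n.
have c0 : 0 < c by rewrite exprn_gt0 // divr_gt0 // exprn_gt0.
(* [x ^ 2 <= c^-1] implies [x <= c^-1 + 1] without taking a root. *)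
exists r => //; exists (c^-1 + 1); first by rewrite addr_ge0 // invr_ge0 ltW.
move=> z zr; have bz := boxD z zr.
have zz : inbox z r z by move=> j; rewrite !subrr normr0 ltW.
split=> [|f [Af fN]]; first exact: bz.
have [fh _] := Af.
have := iter_lower r0 bz fh (leqnn n) zz (fun _ _ => erefl).
rewrite (@iter_int_indep _ _ n _ z (@vzero R n)) //; last first.
  by move=> j; rewrite leqNgt ltn_ord.
rewrite -L2norm2E A2norm2E // lee_fin -/c => h.
have h1 : cabs (f z) ^+ 2 <= c^-1.
  by rewrite -[c^-1]mul1r ler_pdivlMr // mulrC; exact: le_trans h fN.
have c1 : 0 <= c^-1 by rewrite invr_ge0 ltW.
have fz := cabs_ge0 (f z).
by nra.
Qed.

End Bergman.

(** * Positivity of the Bergman metric *)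

Section QuadDerive.
Variable R : realType.

Lemma quad_is_derive (phi : R -> R) (a K d : R) : 0 < d ->
  (forall t, `|t| < d -> `|phi t - phi 0 - t * a| <= K * t ^+ 2) ->
  is_derive (0 : R) 1 phi a.
Proof.
move=> d0 H.
have cv : h^-1 *: (phi (h *: 1 + 0) - phi 0) @[h --> 0^'] --> a.
  apply/cvgrPdist_lt => e e0.
  have K1 : 0 < `|K| + 1 by rewrite ltr_wpDl.
  exists (Num.min d (e / (`|K| + 1))); first by rewrite /= lt_min d0 divr_gt0.
  move=> t /=; rewrite sub0r normrN lt_min => /andP[td te] t0.
  have t0' : 0 < `|t| by rewrite normr_gt0.
  rewrite addr0 /GRing.scale /= mulr1.
  have -> : a - t^-1 * (phi t - phi 0) = - (phi t - phi 0 - t * a) / t by field.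
  rewrite normrM normrN normfV ltr_pdivrMr //.
  apply: le_lt_trans (H _ td) _.
  have te' : `|t| * (`|K| + 1) < e by rewrite -ltr_pdivlMr.
  have -> : t ^+ 2 = `|t| * `|t| by rewrite -expr2 real_normK ?num_real.
  rewrite mulrA ltr_pM2r //.
  by apply: le_lt_trans te'; have := ler_norm K; nra.
apply: DeriveDef; first by apply/cvg_ex; exists a.
exact: cvg_lim.
Qed.

Lemma eq_near_derive1 (phi psi : R -> R) (a d : R) : 0 < d ->
  (forall t, `|t| < d -> phi t = psi t) -> is_derive (0 : R) 1 psi a -> derive1 phi 0 = a.
Proof.
move=> d0 E ha; rewrite derive1E (near_eq_derive (g := psi)); first exact: derive_val.
by exists d => // t /=; rewrite sub0r normrN; exact: E.
Qed.

End QuadDerive.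

Section BergmanMetric.
Variables (R : realType) (n : nat) (D : set (cvec R n)).
Local Notation C := R[i].
Local Notation V := (cvec R n).
Hypothesis Do : openV D.
Implicit Types (z u v w : V) (f g : V -> C).

Local Notation A := (A2 D).
Local Notation N := (A2norm2 D).
Local Notation ball := (uball A N).

Lemma A20 : A (fun=> 0).
Proof.
split; first exact: holo_cst.
rewrite L2norm2E (_ : sqabs D (fun=> 0) = (fun=> 0%E)).
  suff -> : forall k z, iter_int k (fun=> 0%E : \bar R) z = 0%E :> \bar R by [].
  by elim=> //= k IH z; apply: integral0_eq => x _; apply: integral0_eq => y _; rewrite IH.
by apply/funext => z; rewrite /sqabs cabs0 expr0n; case: asboolP.
Qed.

Lemma cdiff_cst (c w : C) : cdiff (fun=> c) w.
Proof. by exists 0; move: (@cderiv_aff R c 0 w); under eq_fun do rewrite mul0r addr0. Qed.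

Lemma cdiffB (g k : C -> C) (w : C) : cdiff g w -> cdiff k w -> cdiff (fun w : C => g w - k w) w.
Proof.
move=> [a ga] [b kb]; exists (a - b) => e e0; have e2 : 0 < e / 2 by rewrite divr_gt0.
have [d d0 gd] := ga _ e2; have [d' d'0 kd] := kb _ e2.
exists (Num.min d d'); first by rewrite lt_min d0.
move=> h; rewrite lt_min => /andP[/gd h1 /kd h2].
have -> : g (w + h) - k (w + h) - (g w - k w) - (a - b) * h =
  (g (w + h) - g w - a * h) - (k (w + h) - k w - b * h) by ring.
by apply: le_trans (cabsB _ _) _; lra.
Qed.

(** All bounds are Cauchy estimates for the two-parameter function [f (z0 + t w + s v)], uniform
    over the unit ball. That its [s]-derivative at 0 is differentiable in [t] is not known
    beforehand: it is the pointwise limit of the difference quotients [q k], holomorphic in [t] with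
    a common bound, and inherits their divided-difference bound. *)
Lemma dir_estimates z0 v w : D z0 -> exists2 d : R, 0 < d & exists2 K : R, 0 <= K &
  (forall t : C, insq d t -> D (vadd z0 (vscale t v)) /\ D (vadd z0 (vscale t w))) /\
  forall f, ball f -> [/\ cabs (f z0) <= K, cabs (dirder v z0 f) <= K,
    (forall t : C, insq d t ->
       cabs (f (vadd z0 (vscale t v)) - f z0 - dirder v z0 f * t) <= K * cabs t ^+ 2) &
    exists2 al : C, cabs al <= K & forall t : C, insq d t ->
       cabs (dirder v (vadd z0 (vscale t w)) f - dirder v z0 f - al * t) <= K * cabs t ^+ 2].
Proof.
move=> Dz0; have [r r0 [M M0 rP]] := local_bound Do Dz0.
pose B := vnorm v + vnorm w + 1.
have v0 := vnorm_ge0 v; have w0 := vnorm_ge0 w.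
have B0 : 0 < B by rewrite /B; lra.
(* Both parameters range over squares of half-side [2 d], so they have modulus at most [4 d], and
   the point stays in the ball of radius [r = 8 d B]. *)
pose d := r / 8 / B; pose rho := 2 * d.
have d0 : 0 < d by rewrite !divr_gt0.
have rho0 : 0 < rho by rewrite mulr_gt0.
have rho2 : rho / 2 = d by rewrite /rho; field.
have rB : 8 * d * B = r by rewrite /d; field; rewrite gt_eqF.
have cab (t : C) : `|complex.Re t| <= rho -> `|complex.Im t| <= rho -> cabs t <= 4 * d.
  by move=> h1 h2; apply: le_trans (cabs_le _) _; rewrite /rho in h1 h2; lra.
pose pt (t s : C) : V := vadd (vadd z0 (vscale t w)) (vscale s v).
have ptP t s : `|complex.Re t| <= rho -> `|complex.Im t| <= rho ->
    `|complex.Re s| <= rho -> `|complex.Im s| <= rho -> vdist z0 (pt t s) < r.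
  move=> t1 t2 s1 s2; have ht := cab _ t1 t2; have hs := cab _ s1 s2.
  apply: le_lt_trans (vdist_triangle _ (vadd z0 (vscale t w)) _) _.
  rewrite !vdist_vadd !vnormZ; rewrite -rB.
  have i1 : cabs t * vnorm w <= 4 * d * vnorm w by apply: ler_wpM2r.
  have i2 : cabs s * vnorm v <= 4 * d * vnorm v by apply: ler_wpM2r.
  by rewrite /B; nra.
have zer : `|complex.Re (0 : C)| <= rho /\ `|complex.Im (0 : C)| <= rho.
  by rewrite /= normr0 ltW.
have [zr zi] := zer.
have in0 : insq d (0 : C) by rewrite /insq /= normr0 d0.
have sqin (t : C) : insq d t -> `|complex.Re t| <= rho /\ `|complex.Im t| <= rho.
  by move=> /andP[h1 h2]; rewrite /rho; split; lra.
have pt0 t : pt t 0 = vadd z0 (vscale t w) by rewrite /pt vadd0.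
have pt0' s : pt 0 s = vadd z0 (vscale s v) by rewrite /pt vadd0.
have pt00 : pt 0 0 = z0 by rewrite pt0 vadd0.
(* [K1] and [K2] are the Cauchy constants of the slices in [s]; [K3] is that of the quotients [q k],
   themselves bounded by [K1]; [K4] bounds the mixed derivative by testing its expansion at
   [t = d / 2]. *)
pose K1 := 64 * M / rho; pose K2 := 128 * M / rho ^+ 2; pose K3 := 128 * K1 / rho ^+ 2.
pose K4 := (2 * K1 + K3 * (d / 2) ^+ 2) / (d / 2).
have K10 : 0 <= K1 by apply: divr_ge0; [exact: mulr_ge0|exact: ltW].
have K20 : 0 <= K2 by apply: divr_ge0; [exact: mulr_ge0|exact: sqr_ge0].
have K30 : 0 <= K3 by apply: divr_ge0; [exact: mulr_ge0|exact: sqr_ge0].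
have K40 : 0 <= K4.
  apply: divr_ge0; last by apply: divr_ge0 => //; exact: ltW.
  by apply: addr_ge0; [exact: mulr_ge0|apply: mulr_ge0 => //; exact: sqr_ge0].
pose K := M + K1 + K2 + K3 + K4.
have [KM KK1 KK2 KK3 KK4] : [/\ M <= K, K1 <= K, K2 <= K, K3 <= K & K4 <= K].
  by rewrite /K; clearbody K1 K2 K3 K4; clear -M0 K10 K20 K30 K40; split; lra.
have K0 : 0 <= K := le_trans M0 KM.
have K12 : K1 + K1 = 2 * K1 by rewrite mulr_natl mulr2n.
clearbody K.
exists d => //; exists K => //.
split=> [t /sqin[h1 h2]|f bf].
  split.
  - by have [] := rP (pt 0 t) (ptP _ _ zr zi h1 h2); rewrite pt0'.
  - by have [] := rP (pt t 0) (ptP _ _ h1 h2 zr zi); rewrite pt0.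
have [[fh _] _] := bf.
have fM t s : `|complex.Re t| <= rho -> `|complex.Im t| <= rho ->
    `|complex.Re s| <= rho -> `|complex.Im s| <= rho -> cabs (f (pt t s)) <= M.
  by move=> t1 t2 s1 s2; have [_ /(_ f bf)] := rP _ (ptP _ _ t1 t2 s1 s2).
have Dpt t s : `|complex.Re t| <= rho -> `|complex.Im t| <= rho ->
    `|complex.Re s| <= rho -> `|complex.Im s| <= rho -> D (pt t s).
  by move=> t1 t2 s1 s2; have [] := rP _ (ptP _ _ t1 t2 s1 s2).
pose e (t s : C) := f (pt t s).
have eds t s : `|complex.Re t| <= rho -> `|complex.Im t| <= rho ->
    `|complex.Re s| <= rho -> `|complex.Im s| <= rho -> cdiff (e t) s.
  move=> t1 t2 s1 s2; eexists; apply: (cderiv_line (v := v)).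
  exact: (cgradP fh (Dpt _ _ t1 t2 s1 s2)).
have edt t s : `|complex.Re t| <= rho -> `|complex.Im t| <= rho ->
    `|complex.Re s| <= rho -> `|complex.Im s| <= rho -> cdiff (fun t : C => e t s) t.
  move=> t1 t2 s1 s2; eexists.
  apply: (@cderiv_comp R n f (fun t : C => pt t s) t w).
    by move=> h; apply/funext => j; rewrite /pt /vadd /vscale; ring.
  exact: (cgradP fh (Dpt _ _ t1 t2 s1 s2)).
pose phi (t : C) := dirder v (vadd z0 (vscale t w)) f.
have phiP t : insq d t -> cderiv (e t) 0 (phi t).
  move=> /sqin[h1 h2]; have Dt := Dpt _ _ h1 h2 zr zi; rewrite pt0 in Dt.
  apply: (cderiv_line (v := v)); rewrite vadd0; exact: (cgradP fh Dt).
have D1 t : insq d t -> dd1_bound d K1 (e t).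
  move=> /sqin[h1 h2]; rewrite -rho2; apply: dd1_boundP => // s s1 s2; [exact: eds|exact: fM].
have D2 t : insq d t -> dd2_bound d K2 (e t).
  move=> /sqin[h1 h2]; rewrite -rho2; apply: dd2_boundP => // s s1 s2; [exact: eds|exact: fM].
have D1' t : `|complex.Re t| <= rho -> `|complex.Im t| <= rho -> dd1_bound d K1 (e t).
  move=> h1 h2; rewrite -rho2; apply: dd1_boundP => // s s1 s2; [exact: eds|exact: fM].
have phi0 : phi 0 = dirder v z0 f by rewrite /phi vadd0.
have phiK t : insq d t -> cabs (phi t) <= K1.
  by move=> ti; apply: dd1_bound_cderiv (D1 _ ti) (phiP _ ti).
have ef s : e 0 s = f (vadd z0 (vscale s v)) by rewrite /e pt0'.
(* The exponent [k.+1] keeps [sk k] strictly below [d] already for [k = 0]. *)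
pose sk (k : nat) : R := d / 2 ^+ k.+1.
have p2 k : 0 < (2 : R) ^+ k by rewrite exprn_gt0.
have sk0 k : 0 < sk k by rewrite /sk divr_gt0.
have skd k : sk k < d.
  rewrite /sk ltr_pdivrMr // ltr_pMr // exprS.
  by rewrite (@lt_le_trans _ _ 2) ?ltr1n // ler_peMr // exprn_ege1 // ler1n.
have ski k : insq d ((sk k)%:C)%C.
  by rewrite /insq /= normr0 d0 andbT ger0_norm // ltW.
have ska k : cabs ((sk k)%:C)%C = sk k by rewrite cabs_real gtr0_norm.
have sk_neq k : ((sk k)%:C)%C != 0 :> C by rewrite -cabs_gt0 ska.
pose q k t := (e t ((sk k)%:C)%C - e t 0) / ((sk k)%:C)%C.
have qd k : dd2_bound d K3 (q k).
  have [s1 s2] := sqin _ (ski k).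
  rewrite -rho2; apply: dd2_boundP => // t t1 t2.
  - apply: (cdiffM _ (cdiff_cst _ _)); apply: cdiffB; exact: edt.
  - rewrite /q cabsM cabsV ler_pdivrMr ?ska //.
    have := D1' t t1 t2 0 ((sk k)%:C)%C in0 (ski k).
    by rewrite subr0 ska.
have phid : dd2_bound d K3 phi.
  apply: (dd2_bound_lim qd) => t ti ep ep0.
  have [k0 k0P] := exists_pow2 (K2 * d) ep0.
  exists k0 => k kk.
  have := dd2_bound_cderiv K20 (D2 _ ti) in0 (phiP _ ti) (ski k).
  rewrite subr0 ska => h.
  have -> : q k t - phi t = (e t ((sk k)%:C)%C - e t 0 - phi t * ((sk k)%:C)%C) / ((sk k)%:C)%C.
    by rewrite /q; field; exact: sk_neq.
  rewrite cabsM cabsV ska ltr_pdivrMr //; apply: le_lt_trans h _.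
  rewrite expr2 mulrA ltr_pM2r //; apply: le_lt_trans k0P.
  rewrite /sk mulrA; apply: ler_wpM2l; first by rewrite mulr_ge0 // ltW.
  by rewrite lef_pV2 ?posrE // ler_eXn2l ?ltr1n // ltnW // ltnS.
have [al alP] := dd2_bound_deriv K30 phid in0.
split.
- by apply: le_trans KM; rewrite -pt00; exact: fM.
- by rewrite -phi0; exact: le_trans (phiK _ in0) _.
- move=> t ti; have := dd2_bound_cderiv K20 (D2 _ in0) in0 (phiP _ in0) ti.
  rewrite !ef vadd0 subr0 phi0 => h; apply: (le_trans h).
  by apply: ler_wpM2r => //; exact: sqr_ge0.
- exists al.
    have d2 : 0 < d / 2 by rewrite divr_gt0.
    have d2i : insq d ((d / 2)%:C)%C.
      by rewrite /insq /= normr0 d0 andbT gtr0_norm // ltr_pdivrMr // ltr_pMr // ltr1n.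
    have d2a : cabs ((d / 2)%:C : C)%C = d / 2 by rewrite cabs_real gtr0_norm.
    apply: le_trans KK4.
    rewrite /K4 ler_pdivlMr // -{1}d2a -cabsM.
    have := alP _ d2i; rewrite subr0 d2a => h.
    have h1 := phiK _ d2i; have h2 := phiK _ in0.
    have -> : al * ((d / 2)%:C)%C = (phi ((d / 2)%:C)%C - phi 0) -
       (phi ((d / 2)%:C)%C - phi 0 - al * ((d / 2)%:C)%C) by ring.
    apply: le_trans (cabsB _ _) _; apply: lerD => //.
    by apply: le_trans (cabsB _ _) _; rewrite -K12; exact: lerD.
  move=> t ti; have := alP _ ti; rewrite subr0 phi0 => h; apply: (le_trans h).
  by apply: ler_wpM2r => //; exact: sqr_ge0.
Qed.

Lemma cderiv_near (g k : C -> C) (a al : C) (d : R) : 0 < d ->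
  (forall h, cabs h < d -> g (a + h) = k (a + h)) -> cderiv g a al -> cderiv k a al.
Proof.
move=> d0 gk ga e e0; have [d' d'0 dP] := ga e e0.
exists (Num.min d d'); first by rewrite lt_min d0.
move=> h; rewrite lt_min => /andP[/gk E /dP]; rewrite E.
by have := gk 0; rewrite cabs0 addr0 => /(_ d0) ->.
Qed.

Lemma cderivD (g k : C -> C) (w a b : C) : cderiv g w a -> cderiv k w b ->
  cderiv (fun w : C => g w + k w) w (a + b).
Proof.
move=> ga kb e e0; have e2 : 0 < e / 2 by rewrite divr_gt0.
have [d d0 gd] := ga _ e2; have [d' d'0 kd] := kb _ e2.
exists (Num.min d d'); first by rewrite lt_min d0.
move=> h; rewrite lt_min => /andP[/gd h1 /kd h2].
have -> : g (w + h) + k (w + h) - (g w + k w) - (a + b) * h =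
  (g (w + h) - g w - a * h) + (k (w + h) - k w - b * h) by ring.
by apply: le_trans (cabsD _ _) _; lra.
Qed.

Lemma cderivZ (c : C) (g : C -> C) (w a : C) : cderiv g w a ->
  cderiv (fun w : C => c * g w) w (c * a).
Proof.
move=> ga; have := @cderiv_aff R c 0 w; under eq_fun do rewrite mul0r addr0.
by move=> h; have := cderivM h ga; rewrite mul0r add0r.
Qed.

Lemma line_in z v : D z -> exists2 d : R, 0 < d &
  forall h : C, cabs h < d -> D (vadd z (vscale h v)).
Proof.
move=> Dz; have [e e0 eP] := Do Dz.
have v1 : 0 < vnorm v + 1 by rewrite ltr_wpDl // vnorm_ge0.
exists (e / (vnorm v + 1)); first by rewrite divr_gt0.
move=> h; rewrite ltr_pdivlMr // => hh; apply: eP; rewrite vdist_vadd vnormZ.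
by apply: le_lt_trans hh; rewrite ler_wpM2l ?cabs_ge0 // lerDl.
Qed.

Lemma A2_scale_ball f : A f -> exists2 c : C, c != 0 & ball (fscale c f).
Proof.
move=> Af; have n0 : 0 < N f + 1 by rewrite ltr_wpDl // A2norm2_ge0.
pose s := (Num.sqrt (N f + 1))^-1.
have s0 : 0 < s by rewrite invr_gt0 sqrtr_gt0.
exists (s%:C)%C; first by rewrite -cabs_gt0 cabs_real gtr0_norm.
split; first exact: A2Z.
rewrite A2norm2Z // cabs_real gtr0_norm // exprVn sqr_sqrtr ?(ltW n0) //.
by rewrite mulrC ler_pdivrMr // mul1r lerDl.
Qed.

Definition dirder2 v w z f : C := ClassicalEpsilon.epsilon (inhabits 0)
  (fun al => cderiv (fun t : C => dirder v (vadd z (vscale t w)) f) 0 al).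

Lemma dirder2E v w z f al : cderiv (fun t : C => dirder v (vadd z (vscale t w)) f) 0 al ->
  dirder2 v w z f = al.
Proof.
move=> h; apply: (cderiv_unique _ h).
by rewrite /dirder2; apply: ClassicalEpsilon.epsilon_spec; exists al.
Qed.

Lemma insq_cabs (d : R) (h : C) : cabs h < d -> insq d h.
Proof.
move=> hd; apply/andP; split; apply: le_lt_trans hd; [exact: Re_le_cabs|exact: Im_le_cabs].
Qed.

Lemma dirder2_ball v w z f : D z -> ball f ->
  cderiv (fun t : C => dirder v (vadd z (vscale t w)) f) 0 (dirder2 v w z f).
Proof.
move=> Dz bf; have [d d0 [K K0 [_ /(_ f bf)[_ _ _ [al _ alP]]]]] := dir_estimates v w Dz.
suff h : cderiv (fun t : C => dirder v (vadd z (vscale t w)) f) 0 al by rewrite (dirder2E h).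
apply: (quad_cderiv K0 d0) => h /insq_cabs /alP; rewrite add0r vadd0; exact.
Qed.

(** The estimates live on the unit ball; scaling carries differentiability to the whole Bergman
    space. *)
Lemma dirder2P v w z f : D z -> A f ->
  cderiv (fun t : C => dirder v (vadd z (vscale t w)) f) 0 (dirder2 v w z f).
Proof.
move=> Dz Af; have [c c0 cf] := A2_scale_ball Af; have [fh _] := Af.
have h := cderivZ c^-1 (dirder2_ball v w Dz cf).
have [d d0 dP] := line_in w Dz.
have {}h : cderiv (fun t : C => dirder v (vadd z (vscale t w)) f) 0
    (c^-1 * dirder2 v w z (fscale c f)).
  apply: (cderiv_near d0 _ h) => t td; rewrite add0r (dirderZ _ _ (dP _ td) fh).
  by rewrite mulrA mulVf // mul1r.
by rewrite (dirder2E h).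
Qed.

Definition ev z f : C := f z.

Lemma bfun_ev z : D z -> bfun A N (ev z).
Proof.
move=> Dz; split=> //.
have [r r0 [M _ MP]] := local_bound Do Dz; exists M => f bf.
by have [|_ /(_ f bf)] := MP z; rewrite ?vdist0.
Qed.

Lemma bfun_dirder v z : D z -> bfun A N (dirder v z).
Proof.
move=> Dz; split=> [f g [fh _] [gh _]|c f [fh _]|].
- exact: (dirderD v Dz fh gh).
- exact: (dirderZ v c Dz fh).
- have [d d0 [K K0 [_ KP]]] := dir_estimates v v Dz; exists K => f /KP; by case.
Qed.

Lemma bfun_dirder2 v w z : D z -> bfun A N (dirder2 v w z).
Proof.
move=> Dz; have [d d0 dP] := line_in w Dz; split=> [f g Af Ag|c f Af|].
- have [fh _] := Af; have [gh _] := Ag.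
  have h := cderivD (dirder2P v w Dz Af) (dirder2P v w Dz Ag).
  apply: dirder2E; apply: (cderiv_near d0 _ h) => t td.
  by rewrite add0r (dirderD _ (dP _ td) fh gh).
- have [fh _] := Af.
  have h := cderivZ c (dirder2P v w Dz Af).
  apply: dirder2E; apply: (cderiv_near d0 _ h) => t td.
  by rewrite add0r (dirderZ _ _ (dP _ td) fh).
- have [d' d'0 [K K0 [_ KP]]] := dir_estimates v w Dz; exists K => f bf.
  have [_ _ _ [al alK alP]] := KP _ bf.
  rewrite (dirder2E (al := al)) //.
  by apply: (quad_cderiv K0 d'0) => h /insq_cabs /alP; rewrite add0r vadd0; exact.
Qed.

Definition vline z v (t : R) : V := vadd z (vscale (t%:C)%C v).

Lemma vline0 z v : vline z v 0 = z.
Proof. by rewrite /vline vadd0. Qed.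

Lemma real_estimates v w z : D z -> exists2 d : R, 0 < d & exists2 K : R, 0 <= K &
  forall t, `|t| < d -> [/\ D (vline z v t), D (vline z w t),
   forall f, ball f ->
     cabs (ev (vline z v t) f - ev z f - (t%:C)%C * dirder v z f) <= K * t ^+ 2 &
   forall f, ball f ->
     cabs (dirder v (vline z w t) f - dirder v z f - (t%:C)%C * dirder2 v w z f) <= K * t ^+ 2].
Proof.
move=> Dz; have [d d0 [K K0 [KD KP]]] := dir_estimates v w Dz.
exists d => //; exists K => // t td.
have ti : insq d (t%:C)%C by apply: insq_cabs; rewrite cabs_real.
have t2 : cabs ((t%:C)%C : C) ^+ 2 = t ^+ 2 by rewrite cabs_real real_normK ?num_real.
have [h1 h2] := KD _ ti; split=> // f bf; have [_ _ i1 [al _ alP]] := KP f bf.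
- by have := i1 _ ti; rewrite t2 mulrC.
- rewrite (dirder2E (al := al)); first by have := alP _ ti; rewrite t2 mulrC.
  by apply: (quad_cderiv K0 d0) => h /insq_cabs /alP; rewrite add0r vadd0; exact.
Qed.

(** * Derivatives of the kernel and of its logarithm *)

Local Notation B := (dinner A N).
Let AD := A2D Do.
Let AZ := A2Z Do.
Let N0 := A2norm2_ge0 Do.
Let NZ := A2norm2Z Do.
Let NP := A2norm2_par Do.

Definition kdiag z : R := dnorm2 A N (ev z).

Lemma bergman_diagE z : bergman_diag D z = kdiag z.
Proof.
congr sup; apply/seteqP; split=> _ [f fP <-]; exists f => //; exact/(ubA2E Do).
Qed.

Lemma kdiag_derive v z : D z ->
  is_derive (0 : R) 1 (fun t => kdiag (vline z v t)) (2 * B (ev z) (dirder v z)).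
Proof.
move=> Dz; have [d d0 [K K0 KP]] := real_estimates v v Dz.
have be := bfun_ev Dz; have bd := bfun_dirder v Dz.
have hb t : `|t| < d -> bfun A N (ev (vline z v t)).
  by move=> /KP[h _ _ _]; exact: bfun_ev.
have he t f : `|t| < d -> ball f ->
    cabs (ev (vline z v t) f - ev z f - (t%:C)%C * dirder v z f) <= K * t ^+ 2.
  by move=> /KP[_ _ h _]; exact: h.
have [d' d'0 [K' K'P]] := dinner_curve A20 AD AZ N0 NZ NP d0 K0 be bd be bd hb hb he he.
apply: (@quad_is_derive _ _ _ K' (Num.min d d')); first by rewrite lt_min d0.
move=> t; rewrite lt_min => /andP[td td']; have := K'P _ td'.
rewrite (dinner_diag A20 NZ (hb _ td)) (dinner_diag A20 NZ be) (vline0 z v) -/(kdiag _) -/(kdiag _).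
have -> : B (dirder v z) (ev z) + B (ev z) (dirder v z) = 2 * B (ev z) (dirder v z).
  by rewrite (dinnerC _ _ (dirder v z) (ev z)); ring.
exact.
Qed.

Lemma kmix_derive w v z : D z ->
  is_derive (0 : R) 1 (fun t => B (ev (vline z v t)) (dirder w (vline z v t)))
    (B (dirder v z) (dirder w z) + B (ev z) (dirder2 w v z)).
Proof.
move=> Dz; have [d1 d10 [K1 K10 KP1]] := real_estimates v v Dz.
have [d2 d20 [K2 K20 KP2]] := real_estimates w v Dz.
pose d := Num.min d1 d2; pose K := K1 + K2.
have d0 : 0 < d by rewrite lt_min d10.
have K0 : 0 <= K by rewrite addr_ge0.
have t20 (t : R) : 0 <= t ^+ 2 by exact: sqr_ge0.
have be := bfun_ev Dz; have bv := bfun_dirder v Dz; have bw := bfun_dirder w Dz.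
have b2 := bfun_dirder2 w v Dz.
have hb1 t : `|t| < d -> bfun A N (ev (vline z v t)).
  by rewrite lt_min => /andP[/KP1[h _ _ _] _]; exact: bfun_ev.
have hb2 t : `|t| < d -> bfun A N (dirder w (vline z v t)).
  by rewrite lt_min => /andP[/KP1[h _ _ _] _]; exact: bfun_dirder.
have he1 t f : `|t| < d -> ball f ->
    cabs (ev (vline z v t) f - ev z f - (t%:C)%C * dirder v z f) <= K * t ^+ 2.
  rewrite lt_min => /andP[/KP1[_ _ h _] _] bf; apply: (le_trans (h f bf)).
  by apply: ler_wpM2r => //; rewrite /K lerDl.
have he2 t f : `|t| < d -> ball f ->
    cabs (dirder w (vline z v t) f - dirder w z f - (t%:C)%C * dirder2 w v z f) <= K * t ^+ 2.
  rewrite lt_min => /andP[_ /KP2[_ _ _ h]] bf; apply: (le_trans (h f bf)).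
  by apply: ler_wpM2r => //; rewrite /K lerDr.
have [d' d'0 [K' K'P]] := dinner_curve A20 AD AZ N0 NZ NP d0 K0 be bv bw b2 hb1 hb2 he1 he2.
apply: (@quad_is_derive _ _ _ K' d' d'0) => t td; rewrite (vline0 z v); exact: (K'P t td).
Qed.

Hypothesis Db : boundedV D.

Lemma A2_cst (c : C) : A (fun=> c).
Proof.
by apply: (@A2_bounded _ _ _ Do _ (cabs c)) => //; exact: holo_cst.
Qed.

Lemma kdiag_gt0 z : D z -> 0 < kdiag z.
Proof.
move=> Dz; apply: (dnorm2_gt0 A20 AZ N0 NZ (bfun_ev Dz) (A2_cst 1)).
by rewrite /ev oner_eq0.
Qed.

Local Notation logK := (fun w => ln (bergman_diag D w)).

Lemma rdir_logK w z : D z -> rdir logK w z = 2 * B (ev z) (dirder w z) / kdiag z.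
Proof.
move=> Dz; rewrite /rdir derive1E.
have -> : (fun t : R => ln (bergman_diag D (vadd z (vscale (t%:C)%C w)))) =
    (@ln R) \o (fun t => kdiag (vline z w t)).
  by apply/funext => t; rewrite /= bergman_diagE.
have hk : is_derive (kdiag (vline z w 0)) 1 (@ln R) (kdiag (vline z w 0))^-1.
  by apply: is_derive1_ln; rewrite vline0; exact: kdiag_gt0.
have h := @is_derive1_comp R (@ln R) (fun t => kdiag (vline z w t)) 0 _ _ hk (kdiag_derive w Dz).
by rewrite (@derive_val _ _ _ _ _ _ _ h) vline0 mulrC.
Qed.

Lemma rdir2_logK w v z : D z -> rdir (rdir logK w) v z =
  2 * (B (dirder v z) (dirder w z) + B (ev z) (dirder2 w v z)) / kdiag z -
  (2 * B (ev z) (dirder w z)) * (2 * B (ev z) (dirder v z)) / kdiag z ^+ 2.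
Proof.
move=> Dz; have [d d0 dP] := line_in v Dz.
have k0 := kdiag_gt0 Dz.
pose g (t : R) : R := B (ev (vline z v t)) (dirder w (vline z v t)).
pose k (t : R) : R := kdiag (vline z v t).
have hg : is_derive (0 : R) 1 g _ := kmix_derive w v Dz.
have hk : is_derive (0 : R) 1 k _ := kdiag_derive v Dz.
have kn : k 0 != 0 by rewrite /k vline0 gt_eqF.
have hv := is_deriveV kn hk.
have hm := is_deriveM (is_deriveZ 2 hg) hv.
apply: (@eq_near_derive1 R _ ((2 \*: g) * (fun t => (k t)^-1)) _ d d0).
  move=> t td; rewrite rdir_logK //; apply: dP; by rewrite cabs_real.
apply: (is_derive_eq hm).
rewrite /k /g /= vline0 /GRing.scale /=.
by field; rewrite gt_eqF.
Qed.

Lemma dirder_scale (c : C) v z : dirder (vscale c v) z = fscale c (dirder v z).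
Proof. by apply/funext => f; rewrite /dirder /fscale cdotZr. Qed.

(** The identities for [dirder2] hold on the Bergman space only, so functionals have to be compared
    on the unit ball rather than as functions. *)
Lemma dinner_ext L M M' : (forall f, ball f -> M f = M' f) -> B L M = B L M'.
Proof.
move=> MM; have ext X X' : (forall f, ball f -> X f = X' f) -> dnorm2 A N X = dnorm2 A N X'.
  move=> XX; congr sup; apply/seteqP; split=> _ [f bf <-]; exists f => //; by rewrite XX.
by rewrite /dinner (ext _ _ MM) (ext (fadd L M) (fadd L M')) // => f bf; rewrite /fadd MM.
Qed.

Lemma dirder2_scale_l (c : C) v w z f : D z -> A f ->
  dirder2 (vscale c v) w z f = c * dirder2 v w z f.
Proof.
move=> Dz Af; apply: dirder2E; have h := cderivZ c (dirder2P v w Dz Af).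
suff -> : (fun t : C => dirder (vscale c v) (vadd z (vscale t w)) f) =
  (fun t : C => c * dirder v (vadd z (vscale t w)) f) by exact: h.
by apply/funext => t; rewrite dirder_scale.
Qed.

Lemma dirder2_scale_r v w z f : D z -> A f ->
  dirder2 v (vscale 'i%C w) z f = 'i%C * dirder2 v w z f.
Proof.
move=> Dz Af; apply: dirder2E => e e0.
have [d d0 dP] := dirder2P v w Dz Af e0.
exists d => // h hd; have := dP ('i%C * h); rewrite cabsM cabs_i mul1r !add0r => /(_ hd).
have -> : vscale h (vscale 'i%C w) = vscale ('i%C * h) w.
  by apply/funext => k; rewrite /vscale; ring.
by rewrite !vadd0 mulrA (mulrC _ 'i%C).
Qed.

(** The second derivatives of [f] drop out: by complex linearity in both directions,
    [dirder2 iw iv = - dirder2 w v] and [dirder2 iw v = dirder2 w iv]. Only products of first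
    derivatives remain, as in [log_levi]. *)
Lemma rdir2_logK_levi (v w : V) z : D z ->
  let dd v w := rdir (rdir logK w) v z in
  let e := ev z in let K := kdiag z in
  let dv := dirder v z in let dw := dirder w z in
  let iv := vscale 'i%C v in let iw := vscale 'i%C w in
  (dd v w + dd iv iw) / 4 = B dv dw / K - (B e dv * B e dw
      + B e (fscale 'i%C dv) * B e (fscale 'i%C dw)) / K ^+ 2 /\
  (dd v iw - dd iv w) / 4 = B dv (fscale 'i%C dw) / K - (B e dv * B e (fscale 'i%C dw)
      - B e (fscale 'i%C dv) * B e dw) / K ^+ 2.
Proof.
move=> Dz dd e K dv dw iv iw.
have k0 : K != 0 by rewrite gt_eqF ?kdiag_gt0.
have be : bfun A N e := bfun_ev Dz.
have bv : bfun A N dv := bfun_dirder v Dz.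
have bw : bfun A N dw := bfun_dirder w Dz.
have b2 := bfun_dirder2 w v Dz.
have e1 : B e (dirder2 iw iv z) = - B e (dirder2 w v z).
  rewrite (dinnerC _ _ e (dirder2 w v z)) -(dinnerNl A20 AD AZ N0 NZ NP b2 be).
  rewrite (dinnerC _ _ _ e); apply: dinner_ext => // f [Af _].
  by rewrite /iw /iv dirder2_scale_l // dirder2_scale_r // /fscale mulrA -expr2 sqr_i.
have e2 : B e (dirder2 iw v z) = B e (dirder2 w iv z).
  by apply: dinner_ext => // f [Af _]; rewrite /iw /iv dirder2_scale_l // dirder2_scale_r.
have h1 := rdir2_logK w v Dz; have h2 := rdir2_logK iw iv Dz.
have h3 := rdir2_logK iw v Dz; have h4 := rdir2_logK w iv Dz.
rewrite {1}/iv {1}/iw in h2 h3 h4.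
rewrite !(dirder_scale _ w) !(dirder_scale _ v) in h2 h3 h4.
rewrite -/iv -/iw -/e -/dv -/dw -/K in h1 h2 h3 h4.
rewrite e1 (dinner_i A20 NZ bv bw) in h2; rewrite e2 in h3.
rewrite (dinner_il A20 AD AZ N0 NZ NP bv bw) in h4.
rewrite -/(dd v w) in h1; rewrite -/(dd iv iw) in h2.
rewrite -/(dd v iw) in h3; rewrite -/(dd iv w) in h4.
by rewrite h1 h2 h3 h4; split; field.
Qed.

Lemma levi_coef_logK i j z : D z -> levi_coef logK i j z =
  log_levi A N (fun j => dirder (ereal_dir R j) z) (ev z) i j.
Proof.
move=> Dz; rewrite /levi_coef (eimag_scale R i) (eimag_scale R j).
have [h1 h2] := rdir2_logK_levi (ereal_dir R i) (ereal_dir R j) Dz.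
by rewrite h1 h2.
Qed.

Theorem bergman_metric_gt0 z u : D z -> u <> @vzero R n -> 0 < bergman_metric D z u.
Proof.
move=> Dz u0; rewrite /bergman_metric.
pose F (j : 'I_n) := dirder (ereal_dir R j) z.
have bF j : bfun A N (F j) by exact: bfun_dirder.
have be := bfun_ev Dz; have k0 := kdiag_gt0 Dz.
have [k kE] := log_levi_sum A20 AD AZ N0 NZ NP u bF be k0.
under eq_bigr do under eq_bigr do rewrite levi_coef_logK //.
rewrite kE; apply: divr_gt0 => //.
pose b : V := fun j => (u j)^*%C.
(* [f0] vanishes at [z] and its derivative along [u] is [|u|^2]. *)
pose f0 := fadd (cdot b) (fun=> - cdot b z).
have f0h : holomorphic D f0 by apply: holoD; [exact: holo_lin|exact: holo_cst].
have Af0 : A f0.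
  have [M DM] := Db.
  apply: (@A2_bounded _ _ _ Do _ (vnorm b * M + cabs (cdot b z))) => // w Dw.
  rewrite /f0 /fadd; apply: le_trans (cabsB _ _) _; rewrite lerD2r.
  by apply: le_trans (cabs_cdot _ _) _; rewrite ler_wpM2l ?vnorm_ge0 // DM.
have bS := bfunD (bfun_sum u bF (index_enum 'I_n)) (bfunZ k be).
apply: (dnorm2_gt0 A20 AZ N0 NZ bS Af0).
rewrite /fadd /fscale /ev {2}/f0 /fadd subrr mulr0 addr0.
have Ff0 j : F j f0 = (u j)^*%C.
  rewrite /F /dirder cdot_ereal (cgradE (has_cgradD (has_cgrad_lin b z) (has_cgrad_cst _ z))).
  by rewrite /vadd /vzero addr0.
have [j uj] : exists j, u j != 0.
  apply: contrapT => nj; apply: u0; apply/funext => j; apply/eqP/negPn/negP => uj.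
  by apply: nj; exists j.
have cc (c : C) : complex.Re (c * c^*%C) = cabs c ^+ 2.
  by rewrite sqr_cabs; case: c => x y /=; ring.
apply/eqP => /(congr1 (@complex.Re R)) /eqP; rewrite Re_sum /=.
under eq_bigr do rewrite Ff0 cc.
by rewrite -sqr_vnorm gt_eqF // exprn_gt0 //; apply: lt_le_trans (coord_le_vnorm u j);
  rewrite cabs_gt0.
Qed.

End BergmanMetric.

(** * Bloch functions and the spectrum *)

Section Bloch.
Variables (R : realType) (n : nat) (D : set (cvec R n)).
Local Notation C := R[i].
Local Notation V := (cvec R n).
Hypotheses (n0 : (0 < n)%N) (Do : openV D) (Dc : connectedV D) (Db : boundedV D).
Hypothesis D0 : D (@vzero R n).
Implicit Types (z u v w : V) (f g psi phi : V -> C).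

Definition qratio f z u : R := cabs (cdot (cgrad f z) u) / Num.sqrt (bergman_metric D z u).

Lemma qratio_ge0 f z u : 0 <= qratio f z u.
Proof. by rewrite divr_ge0 ?cabs_ge0 ?sqrtr_ge0. Qed.

Lemma qratio_gt0 f z u : D z -> u <> @vzero R n -> cdot (cgrad f z) u != 0 -> 0 < qratio f z u.
Proof.
move=> Dz u0 fu; rewrite divr_gt0 ?cabs_gt0 // sqrtr_gt0; exact: bergman_metric_gt0.
Qed.

Lemma has_cgrad_eq_on f g z a : eq_on D f g -> D z -> has_cgrad f z a -> has_cgrad g z a.
Proof.
move=> fg Dz fa e e0; have [d d0 dP] := fa e e0; have [d' d'0 d'P] := Do Dz.
exists (Num.min d d'); first by rewrite lt_min d0.
move=> h; rewrite lt_min => /andP[/dP h1 h2].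
rewrite -!fg //; apply: d'P; by rewrite vdist_vadd.
Qed.

Lemma ereal_dir_neq0 (j : 'I_n) : ereal_dir R j <> @vzero R n.
Proof.
by move=> /(congr1 (fun v => v j)); rewrite /ereal_dir /vzero eqxx => /eqP; rewrite oner_eq0.
Qed.

(** Bounding a [sup] from above requires a nonempty set, and nonzero directions exist only in
    positive dimension. *)
Lemma Q_ratios_neq0 f z : (Q_ratios D f z) !=set0.
Proof.
by exists (qratio f z (ereal_dir R (Ordinal n0))), (ereal_dir R (Ordinal n0)) => //;
  exact: ereal_dir_neq0.
Qed.

Lemma Qf_le f z (B : R) : (forall u, u <> @vzero R n -> qratio f z u <= B) -> Qf D f z <= B.
Proof. by move=> fB; apply: ge_sup; [exact: Q_ratios_neq0|move=> _ [u u0 <-]; exact: fB]. Qed.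

Lemma qratio_le_Qf f z u : bloch D f -> D z -> u <> @vzero R n -> qratio f z u <= Qf D f z.
Proof.
move=> [_ [M MP]] Dz u0; apply: ub_le_sup; last by exists u.
by exists M => _ [v v0 <-]; exact: MP.
Qed.

Lemma Qf_ge0 f z : bloch D f -> D z -> 0 <= Qf D f z.
Proof.
move=> fb Dz; apply: le_trans (qratio_le_Qf fb Dz (@ereal_dir_neq0 (Ordinal n0))).
exact: qratio_ge0.
Qed.

Lemma Qf_le_beta f z : bloch D f -> D z -> Qf D f z <= beta D f.
Proof.
move=> [fh [M MP]] Dz; apply: ub_le_sup; last by exists z.
by exists M => _ [w Dw <-]; apply: Qf_le => u u0; exact: MP.
Qed.

Lemma beta_le f (B : R) : (forall z, D z -> Qf D f z <= B) -> beta D f <= B.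
Proof.
move=> fB; apply: ge_sup; first by exists (Qf D f (@vzero R n)), (@vzero R n).
by move=> _ [z Dz <-]; exact: fB.
Qed.

Lemma beta_ge0 f : bloch D f -> 0 <= beta D f.
Proof. by move=> fb; apply: le_trans (Qf_le_beta fb D0); exact: Qf_ge0. Qed.

Lemma bloch_norm_ge0 f : bloch D f -> 0 <= bloch_norm D f.
Proof. by move=> fb; rewrite addr_ge0 ?cabs_ge0 ?beta_ge0. Qed.

Lemma holoM f g : holomorphic D f -> holomorphic D g -> holomorphic D (fun z => f z * g z).
Proof.
move=> fh gh z Dz; eexists; apply: has_cgradM; [exact: cgradP fh Dz|exact: cgradP gh Dz].
Qed.

Lemma qratio_cst (c : C) z u : qratio (fun=> c) z u = 0.
Proof. by rewrite /qratio (cgradE (has_cgrad_cst c z)) cdot0 cabs0 mul0r. Qed.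

Lemma Qf_cst (c : C) z : Qf D (fun=> c) z = 0.
Proof.
apply/le_anti/andP; split; first by apply: Qf_le => u _; rewrite qratio_cst.
apply: ub_le_sup; first by exists 0 => _ [u _ <-]; rewrite -/(qratio _ z u) qratio_cst.
by exists (ereal_dir R (Ordinal n0)); [exact: ereal_dir_neq0|exact: qratio_cst].
Qed.

Lemma bloch_cst (c : C) : bloch D (fun=> c).
Proof.
split; first exact: holo_cst.
by exists 0 => z u _ _; rewrite -/(qratio _ z u) qratio_cst.
Qed.

Lemma little_bloch_cst (c : C) : little_bloch D (fun=> c).
Proof. by split; [exact: bloch_cst|move=> e e0; exists 1 => // z _ _; rewrite Qf_cst]. Qed.

Lemma half_bound (x y e : R) : 0 <= x -> 0 <= y -> y < e / (2 * (x + 1)) -> x * y < e / 2.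
Proof.
move=> x0 y0; have x1 : 0 < x + 1 by rewrite ltr_pwDr.
rewrite invfM mulrA ltr_pdivlMr //; apply: le_lt_trans.
by rewrite mulrC; apply: ler_wpM2l => //; rewrite lerDl.
Qed.

(** * Multiplication by the resolvent *)

Section Resolvent.
Variables (psi : V -> C) (lam : C).
Hypothesis psih : holomorphic D psi.
Let phi z : C := (psi z - lam)^-1.

Lemma resolvent_cgrad z : D z -> psi z != lam ->
  has_cgrad phi z (vscale (- phi z ^+ 2) (cgrad psi z)).
Proof.
move=> Dz pl; have h := has_cgradD (cgradP psih Dz) (has_cgrad_cst (- lam) z).
have pl0 : fadd psi (fun=> - lam) z != 0 by rewrite /fadd subr_eq0.
have := has_cgradV pl0 h; congr has_cgrad; apply/funext => j.
by rewrite /vscale /vadd /vzero addr0 /phi /fadd exprVn.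
Qed.

Lemma resolvent_holo : (forall z, D z -> psi z != lam) -> holomorphic D phi.
Proof. by move=> pl z Dz; eexists; apply: resolvent_cgrad => //; exact: pl. Qed.

Section BoundedBelow.
Variable d : R.
Hypotheses (d0 : 0 < d) (psid : forall z, D z -> d <= cabs (psi z - lam)).

Lemma psi_neq z : D z -> psi z != lam.
Proof. by move=> /psid h; rewrite -subr_eq0 -cabs_gt0; exact: lt_le_trans h. Qed.

Lemma phi_le z : D z -> cabs (phi z) <= d^-1.
Proof.
move=> Dz; rewrite /phi cabsV lef_pV2 ?posrE ?psid //.
exact: lt_le_trans (psid Dz).
Qed.

Let C1 := d^-1 * (2 + cabs lam / d).
Let C2 := d^-1 ^+ 2.

Lemma C1_ge0 : 0 <= C1.
Proof. by rewrite /C1 mulr_ge0 ?invr_ge0 ?(ltW d0) // addr_ge0 // divr_ge0 ?cabs_ge0 // ltW. Qed.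
Lemma C2_ge0 : 0 <= C2. Proof. exact: sqr_ge0. Qed.

(* Since [phi psi = 1 + lam phi] is bounded, the term [f grad psi] can be traded for
   [grad (psi f) - psi grad f]. *)
Lemma qratio_resolvent f z u : holomorphic D f -> D z ->
  qratio (fun z => phi z * f z) z u <= C1 * qratio f z u + C2 * qratio (mult_op psi f) z u.
Proof.
move=> fh Dz; have fg := cgradP fh Dz; have pg := cgradP psih Dz.
have pl := psi_neq Dz.
rewrite /qratio (cgradE (has_cgradM (resolvent_cgrad Dz pl) fg)).
rewrite (cgradE (has_cgradM pg fg)) !mulrA -mulrDl.
apply: ler_wpM2r; first by rewrite invr_ge0 sqrtr_ge0.
rewrite !cdotD !cdotZ.
set a := cdot (cgrad psi z) u; set b := cdot (cgrad f z) u.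
have pl0 : psi z - lam != 0 by rewrite subr_eq0.
have -> : f z * (- phi z ^+ 2 * a) + phi z * b =
  phi z * (2 + lam * phi z) * b - phi z ^+ 2 * (f z * a + psi z * b).
  by rewrite /phi; field.
apply: le_trans (cabsB _ _) _; rewrite (cabsM _ b) (cabsM (phi z)) (cabsM (phi z ^+ 2)) cabsX.
have p0 := cabs_ge0 (phi z); have pd := phi_le Dz; have di : 0 <= d^-1 by exact: le_trans pd.
apply: lerD; apply: ler_wpM2r; rewrite ?cabs_ge0 //; last first.
  by rewrite /C2 ler_pXn2r ?nnegrE.
rewrite /C1; apply: ler_pM; rewrite ?cabs_ge0 //.
apply: le_trans (cabsD _ _) _; apply: lerD.
  by rewrite (_ : (2 : C) = ((2 : R)%:C)%C) ?cabs_real ?ger0_norm // rmorph_nat.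
by rewrite cabsM; apply: ler_wpM2l; rewrite ?cabs_ge0.
Qed.

Lemma bloch_resolvent f : bloch D f -> bloch D (mult_op psi f) ->
  bloch D (fun z => phi z * f z).
Proof.
move=> [fh [M MP]] [_ [M' M'P]]; split.
  by apply: holoM => //; apply: resolvent_holo => z; exact: psi_neq.
exists (C1 * M + C2 * M') => z u Dz u0; rewrite -/(qratio _ z u).
apply: le_trans (qratio_resolvent u fh Dz) _.
by apply: lerD; apply: ler_wpM2l; rewrite ?C1_ge0 ?C2_ge0 //; [exact: MP|exact: M'P].
Qed.

Lemma Qf_resolvent f z : bloch D f -> bloch D (mult_op psi f) -> D z ->
  Qf D (fun z => phi z * f z) z <= C1 * Qf D f z + C2 * Qf D (mult_op psi f) z.
Proof.
move=> fb pfb Dz; have [fh _] := fb; apply: Qf_le => u u0.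
apply: le_trans (qratio_resolvent u fh Dz) _.
by apply: lerD; apply: ler_wpM2l; rewrite ?C1_ge0 ?C2_ge0 //; exact: qratio_le_Qf.
Qed.

Lemma little_bloch_resolvent f : little_bloch D f -> little_bloch D (mult_op psi f) ->
  little_bloch D (fun z => phi z * f z).
Proof.
move=> [fb fl] [pfb pfl]; split; first exact: bloch_resolvent.
move=> e e0; have c1 := C1_ge0; have c2 := C2_ge0.
have e1 : 0 < e / (2 * (C1 + 1)) by rewrite divr_gt0 // mulr_gt0 // ltr_pwDr.
have e2 : 0 < e / (2 * (C2 + 1)) by rewrite divr_gt0 // mulr_gt0 // ltr_pwDr.
have [a a0 aP] := fl _ e1; have [b b0 bP] := pfl _ e2.
exists (Num.min a b); first by rewrite lt_min a0.
move=> z Dz [w wb]; rewrite lt_min => /andP[za zb].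
apply: le_lt_trans (Qf_resolvent fb pfb Dz) _.
have q1 := aP z Dz (ex_intro2 _ _ w wb za); have q2 := bP z Dz (ex_intro2 _ _ w wb zb).
have f0 := Qf_ge0 fb Dz; have g0 := Qf_ge0 pfb Dz.
rewrite [e]splitr; apply: ltrD; exact: half_bound.
Qed.

Lemma resolvent_norm f (c : R) : bloch D f -> bloch D (mult_op psi f) ->
  bloch_norm D (mult_op psi f) <= c * bloch_norm D f ->
  bloch_norm D (fun z => phi z * f z) <= (d^-1 + C1 + C2 * c) * bloch_norm D f.
Proof.
move=> fb pfb hc; have c1 := C1_ge0; have c2 := C2_ge0; have di : 0 <= d^-1 by rewrite invr_ge0 ltW.
have nf : bloch_norm D f = cabs (f (@vzero R n)) + beta D f by [].
have bf := beta_ge0 fb; have f0 := cabs_ge0 (f (@vzero R n)).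
rewrite !mulrDl /bloch_norm -addrA; apply: lerD.
  rewrite cabsM; apply: ler_pM; rewrite ?cabs_ge0 ?phi_le // lerDl //.
apply: beta_le => z Dz; apply: le_trans (Qf_resolvent fb pfb Dz) _; apply: lerD.
  apply: ler_wpM2l => //; apply: le_trans (Qf_le_beta fb Dz) _; by rewrite lerDr.
rewrite -mulrA; apply: ler_wpM2l => //; apply: le_trans hc.
by apply: le_trans (Qf_le_beta pfb Dz) _; rewrite lerDr cabs_ge0.
Qed.

End BoundedBelow.

(** * Powers of the resolvent and the converse inclusion *)

Lemma cgrad_pow z k : D z -> psi z != lam ->
  has_cgrad (fun w => phi w ^+ k.+1) z (vscale (k.+1%:R * phi z ^+ k) (cgrad phi z)).
Proof.
move=> Dz pl; have pg := resolvent_cgrad Dz pl; have pE := cgradE pg.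
rewrite -pE in pg; elim: k => [|k IH].
  rewrite expr0 mulr1 (_ : vscale 1 _ = cgrad phi z).
    by under [X in has_cgrad X]eq_fun do rewrite expr1.
  by apply/funext => j; rewrite /vscale mul1r.
under [X in has_cgrad X]eq_fun do rewrite exprS.
have := has_cgradM pg IH; congr has_cgrad; apply/funext => j.
by rewrite /vadd /vscale [in RHS]exprS -[in RHS]natr1 exprS; ring.
Qed.

(** Thanks to the factor [k + 1], a single [k] refutes [c < s]: one with [(k + 1) rho > c], since
    [c ^ (k + 1) <= c s ^ k]. *)
Lemma pow_bound (s c rho : R) : 0 <= c -> 0 < rho ->
  (forall k, k.+1%:R * s ^+ k * rho <= c ^+ k.+1) -> s <= c.
Proof.
move=> c0 rho0 h; rewrite leNgt; apply/negP => cs.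
have s0 : 0 < s by exact: le_lt_trans cs.
pose k := Num.truncn (c / rho).
have := h k; rewrite leNgt => /negP; apply.
have sk : 0 < s ^+ k by rewrite exprn_gt0.
apply: (@le_lt_trans _ _ (c * s ^+ k)).
  by rewrite exprS; apply: ler_wpM2l => //; apply: lerXn2r; rewrite ?nnegrE //; exact: ltW.
rewrite mulrAC ltr_pM2r // -ltr_pdivrMr //; exact: truncnS_gt.
Qed.

(** The mean value theorem is real, so it is applied along the segment to the real and the imaginary
    part, for which [P] stands. *)
Lemma zero_cgrad_segment (f : V -> C) z w :
  (forall t : R, 0 <= t <= 1 -> has_cgrad f (vline z (vsub w z) t) (@vzero R n)) -> f w = f z.
Proof.
move=> fz; pose v := vsub w z.
have key (P : C -> R) : (forall c c', P (c - c') = P c - P c') ->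
    (forall c, `|P c| <= cabs c) -> P (f w) = P (f z).
  move=> PB Pc; pose g (t : R) : R := P (f (vline z v t)).
  have gl (t : R) : 0 <= t <= 1 -> forall e : R, 0 < e -> exists2 d : R, 0 < d &
      forall s : R, `|s| < d -> `|g (t + s) - g t| <= e * `|s|.
    move=> t01 e e0; have h := cderiv_line (v := v) (fz t t01).
    have [d d0 dP] := h e e0; exists d => // s sd.
    have := dP (s%:C)%C; rewrite cabs_real cdot0 mul0r subr0 -rmorphD => /(_ sd) hh.
    by apply: le_trans hh; rewrite /g -PB; exact: Pc.
  have gd (t : R) : 0 <= t <= 1 -> is_derive t 1 g 0.
    move=> t01.
    have cv : h^-1 *: (g (h *: 1 + t) - g t) @[h --> 0^'] --> (0 : R).
      apply/cvgrPdist_le => e e0; have [d d0 dP] := gl t t01 e e0.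
      exists d => // s /=; rewrite sub0r normrN => sd s0.
      rewrite sub0r normrN /GRing.scale /= mulr1 normrM normfV mulrC.
      by rewrite ler_pdivrMr ?normr_gt0 // (addrC s t); exact: dP.
    by apply: DeriveDef; [apply/cvg_ex; exists 0|exact: cvg_lim].
  have gc : {within `[0, 1], continuous g}.
    apply: continuous_in_subspaceT => t; rewrite inE /= in_itv /= => t01.
    by apply/differentiable_continuous/derivable1_diffP; have [] := gd t t01.
  have [|c _] := @MVT R g (fun=> 0) 0 1 ltr01 _ gc.
    by move=> t; rewrite in_itv /= => /andP[t0 t1]; apply: gd; rewrite !ltW.
  rewrite mul0r => /eqP; rewrite subr_eq0 => /eqP.
  rewrite /g vline0 (_ : vline z v 1 = w) //.
  by apply/funext => j; rewrite /vline /vadd /vscale /v /vsub mul1r addrC subrK.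
apply: complexP; apply: key => [c c'|c].
- by rewrite ReD ReN.
- exact: Re_le_cabs.
- by rewrite ImD ImN.
- exact: Im_le_cabs.
Qed.

(* The set where [f] equals [f z0] is open, as [f] is locally constant where [|f| > c]. *)
Lemma holo_const (f : V -> C) (c : R) z0 : holomorphic D f -> D z0 -> c < cabs (f z0) ->
  (forall z, D z -> c < cabs (f z) -> cgrad f z = @vzero R n) ->
  forall z, D z -> f z = f z0.
Proof.
move=> fh Dz0 cz fg.
have nearc z : D z -> forall e : R, 0 < e -> exists2 r : R, 0 < r &
    forall w, vdist z w < r -> D w /\ cabs (f w - f z) < e.
  move=> Dz e e0; have [a fa] := fh _ Dz; have [r r0 rP] := has_cgrad_cont fa e0.
  have [r' r'0 r'P] := Do Dz; exists (Num.min r r'); first by rewrite lt_min r0.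
  by move=> w; rewrite lt_min => /andP[/rP h /r'P].
have Po : openV [set z | D z /\ f z = f z0].
  move=> z [Dz fz]; have e0 : 0 < cabs (f z) - c by rewrite fz subr_gt0.
  have [r r0 rP] := nearc _ Dz _ e0; exists r => // w zw.
  split; first by have [] := rP _ zw.
  rewrite -fz; apply: zero_cgrad_segment => t /andP[t0 t1].
  have h : vdist z (vline z (vsub w z) t) < r.
    rewrite vdist_vadd vnormZ cabs_real ger0_norm //.
    apply: le_lt_trans zw; rewrite -[leRHS]mul1r (vdistC z w).
    by apply: ler_wpM2r => //; exact: vnorm_ge0.
  have [Dw fw] := rP _ h; rewrite -(fg _ Dw); first exact: cgradP fh Dw.
  have := cabs_dist (f z) (f (vline z (vsub w z) t)) 0; rewrite !subr0 cabsBC; lra.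
have Qo : openV [set z | D z /\ f z <> f z0].
  move=> z [Dz /eqP fz]; have e0 : 0 < cabs (f z - f z0) by rewrite cabs_gt0 subr_eq0.
  have [r r0 rP] := nearc _ Dz _ e0; exists r => // w zw; have [Dw fw] := rP _ zw.
  by split=> // E; rewrite E cabsBC ltxx in fw.
have [||h|h] := Dc Po Qo; last by have [] := h _ Dz0.
- by move=> z Dz /=; have [->|/eqP ne] := eqVneq (f z) (f z0); [left|right].
- by apply/seteqP; split=> // z [[[_ e] [_ ne]] _]; exact: ne.
- by move=> z Dz; have [] := h _ Dz.
Qed.

(** [X] stands for either space: the argument uses only that it lies in [bloch D], contains 1 and is
    stable under the resolvent. *)
Lemma spectrum_eq (X : set (V -> C)) : X `<=` bloch D -> X (fun=> 1) ->
  (forall d : R, 0 < d -> (forall z, D z -> d <= cabs (psi z - lam)) ->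
     forall f, X f -> X (mult_op psi f) -> X (fun z => phi z * f z)) ->
  bounded_op X (bloch_norm D) (mult_op psi) ->
  spectrum D X (bloch_norm D) (mult_op psi) lam <-> cclosure (psi @` D) lam.
Proof.
move=> Xb X1 Xphi [TX [c0 Tc]]; split.
  move=> sp; apply: contrapT => ncl; apply: sp.
  have [d d0 dP] : exists2 d : R, 0 < d & forall z, D z -> d <= cabs (psi z - lam).
    apply: contrapT => nd; apply: ncl => e e0; apply: contrapT => ne; apply: nd.
    exists e => // z Dz; rewrite leNgt; apply/negP => h; apply: ne.
    by exists (psi z); [exists z|rewrite cabsBC].
  exists (fun f z => phi z * f z); split.
  - split=> [f Xf|]; first by apply: (Xphi d) => //; exact: TX.
    exists (d^-1 + (d^-1 * (2 + cabs lam / d)) + (d^-1 ^+ 2) * c0) => f Xf.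
    by apply: (resolvent_norm d0 dP) => //; [exact: Xb|apply: Xb; exact: TX|exact: Tc].
  - move=> f Xf z Dz; have := psi_neq d0 dP Dz; rewrite -subr_eq0 => pl.
    by rewrite /mult_op /phi; field.
  - move=> f Xf z Dz; have := psi_neq d0 dP Dz; rewrite -subr_eq0 => pl.
    by rewrite /mult_op /phi; field.
move=> cl [S [[SX [c Sc]] _ TS]].
(* Applied to the constant 1, the right inverse gives [(psi z - lam) * S 1 z = 1]. *)
have pl z : D z -> psi z != lam.
  move=> Dz; apply/negP => /eqP E; have := TS _ X1 z Dz.
  by rewrite /mult_op E subrr => /eqP; rewrite eq_sym oner_eq0.
have SE f : X f -> forall z, D z -> S f z = phi z * f z.
  move=> Xf z Dz; have := TS f Xf z Dz; rewrite /mult_op -mulrBl => <-.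
  by rewrite /phi mulrA mulVf ?mul1r // subr_eq0 pl.
(* On [D] the iterates of [S] on 1 are the powers of [phi]; starting from a function of norm 1, they
   have norm at most [K ^ k]. *)
pose G k := iter k S (fun=> 1).
have GX k : X (G k) by elim: k => //= k IH; exact: SX.
have GE k z : D z -> G k z = phi z ^+ k.
  move=> Dz; elim: k => [|k IH]; first by rewrite expr0.
  by rewrite /G iterS -/(G k) SE // IH exprS.
(* The constant in [bounded_op] carries no sign, and powers of it are compared below. *)
pose K := `|c|.
have Gn k : bloch_norm D (G k) <= K ^+ k.
  elim: k => [|k IH].
    rewrite expr0 /bloch_norm /G /= cabs1 -[leRHS]addr0 lerD2l; apply: beta_le => z _.
    by rewrite Qf_cst.
  have h0 := bloch_norm_ge0 (Xb _ (GX k)).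
  apply: (le_trans (Sc _ (GX k))); rewrite exprS.
  apply: (@le_trans _ _ (K * bloch_norm D (G k))).
    by apply: ler_wpM2r => //; exact: ler_norm.
  by apply: ler_wpM2l => //; exact: normr_ge0.
have phih := resolvent_holo pl.
have bigz z : D z -> K < cabs (phi z) -> cgrad phi z = @vzero R n.
  move=> Dz Kz; apply/funext => j; apply/eqP; rewrite /vzero -cdot_ereal.
  apply/negPn/negP => gj; move: Kz; rewrite ltNge => /negP; apply.
  have u0 := @ereal_dir_neq0 j; set u := ereal_dir R j in gj u0.
  have r0 := qratio_gt0 Dz u0 gj.
  apply: (pow_bound (normr_ge0 c) r0) => k.
  (* [G k.+1] is known on [D] only; openness of [D] transfers the gradient of the power to it. *)
  have gk : has_cgrad (G k.+1) z (vscale (k.+1%:R * phi z ^+ k) (cgrad phi z)).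
    apply: (@has_cgrad_eq_on (fun w => phi w ^+ k.+1)) => //; last first.
      by apply: cgrad_pow => //; exact: pl.
    by move=> w Dw; rewrite GE.
  have qk : qratio (G k.+1) z u = k.+1%:R * cabs (phi z) ^+ k * qratio phi z u.
    rewrite /qratio (cgradE gk) cdotZ !cabsM cabsX !mulrA; congr (_ * _ * _ * _).
    by rewrite (_ : (k.+1%:R : C) = ((k.+1%:R : R)%:C)%C) ?cabs_real ?ger0_norm // rmorph_nat.
  rewrite -qk; apply: le_trans (Gn k.+1).
  have Gb := Xb _ (GX k.+1).
  apply: le_trans (qratio_le_Qf Gb Dz u0) _; apply: le_trans (Qf_le_beta Gb Dz) _.
  by rewrite lerDr cabs_ge0.
have K1 : 0 < K + 1 by rewrite ltr_wpDl // normr_ge0.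
have Ki : 0 < (K + 1)^-1 by rewrite invr_gt0.
(* A value of [psi] within [1 / (K + 1)] of [lam] makes [|phi| > K + 1]. *)
have [_ [z0 Dz0 <-] lz0] := cl _ Ki.
have phiz0 : K < cabs (phi z0).
  rewrite /phi cabsV -cabsBC.
  have l0 : 0 < cabs (lam - psi z0) by rewrite cabs_gt0 subr_eq0 eq_sym pl.
  apply: (@lt_trans _ _ (K + 1)); first by rewrite ltrDl.
  by rewrite -[ltLHS]invrK ltf_pV2 ?posrE.
have pc := holo_const phih Dz0 phiz0 bigz.
have psic z : D z -> psi z = psi z0.
  move=> Dz; have := pc z Dz; rewrite /phi => /invr_inj /eqP.
  by rewrite -subr_eq0 opprB addrA subrK subr_eq0 => /eqP.
have := pl _ Dz0; apply/negP/negPn/eqP/esym/eqP; rewrite -subr_eq0; apply/eqP/cabs_le0/le_eps => e e0.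
have [_ [z Dz <-] lz] := cl _ e0; rewrite (psic _ Dz) in lz.
by rewrite add0r ltW.
Qed.

End Resolvent.

End Bloch.

Unset Implicit Arguments.

Theorem mainTheorem8 (R : realType) (n : nat) (D : set (cvec R n)) (psi : cvec R n -> R[i]) :
  (0 < n)%N -> domainV D -> boundedV D -> homogeneous D -> D (@vzero R n) ->
  holomorphic D psi ->
  (bounded_op (bloch D) (bloch_norm D) (mult_op psi) ->
     spectrum D (bloch D) (bloch_norm D) (mult_op psi) = cclosure (psi @` D)) /\
  (bounded_op (little_bloch D) (bloch_norm D) (mult_op psi) ->
     spectrum D (little_bloch D) (bloch_norm D) (mult_op psi) = cclosure (psi @` D)).
Proof.
move=> n0 [Do [Dc _]] Db _ D0 psih; split=> T.
- have key lam := @spectrum_eq R n D n0 Do Dc Db D0 psi lam psih (bloch D)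
    (fun f => id) (bloch_cst D 1) (fun d d0 dP => bloch_resolvent psih d0 dP) T.
  by apply/seteqP; split=> lam; have [] := key lam.
- have key lam := @spectrum_eq R n D n0 Do Dc Db D0 psi lam psih (little_bloch D)
    (fun f => @proj1 _ _) (little_bloch_cst D n0 1)
    (fun d d0 dP => little_bloch_resolvent n0 psih d0 dP) T.
  by apply/seteqP; split=> lam; have [] := key lam.
Qed.
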